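(* Let $B\in\mathcal L(U,H)$, $E\in\mathcal L(H,Y)$, $Q=E^*E$, $S=BB^*$, $P_0\in\Sigma^+(H)$, and let $A:\mathcal D(A)\subset H\to H$ be the generator of an analytic semigroup on $H$. Assume in addition that $P_0\in\mathcal D(\mathcal A)$. Let $P$ be the solution on $[0,T]$ of $$\dot P=\mathcal A P+Q-PSP,\qquad P(0)=P_0,$$ and let $\mathcal L_\tau=\mathrm e^{\tau F}\mathrm e^{\tau G}$ be the Lie splitting operator. Then there exist constants $D,\tau^*>0$, depending only on $\|P\|_\infty$, $\|\dot P\|_\infty$, $T$, $\|S\|_{\mathcal L(H)}$, $\|Q\|_{\mathcal L(H)}$ (and on the fixed operator $A$ through the semigroup constant $C_A$ of the context), such that for every step size $\tau=T/N$, $N\in\mathbb N$, with $\tau\le\tau^*$ and every $n\in\{0,\dots,N\}$, $$\|P(n\tau)-\mathcal L_\tau^nP_0\|_{\mathcal L(H)}\le D\,\tau\,(1+|\log\tau|).$$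
   Context: $H$ is a complex Hilbert space, $U,Y$ are Hilbert spaces, $T>0$. $\mathcal L(X,Y)$ is the space of bounded linear operators, $\mathcal L(H)=\mathcal L(H,H)$. $\Sigma(H)=\{P\in\mathcal L(H): P=P^*\}$ with the $\mathcal L(H)$-norm and $\Sigma^+(H)=\{P\in\Sigma(H):P\ge0\}$. Operator $\mathcal A$: for $P\in\Sigma(H)$ put $\varphi_P(x,y)=(Px,Ay)+(Ax,Py)$, $x,y\in\mathcal D(A)$. $\mathcal D(\mathcal A)$ is the set of $P\in\Sigma(H)$ for which $\varphi_P$ is continuous with respect to the norm of $H\times H$ (i.e. $|\varphi_P(x,y)|\le C\|x\|\|y\|$ for $x,y\in\mathcal D(A)$), and $\mathcal A(P)\in\Sigma(H)$ is the operator with $(\mathcal A(P)x,y)=\varphi_P(x,y)$ for $x,y\in\mathcal D(A)$. The associated semigroup on $\Sigma(H)$ is $\mathrm e^{t\mathcal A}P=\mathrm e^{tA^*}P\mathrm e^{tA}$, $t\ge0$. Function spaces: $C_p([0,T],\Sigma(H))$ is the set of $t\mapsto P(t)\in\Sigma(H)$ such that $t\mapsto P(t)x$ is continuous on $[0,T]$ for every $x\in H$, with norm $\|P\|_\infty=\sup_{t\in(0,T)}\|P(t)\|_{\mathcal L(H)}$; $C_p^k([0,T],\Sigma(H))$ consists of those $P$ for which $t\mapsto P(t)x$ is $k$ times differentiable for every $x\in H$, with $k$-th derivative in $C_p([0,T],\Sigma(H))$. Solution: the solution $P$ of the equation is the unique $P\in C_p([0,T],\Sigma(H))$ with $P(0)=P_0$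 such that for $t\in(0,T)$ $P$ is differentiable in $\mathcal L(H)$, $P(t)\in\mathcal D(\mathcal A)\cap\Sigma^+(H)$ and the equation holds. It is known to exist, to satisfy $P(t)\in\Sigma^+(H)$ for $t\in[0,T]$, to be infinitely differentiable in $\mathcal L(H)$ with bounded derivatives on $[\varepsilon,T]$ for every $\varepsilon>0$, and to lie in $C_p^1([0,T],\Sigma(H))$ if $P_0\in\mathcal D(\mathcal A)$. Splitting: $FP=\mathcal AP+Q$ and $GP=-PSP$. For $P_1\in\Sigma^+(H)$, $\mathrm e^{tF}P_1=\mathrm e^{t\mathcal A}P_1+\int_0^t\mathrm e^{(t-s)\mathcal A}Q\,\mathrm ds$ (integral in the pointwise sense on $H$) is the solution at time $t$ of $\dot P=FP$, $P(0)=P_1$, and $\mathrm e^{tG}P_1$ is the solution at time $t$ of $\dot P=GP$, $P(0)=P_1$. These flows map $\Sigma^+(H)$ to itself. $C_A$ denotes a constant with $\|\mathrm e^{tA}\|_{\mathcal L(H)}\le C_A$ and $\|A\mathrm e^{tA}\|_{\mathcal L(H)}\le C_A/t$ for $t\in(0,T]$. *)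

(* Defs.v *)
From HB Require Import structures.
From mathcomp Require Import all_boot all_order all_algebra.
From mathcomp Require Import complex.
From mathcomp Require Import all_classical all_reals all_analysis.
Set Implicit Arguments.
Unset Strict Implicit.
Unset Printing Implicit Defensive.
Import Order.TTheory GRing.Theory Num.Theory.
Import numFieldNormedType.Exports.
Local Open Scope classical_set_scope.
Local Open Scope complex_scope.
Local Open Scope ring_scope.

(* Complex Hilbert spaces: complete normed spaces over R[i] whose norm comes
   from a positive definite Hermitian form, linear in its first argument and
   conjugate-linear in its second one. *)
HB.mixin Record NormedModule_isHilbert (R : realType) H
    of CompleteNormedModule R[i] H := {
  inner : {dot H for (@Num.conj R[i])};
  inner_normE : forall x : H, `|x| ^+ 2 = inner x x
}.

#[short(type="hilbertType")]
HB.structure Definition Hilbert (R : realType) :=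
  {H of NormedModule_isHilbert R H & CompleteNormedModule R[i] H}.

(* In a normed space over R[i], `|x| is a nonnegative element of R[i]; this is
   the same number as an element of R. *)
Definition rnorm (R : realType) (V : normedModType R[i]) (x : V) : R :=
  complex.Re `|x|.

Section BoundedOperators.
Context {R : realType}.

Definition bounded_linear (V W : normedModType R[i]) (f : V -> W) : Prop :=
  linear f /\ exists M : R, forall x, rnorm (f x) <= M * rnorm x.

(* +oo on maps that are unbounded on the unit ball. *)
Definition opnorm (V W : normedModType R[i]) (f : V -> W) : \bar R :=
  ereal_sup [set (rnorm (f x))%:E | x in [set x | rnorm x <= 1]].

Definition adj (V W : hilbertType R) (f : V -> W) : W -> V :=
  fun y => xget 0 [set z | forall x, inner (f x) y = inner x z].

(* Riemann integral of a vector-valued function on [a, b]: v is the limit of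
   the tagged Riemann sums as the mesh of the partition tends to 0. *)
Definition is_rint (V : normedModType R[i]) (f : R -> V) (a b : R) (v : V) :
    Prop :=
  forall e : R, 0 < e -> exists2 d : R, 0 < d &
    forall (s : seq R) (xi : nat -> R), itv_partition a b s ->
      (forall i, (i < size s)%N ->
         [/\ nth 0 (a :: s) i <= xi i, xi i <= nth 0 s i
           & nth 0 s i - nth 0 (a :: s) i < d]) ->
      rnorm (\sum_(i < size s)
        (nth 0 s i - nth 0 (a :: s) i)%:C *: f (xi i) - v) < e.

Definition rint (V : normedModType R[i]) (a b : R) (f : R -> V) : V :=
  xget 0 [set v | is_rint f a b v].

End BoundedOperators.

Section Semigroups.
Context {R : realType} {H : hilbertType R}.

Definition sector (delta : R) : set R[i] :=
  [set z | exists r theta : R,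
     [/\ 0 < r, `|theta| < delta & z = (r * cos theta) +i* (r * sin theta)]].

(* [S z] plays the role of e^{zA}; its values outside the sector and 0 are
   irrelevant. *)
Definition analytic_semigroup (S : R[i] -> H -> H) : Prop :=
  exists delta : R,
    0 < delta <= pi / 2 /\
    [/\ S 0 = id,
        forall z, sector delta z -> bounded_linear (S z),
        forall z w, sector delta z -> sector delta w ->
          S (z + w) = S z \o S w,
        forall z, sector delta z -> exists V : H -> H, bounded_linear V /\
          opnorm (h^-1 \*: (S (z + h) \- S z) \- V)
            @[h --> (0 : R[i]^o)^'] --> 0%E
      & forall x : H,
          S z x @[z --> within (sector delta) (nbhs (0 : R[i]^o))] --> x].

(* The unbounded operator A with domain DA is the infinitesimal generator of
   t |-> S t, t >= 0; the values of A outside DA are irrelevant. *)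
Definition is_generator (S : R[i] -> H -> H) (DA : set H) (A : H -> H) :
    Prop :=
  forall x y : H,
    DA x /\ A x = y <->
    (h^-1)%:C *: (S h%:C x - x) @[h --> (0 : R)^'+] --> y.

End Semigroups.

Section RiccatiEquation.
Context {R : realType} {H : hilbertType R}.
Implicit Types P Q S X W Z : H -> H.

Definition Sigma : set (H -> H) := [set P | bounded_linear P /\ adj P = P].

Definition SigmaP : set (H -> H) :=
  [set P | Sigma P /\ forall x, 0 <= inner (P x) x].

Definition Cp (T : R) (P : R -> H -> H) : Prop :=
  (forall t, t \in `[0, T] -> Sigma (P t)) /\
  (forall x : H, {within `[0, T], continuous (fun t => P t x)}).

Definition norm_inf (T : R) (P : R -> H -> H) : \bar R :=
  ereal_sup [set opnorm (P t) | t in `]0, T[].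

(* V is the derivative of P at t in the norm of L(H). *)
Definition is_opderive (P : R -> H -> H) (t : R) (V : H -> H) : Prop :=
  bounded_linear V /\
  opnorm ((h^-1)%:C \*: (P (t + h) \- P t) \- V) @[h --> (0 : R)^'] --> 0%E.

Definition opderive (P : R -> H -> H) (t : R) : H -> H :=
  xget (fun=> 0) [set V | is_opderive P t V].

Definition phiA (A : H -> H) P (x y : H) : R[i] :=
  inner (P x) (A y) + inner (A x) (P y).

Definition calA_dom (DA : set H) (A : H -> H) : set (H -> H) :=
  [set P | Sigma P /\ exists C : R, forall x y, DA x -> DA y ->
     `|phiA A P x y| <= (C * rnorm x * rnorm y)%:C].

(* The graph of the operator written calligraphic A: P is in its domain and Z
   is the value at P, which is unique since DA is dense. *)
Definition calA_graph (DA : set H) (A : H -> H) P Z : Prop :=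
  [/\ calA_dom DA A P, Sigma Z &
      forall x y, DA x -> DA y -> inner (Z x) y = phiA A P x y].

(* P is the solution on [0, T] of P' = Phi(P), P(0) = P1, where the right-hand
   side, which may be defined only on a subset of operators, is given by its
   graph. *)
Definition is_solution (Phi : (H -> H) -> (H -> H) -> Prop) (T : R)
    (P1 : H -> H) (P : R -> H -> H) : Prop :=
  [/\ Cp T P, P 0 = P1 &
      forall t, t \in `]0, T[ ->
        [/\ exists V, is_opderive P t V, SigmaP (P t) &
            Phi (P t) (opderive P t)]].

Definition riccati_rhs (DA : set H) (A : H -> H) Q S X W : Prop :=
  exists2 Z, calA_graph DA A X Z & W = Z \+ Q \- (X \o S \o X).

Definition G_rhs S X W : Prop := W = \- (X \o S \o X).

(* e^{t calA} P = e^{tA^*} P e^{tA}, where e^{tA^*} is the adjoint of e^{tA}. *)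
Definition exp_calA (eA : R[i] -> H -> H) (t : R) P : H -> H :=
  adj (eA t%:C) \o P \o eA t%:C.

Definition exp_F (eA : R[i] -> H -> H) Q (t : R) P1 : H -> H :=
  fun x => exp_calA eA t P1 x + rint 0 t (fun s => exp_calA eA (t - s) Q x).

Definition exp_G S (t : R) P1 : H -> H :=
  xget (fun=> 0) [set X | exists2 V, is_solution (G_rhs S) t P1 V & X = V t].

Definition lie (eA : R[i] -> H -> H) Q S (tau : R) : (H -> H) -> H -> H :=
  exp_F eA Q tau \o exp_G S tau.

End RiccatiEquation.

(* Main.v *)
Require Import Defs.
From HB Require Import structures.
From mathcomp Require Import all_boot all_order all_algebra.
From mathcomp Require Import complex.
From mathcomp Require Import all_classical all_reals all_analysis.
From mathcomp Require Import ring lra.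
Import Order.TTheory GRing.Theory Num.Theory.
Import numFieldNormedType.Exports.
Local Open Scope classical_set_scope.
Local Open Scope complex_scope.
Local Open Scope ring_scope.

Set Implicit Arguments.
Unset Strict Implicit.
Unset Printing Implicit Defensive.

(** The operators are tested through the real part [rip] of the inner product:
a bounded operator [X] is controlled by the scalars [rip (X x) y], and every
estimate is the mean value theorem applied to a real function of time.

The two facts behind the theorem are the following. First, along backward
orbits of the semigroup the unbounded terms of the Riccati equation cancel:
[rip (P (t + s) a) b], where [a], [b] are the orbits [e^{(r - s) A} x] and
[e^{(r - s) A} y], has derivative [rip (Q a) b - rip (S (P a)) (P b)]
([ric_evol]). This is the variation of constants formula in weak form, and it
needs no integral of operators. Second, for an analytic semigroup
[|e^{bA} x - e^{aA} x|] is at most [(b - a) C / a |x|] ([sg_dist]).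

For one step from the exact value [P t], the difference between [P (t + tau)]
and the splitting is the increment over [[0, tau]] of a function whose
derivative compares [S P P] along the solution and the moving orbit with
[S W W] along the quadratic flow [W] and the frozen orbit [e^{tau A} x]. The
time increments of [P] and [W] contribute [O(tau)]. Moving the orbit costs
[O(1)] in general, but if the orbit has already been smoothed by [k] further
steps it costs only [O(1 / (k + 1))]. So the local error tested on
[e^{k tau A} x] is [O(tau (tau + 1 / (k + 1)))] ([local_error]).

The global error satisfies a linear recursion with the semigroup as propagator,
up to terms of relative size [tau] because the increment of the quadratic flow
is Lipschitz with constant [O(tau)] ([G_sol_increment_lip]). Summing the local
errors gives [tau] times a harmonic sum, hence the logarithm, and the Lipschitz
terms contribute the factor [(1 + O(tau)) ^+ n] ([global_error_rec]). Bounds on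
the iterates come from positivity: the quadratic flow decreases the form
[rip (X x) x] ([G_sol_le]), so the iterates lie below the affine flow
([lie_iterate]).

Several objects of the statement are given by a choice operator, so their
existence is proved first: adjoints by the Riesz theorem ([riesz]), the integral
of the source term ([is_rint_exists]), and the quadratic flow as
[X (1 + s S X)^-1] ([exp_G_solution]). The norms on which the constants depend
are extended reals; they are finite by the uniform boundedness principle
([norm_inf_fin]) and, for the derivative, by a Gronwall argument that uses that
[P0] lies in the domain of the operator [P |-> A^* P + P A]
([opderive_norm_fin]). *)

(** * Real norms and real inner products *)

Section RealNorm.
Context {R : realType} {V : normedModType R[i]}.
Implicit Types x y z : V.

Lemma rnormE x : `|x| = (rnorm x)%:C.
Proof. by rewrite /rnorm RRe_real // ger0_real. Qed.

Lemma rnorm_ge0 x : 0 <= rnorm x.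
Proof. by rewrite -ler0c -rnormE. Qed.

Lemma rnorm0 : rnorm (0 : V) = 0.
Proof. by rewrite /rnorm normr0. Qed.

Lemma rnorm_eq0 x : rnorm x = 0 -> x = 0.
Proof. by move=> h; apply/normr0_eq0; rewrite rnormE h. Qed.

Lemma rnormN x : rnorm (- x) = rnorm x.
Proof. by rewrite /rnorm normrN. Qed.

Lemma rnormBC x y : rnorm (x - y) = rnorm (y - x).
Proof. by rewrite /rnorm distrC. Qed.

Lemma ler_rnormD x y : rnorm (x + y) <= rnorm x + rnorm y.
Proof. by rewrite -lecR rmorphD /= -!rnormE ler_normD. Qed.

Lemma ler_rnormB x y : rnorm (x - y) <= rnorm x + rnorm y.
Proof. by rewrite -(rnormN y) ler_rnormD. Qed.

Lemma ler_rnorm_distD z x y : rnorm (x - y) <= rnorm (x - z) + rnorm (z - y).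
Proof. by rewrite (le_trans _ (ler_rnormD _ _)) // addrA subrK. Qed.

Lemma normRC (r : R) : `|r%:C| = `|r|%:C.
Proof. by rewrite normc_def /= expr0n /= addr0 sqrtr_sqr. Qed.

Lemma rnormZ (a : R[i]) x : rnorm (a *: x) = complex.Re `|a| * rnorm x.
Proof.
apply/complexI; rewrite -rnormE normrZ rnormE rmorphM /= RRe_real //.
Qed.

Lemma rnormZr (r : R) x : rnorm (r%:C *: x) = `|r| * rnorm x.
Proof. by rewrite rnormZ normRC. Qed.

End RealNorm.

Section RealInner.
Context {R : realType} {H : hilbertType R}.
Implicit Types x y z : H.

(** Real inner product. Together with complex linearity it carries all the
information of [inner], see [inner_rip]. *)
Definition rip x y : R := complex.Re (inner x y).

Lemma ReD (a b : R[i]) : complex.Re (a + b) = complex.Re a + complex.Re b.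
Proof. by case: a b => ? ? [? ?]. Qed.
Lemma ReZ (r : R) (a : R[i]) : complex.Re (r%:C * a) = r * complex.Re a.
Proof. by case: a => a b /=; rewrite mul0r subr0. Qed.

Lemma innerDl x y z : inner (x + y) z = inner x z + inner y z.
Proof. by rewrite linearDl. Qed.
Lemma innerZl (a : R[i]) x z : inner (a *: x) z = a * inner x z.
Proof. by rewrite linearZl_LR. Qed.
Lemma innerZr (a : R[i]) x z : inner z (a *: x) = a^*%C * inner z x.
Proof. by rewrite linearZr_LR. Qed.
Lemma innerC x y : inner x y = (inner y x)^*%C.
Proof. by rewrite hermC /= expr0 mul1r. Qed.

Lemma ripC x y : rip x y = rip y x.
Proof. by rewrite /rip innerC; case: (inner y x). Qed.
Lemma ripDl x y z : rip (x + y) z = rip x z + rip y z.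
Proof. by rewrite /rip innerDl ReD. Qed.
Lemma ripDr x y z : rip z (x + y) = rip z x + rip z y.
Proof. by rewrite !(ripC z) ripDl. Qed.
Lemma ripZl r x z : rip (r%:C *: x) z = r * rip x z.
Proof. by rewrite /rip innerZl ReZ. Qed.
Lemma ripZr r x z : rip z (r%:C *: x) = r * rip z x.
Proof. by rewrite !(ripC z) ripZl. Qed.
Lemma ripNl x z : rip (- x) z = - rip x z.
Proof. by rewrite -scaleN1r -(rmorphN1 (real_complex R)) ripZl mulN1r. Qed.
Lemma ripNr x z : rip z (- x) = - rip z x.
Proof. by rewrite !(ripC z) ripNl. Qed.
Lemma ripBl x y z : rip (x - y) z = rip x z - rip y z.
Proof. by rewrite ripDl ripNl. Qed.
Lemma ripBr x y z : rip z (x - y) = rip z x - rip z y.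
Proof. by rewrite ripDr ripNr. Qed.
Lemma rip0l z : rip 0 z = 0.
Proof. by rewrite -(subrr z) ripBl subrr. Qed.
Lemma rip0r z : rip z 0 = 0.
Proof. by rewrite ripC rip0l. Qed.

Lemma ripxx x : rip x x = rnorm x ^+ 2.
Proof.
rewrite /rip -inner_normE rnormE -rmorphXn /=. by [].
Qed.

Lemma ripZiZ (a : R[i]) x y : rip (a *: x) y = rip x (a^*%C *: y).
Proof. by rewrite /rip innerZl innerZr conjcK. Qed.

(** Identities between inner products can thus be checked on real parts. *)
Lemma inner_rip x y : inner x y = rip x y +i* rip x ('i%C *: y).
Proof. rewrite /rip innerZr; case: (inner x y) => a b /=; congr (_ +i* _); ring. Qed.

(** Expand the square of the norm of [|y| x - |x| y]. *)
Lemma rip_le x y : rip x y <= rnorm x * rnorm y.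
Proof.
have [y0|y0] := eqVneq (rnorm y) 0.
  by rewrite (rnorm_eq0 y0) rip0r rnorm0 mulr0.
have [x0|x0] := eqVneq (rnorm x) 0.
  by rewrite (rnorm_eq0 x0) rip0l rnorm0 mul0r.
have ny : 0 < rnorm y by rewrite lt_def y0 rnorm_ge0.
have nx : 0 < rnorm x by rewrite lt_def x0 rnorm_ge0.
have := sqr_ge0 (rnorm ((rnorm y)%:C *: x - (rnorm x)%:C *: y)).
rewrite -ripxx !(ripBl, ripBr, ripZl, ripZr) !ripxx (ripC y x).
set a := rnorm x in nx *; set b := rnorm y in ny *; set c := rip x y.
have ab : 0 < a * b by rewrite mulr_gt0.
move=> h; have {}h : 0 <= (a * b) * (a * b - c) by nra.
by rewrite -subr_ge0 -(pmulr_rge0 _ ab).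
Qed.

Lemma abs_rip_le x y : `|rip x y| <= rnorm x * rnorm y.
Proof.
by rewrite ler_norml rip_le lerNl -ripNl -(rnormN x) rip_le.
Qed.

(** Test with [y = x]. All operator bounds below are obtained by testing. *)
Lemma rnorm_le_dual x K : 0 <= K -> (forall y, rip x y <= K * rnorm y) ->
  rnorm x <= K.
Proof.
move=> K0 /(_ x); rewrite ripxx expr2.
have [->//|x0] := eqVneq (rnorm x) 0.
by rewrite ler_pM2r // lt_def x0 rnorm_ge0.
Qed.

Lemma rip_ext x y : (forall z, rip x z = rip y z) -> x = y.
Proof.
move=> h; apply/eqP; rewrite -subr_eq0; apply/eqP/rnorm_eq0/eqP.
by rewrite -sqrf_eq0 -ripxx ripBl h subrr.
Qed.

Lemma rnorm_parallelogram x y :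
  rnorm (x + y) ^+ 2 + rnorm (x - y) ^+ 2 = 2 * rnorm x ^+ 2 + 2 * rnorm y ^+ 2.
Proof. rewrite -!ripxx !(ripDl, ripDr, ripNl, ripNr) (ripC y x); ring. Qed.

End RealInner.

(** * Bounded operators *)

Section Operators.
Context {R : realType}.
Implicit Types V W : normedModType R[i].

Section Lin.
Context {V W : normedModType R[i]} {f : V -> W}.
Hypothesis lf : linear f.
Let flin := GRing.isLinear.Build _ _ _ _ f lf.
Let F : {linear V -> W} := HB.pack f flin.
Lemma linD x y : f (x + y) = f x + f y. Proof. exact: (linearD F). Qed.
Lemma linB x y : f (x - y) = f x - f y. Proof. exact: (linearB F). Qed.
Lemma linN x : f (- x) = - f x. Proof. exact: (linearN F). Qed.
Lemma lin0 : f 0 = 0. Proof. exact: (linear0 F). Qed.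
Lemma linZ a x : f (a *: x) = a *: f x. Proof. by have := lf a x 0; rewrite lin0 !addr0. Qed.
End Lin.

Definition opb V W (K : R) (f : V -> W) := forall x, rnorm (f x) <= K * rnorm x.

Lemma opnorm_ge0 V W (f : V -> W) : (0 <= opnorm f)%E.
Proof.
apply: (@le_trans _ _ (rnorm (f 0))%:E); first by rewrite lee_fin rnorm_ge0.
by apply: ereal_sup_ubound; exists 0 => //=; rewrite rnorm0.
Qed.

Lemma opb_opnorm V W K (f : V -> W) : 0 <= K -> opb K f -> (opnorm f <= K%:E)%E.
Proof.
move=> K0 h; apply: ge_ereal_sup => _ [x /= x1 <-]; rewrite lee_fin.
by rewrite (le_trans (h x)) // -[leRHS]mulr1 ler_wpM2l.
Qed.

(** Linearity reduces every vector to the unit ball, where the supremum is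
taken. *)
Lemma opnorm_opb V W K (f : V -> W) : linear f -> (opnorm f <= K%:E)%E -> opb K f.
Proof.
move=> lf h x.
have [x0|x0] := eqVneq (rnorm x) 0.
  by rewrite (rnorm_eq0 x0) (lin0 lf) !rnorm0 mulr0.
have xp : 0 < rnorm x by rewrite lt_def x0 rnorm_ge0.
have : ((rnorm (f ((rnorm x)^-1%:C *: x)))%:E <= K%:E)%E.
  apply: le_trans h; apply: ereal_sup_ubound.
  eexists; last reflexivity.
  by rewrite /= rnormZr ger0_norm ?mulVf // invr_ge0 ltW.
rewrite lee_fin (linZ lf) rnormZr ger0_norm ?invr_ge0 ?rnorm_ge0 //.
by rewrite ler_pdivrMl // mulrC.
Qed.

Lemma opb_le V W K L (f : V -> W) : K <= L -> opb K f -> opb L f.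
Proof. by move=> KL h x; rewrite (le_trans (h x)) // ler_wpM2r // rnorm_ge0. Qed.

Lemma bounded_linear_opb V W (f : V -> W) :
  bounded_linear f -> exists2 K, 0 <= K & opb K f.
Proof.
move=> [lf [M h]]; exists `|M| => // x.
by rewrite (le_trans (h x)) // ler_wpM2r ?rnorm_ge0 // ler_norm.
Qed.

Lemma opnorm_fin V W (f : V -> W) : bounded_linear f ->
  exists2 K, 0 <= K & opnorm f = K%:E.
Proof.
move=> /bounded_linear_opb[K K0 /(opb_opnorm K0)].
have := opnorm_ge0 f; case: (opnorm f) => // r h _.
by exists r; rewrite -?lee_fin.
Qed.

End Operators.

(** * Completeness, the Riesz theorem and adjoints *)

Section Completeness.
Context {R : realType}.

Lemma exp2_unbounded (a : R) : exists n : nat, a < 2 ^+ n.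
Proof.
exists (Num.trunc a).+1.
rewrite (lt_trans (truncnS_gt a)) // -natrX ltr_nat.
exact: ltn_expl.
Qed.

Lemma le0_geometric (a c : R) : (forall n, a <= c * 2^-1 ^+ n) -> a <= 0.
Proof.
move=> h; rewrite leNgt; apply/negP => a0.
have [n] := exp2_unbounded (c / a); rewrite ltr_pdivrMr // => hn.
have := h n; rewrite leNgt exprVn ltr_pdivrMr ?exprn_gt0 //.
by rewrite mulrC hn.
Qed.

Lemma ler_rnormDB {V : normedModType R[i]} (x y : V) : rnorm x - rnorm y <= rnorm (x + y).
Proof.
rewrite lerBlDr -{1}(addrK y x); exact: ler_rnormB.
Qed.

Context {H : hilbertType R}.
Implicit Types x y z : H.

(** The three completeness arguments below (minimising sequence, fixed point,
gliding hump) all produce increments with geometric decay, so this is the only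
form in which completeness is used. *)
Lemma geometric_cvg (u : nat -> H) (c q : R) : 0 <= q < 1 -> 0 <= c ->
  (forall n, rnorm (u n.+1 - u n) <= c * q ^+ n) ->
  exists l, forall n, rnorm (u n - l) <= c * q ^+ n / (1 - q).
Proof.
move=> /andP[q0 q1] c0 hu.
have q1' : 0 < 1 - q by rewrite subr_gt0.
have hk n k : rnorm (u n - u (n + k)%N) <= c * (q ^+ n - q ^+ (n + k)%N) / (1 - q).
  elim: k => [|k ih]; first by rewrite addn0 !subrr rnorm0 mulr0 mul0r.
  have ht := ler_rnorm_distD (u (n + k)%N) (u n) (u (n + k.+1)%N).
  have h1 := hu (n + k)%N; rewrite -addnS rnormBC in h1.
  apply: (le_trans ht); apply: (le_trans (lerD ih h1)).
  rewrite le_eqVlt; apply/orP; left; apply/eqP; rewrite addnS exprS; field.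
  by rewrite gt_eqF.
have hk' n m : (n <= m)%N -> rnorm (u n - u m) <= c * q ^+ n / (1 - q).
  move=> /subnKC <-; apply: le_trans (hk _ _) _.
  rewrite ler_pM2r ?invr_gt0 // ler_wpM2l // lerBlDr lerDl exprn_ge0 //.
have small (e : R) : 0 < e -> exists n, c * q ^+ n / (1 - q) < e.
  move=> e0.
  have c1 : 0 < c + 1 by rewrite ltr_wpDl.
  have d0 : 0 < e * (1 - q) / (c + 1) by rewrite divr_gt0 // mulr_gt0.
  have hq : q ^+ n @[n --> \oo] --> (0 : R).
    by apply: cvg_expr; rewrite ger0_norm.
  move/cvgrPdist_lt : hq => /(_ _ d0)[n _ /(_ n (leqnn n))].
  rewrite /= sub0r normrN ger0_norm ?exprn_ge0 // => hn.
  exists n; rewrite ltr_pdivrMr //.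
  move: hn; rewrite ltr_pdivlMr //; apply: le_lt_trans.
  by rewrite mulrC ler_wpM2l ?exprn_ge0 // lerDl.
have : cvg (u @ \oo).
  apply/cauchy_cvgP/cauchy_exP => e e0.
  have er : e = (complex.Re e)%:C by rewrite RRe_real // gtr0_real.
  have e0' : 0 < complex.Re e by rewrite -ltcR -er.
  have [n hn] := small _ e0'.
  exists (u n); exists n => // m nm /=; rewrite -ball_normE /= er rnormE ltcR.
  exact: le_lt_trans (hk' _ _ nm) hn.
move=> /cvg_ex[l hl]; exists l => n.
rewrite leNgt; apply/negP => hlt.
set d := _ / _ in hlt.
have e0 : 0 < (rnorm (u n - l) - d)%:C by rewrite ltcR subr_gt0.
move/cvgrPdist_lt : hl => /(_ _ e0)[N _ hN].
have := hN (maxn n N) (leq_maxr _ _).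
rewrite /= rnormE ltcR rnormBC => h1.
have h2 := hk' _ _ (leq_maxl n N).
have := ler_rnorm_distD (u (maxn n N)) (u n) l.
by rewrite leNgt => /negP; apply; rewrite -/d in h2; lra.
Qed.

(** A minimising sequence of [x |-> |x|^2 - 2 l x] is Cauchy by the
parallelogram law; comparing its values with those at [u n + q y] for small [q]
identifies the limit. *)
Lemma riesz (l : H -> R) (M : R) :
  (forall x y, l (x + y) = l x + l y) -> (forall r x, l (r%:C *: x) = r * l x) ->
  (forall x, l x <= M * rnorm x) -> exists v, forall y, rip v y = l y.
Proof.
move=> lD lZ lM.
pose J x := rnorm x ^+ 2 - 2 * l x.
have Jge x : - M ^+ 2 <= J x.
  rewrite /J; have := lM x; have := sqr_ge0 (rnorm x - M); nra.
pose A := [set J x | x in [set: H]].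
have hA : has_inf A.
  split; first by exists (J 0), 0.
  by exists (- M ^+ 2) => _ [x _ <-]; exact: Jge.
pose m := inf A.
have mJ x : m <= J x by apply: inf_lbound; [case: hA | exists x].
have ex (n : nat) : exists x, J x <= m + (2^-1 ^+ n) ^+ 2.
  have e0 : 0 < (2^-1 ^+ n) ^+ 2 :> R by rewrite !exprn_gt0.
  by have [_ [x _ <-] hx] := inf_adherent e0 hA; exists x; exact: ltW.
have [u hu] := choice ex.
have step n : rnorm (u n.+1 - u n) <= 2 * 2^-1 ^+ n.
  set x := u n.+1; set y := u n.
  have h1 : J x <= m + (2^-1 ^+ n) ^+ 2.
    apply: le_trans (hu n.+1) _; rewrite lerD2l (exprS 2^-1 n) exprMn.
    have := sqr_ge0 (2^-1 ^+ n : R); nra.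
  have h2 := hu n; rewrite -/y in h2.
  have h3 := mJ ((2^-1)%:C *: (x + y)).
  have h4 := rnorm_parallelogram x y.
  have : rnorm (x - y) ^+ 2 <= (2 * 2^-1 ^+ n) ^+ 2.
    move: h1 h2 h3; rewrite /J rnormZr lZ lD ger0_norm // !exprMn.
    set a := rnorm (x + y) in h4 *; set b := rnorm (x - y) in h4 *.
    set e := 2^-1 ^+ n => *. nra.
  by rewrite ler_sqr ?nnegrE ?rnorm_ge0 // mulr_ge0 // exprn_ge0.
have q01 : 0 <= (2^-1 : R) < 1 by lra.
have [v hv] := geometric_cvg q01 (ler0n _ 2) step.
exists v.
suff main y : l y - rip v y <= 0.
  move=> y; apply/eqP; rewrite eq_le; apply/andP; split; last first.
    by have := main y; rewrite subr_le0.
  have := main ((-1)%:C *: y); rewrite ripZr lZ; lra.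
apply: (@le0_geometric _ (1 + rnorm y ^+ 2 + 4 * rnorm y)) => n.
set q := 2^-1 ^+ n.
have q0 : 0 < q by rewrite exprn_gt0.
have h1 := mJ (u n + q%:C *: y).
have h2 := hu n.
have h3 := hv n; rewrite -/q in h2 h3.
have h4 : rip (u n - v) y <= 4 * q * rnorm y.
  apply: le_trans (rip_le _ _) _; rewrite ler_wpM2r ?rnorm_ge0 //.
  apply: le_trans h3 _; rewrite ler_pdivrMr; lra.
rewrite ripBl in h4.
have : 2 * q * (l y - rip (u n) y) <= q ^+ 2 * (1 + rnorm y ^+ 2).
  move: h1; rewrite /J lD lZ -ripxx !(ripDl, ripDr, ripZl, ripZr) !ripxx (ripC y).
  move: h2; rewrite /J; nra.
have -> : q ^+ 2 * (1 + rnorm y ^+ 2) = 2 * q * (q * (1 + rnorm y ^+ 2) / 2) by field.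
rewrite ler_pM2l ?mulr_gt0 //; have := sqr_ge0 (rnorm y); nra.
Qed.

(** Fixed point iteration for [w |-> x - N w]. *)
Lemma halfcontraction_surj (N : H -> H) : linear N -> opb 2^-1 N ->
  forall x, exists w, w + N w = x.
Proof.
move=> lN hN x.
pose u n := iter n (fun w => x - N w) 0.
have step n : rnorm (u n.+1 - u n) <= rnorm x * 2^-1 ^+ n.
  elim: n => [|n ih]; first by rewrite /u /= lin0 // !subr0 expr0 mulr1.
  have -> : u n.+2 - u n.+1 = - N (u n.+1 - u n).
    by rewrite (linB lN) opprB /u /= opprB addrC addrA subrK.
  rewrite rnormN (le_trans (hN _)) // exprS mulrCA ler_pM2l //.
have q01 : 0 <= (2^-1 : R) < 1 by lra.
have [w hw] := geometric_cvg q01 (rnorm_ge0 x) step.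
exists w; apply/eqP; rewrite -subr_eq0; apply/eqP/rnorm_eq0.
apply/eqP; rewrite eq_le rnorm_ge0 andbT.
apply: (@le0_geometric _ (4 * rnorm x)) => n.
have -> : w + N w - x = - (u n.+1 - w) - N (u n - w).
  have -> : u n.+1 = x - N (u n) by [].
  by rewrite (linB lN) !opprB -!addrA; congr (_ + _); rewrite addrA [RHS]addrC addrA subrK.
apply: le_trans (ler_rnormB _ _) _; rewrite rnormN.
have h1 := hw n.+1; have h2 := hw n; have h3 := hN (u n - w).
have q0 : 0 <= 2^-1 ^+ n :> R by rewrite exprn_ge0.
have x0 := rnorm_ge0 x.
rewrite exprS in h1.
have e : (1 - 2^-1)^-1 = 2 :> R by field.
rewrite e in h1 h2; nra.
Qed.

End Completeness.

Section Adjoint.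
Context {R : realType}.

(** The choice in [adj] succeeds: the representing vector exists by the Riesz
theorem applied to the real part, and complex linearity of [f] upgrades the
identity of real parts to one of inner products. *)
Lemma adjP {V W : hilbertType R} (f : V -> W) : bounded_linear f ->
  forall x y, rip (f x) y = rip x (adj f y).
Proof.
move=> bf; have lf := bf.1; have [K K0 hK] := bounded_linear_opb bf.
move=> x0 y; rewrite /adj; case: xgetP => [z -> hz|none]; first by rewrite /rip (hz x0).
have lD a b : rip (f (a + b)) y = rip (f a) y + rip (f b) y.
  by rewrite (linD lf) ripDl.
have lZ r a : rip (f (r%:C *: a)) y = r * rip (f a) y.
  by rewrite (linZ lf) ripZl.
have lM a : rip (f a) y <= K * rnorm y * rnorm a.
  by rewrite (le_trans (rip_le _ _)) // mulrAC ler_wpM2r ?rnorm_ge0.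
have [z hz] := riesz lD lZ lM.
exfalso; apply: (none z) => x /=.
have h a : rip (f a) y = rip a z by rewrite -hz ripC.
rewrite !inner_rip; congr (_ +i* _); first exact: h.
have e : forall (V' : hilbertType R) (a b : V'), rip a ('i%C *: b) = rip (- 'i%C *: a) b.
  move=> V' a b; rewrite ripZiZ; congr (rip _ (_ *: _)).
  by apply/eqP; rewrite eq_complex /= oppr0 opprK !eqxx.
by rewrite !e -(linZ lf) h.
Qed.

Lemma adj_unique {V W : hilbertType R} (f : V -> W) (g : W -> V) :
  bounded_linear f -> (forall x y, rip (f x) y = rip x (g y)) -> adj f = g.
Proof.
move=> bf h; apply/funext => y; apply: rip_ext => x.
by rewrite ripC -adjP // h ripC.
Qed.

Lemma adj_linear {V W : hilbertType R} (f : V -> W) :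
  bounded_linear f -> linear (adj f).
Proof.
move=> bf a x y; apply: rip_ext => z.
have e w u : rip (adj f w) u = rip (f u) w by rewrite ripC adjP.
rewrite ripDl ripZiZ !e ripDr (linZ bf.1); congr (_ + _).
by rewrite ripC ripZiZ ripC.
Qed.

End Adjoint.

(** * The uniform boundedness principle *)

Section UniformBoundedness.
Context {R : realType} {H : hilbertType R}.

Lemma opnorm_attained (f : H -> H) K : opnorm f = K%:E -> 0 < K ->
  exists2 z, rnorm z <= 1 & K / 2 < rnorm (f z).
Proof.
move=> fK K0.
have : ((K / 2)%:E < opnorm f)%E by rewrite fK lte_fin ltr_pdivrMr // ltr_pMr // ltr1n.
by move=> /ereal_sup_gt[_ [z z1 <-]]; rewrite lte_fin => ?; exists z.
Qed.

(** Gliding hump. Otherwise there are [T_n] of norm above [8 ^+ n] and [z_n] in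
the unit ball at which half of that norm is attained. Adding or subtracting
[4 ^- n z_n], whichever makes [T_n] larger, gives a convergent sequence; the
later steps are too short to undo the [n]-th one, so that [T_n] is unbounded at
the limit. *)
Lemma uniform_boundedness (I : Type) (D : set I) (T : I -> H -> H) :
  (forall i, D i -> bounded_linear (T i)) ->
  (forall x, exists M, forall i, D i -> rnorm (T i x) <= M) ->
  exists2 M, 0 <= M & forall i, D i -> opb M (T i).
Proof.
move=> bT ptT; apply: contrapT => hno.
have ex (n : nat) : exists iz : I * H, exists K : R,
    [/\ D iz.1, 8 ^+ n < K, opb K (T iz.1), rnorm iz.2 <= 1 & K / 2 < rnorm (T iz.1 iz.2)].
  have : exists2 i, D i & ((8 ^+ n)%:E < opnorm (T i))%E.
    apply: contrapT => h; apply: hno; exists (8 ^+ n); first by rewrite exprn_ge0.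
    move=> i Di; apply: (opnorm_opb (bT _ Di).1); rewrite leNgt; apply/negP => hi.
    by apply: h; exists i.
  move=> [i Di]; have [K K0 e] := opnorm_fin (bT i Di).
  rewrite e lte_fin => hK.
  have Kp : 0 < K by rewrite (le_lt_trans _ hK) // exprn_ge0.
  have [z z1 hz] := opnorm_attained e Kp.
  exists (i, z), K; split => //=.
  by apply: (opnorm_opb (bT _ Di).1); rewrite e.
have [iz hiz] := choice ex.
have [K hK] := choice hiz.
pose Tn n := T (iz n).1; pose z n := (iz n).2.
have lT n : linear (Tn n) by case: (hK n) => /bT[].
pose q : R := 4^-1.
have q01 : 0 <= q < 1 by rewrite /q; lra.
have qn n : 0 < q ^+ n by rewrite exprn_gt0 // /q; lra.
pose next n x := let y := (q ^+ n)%:C *: z n in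
  if rnorm (Tn n y) <= rnorm (Tn n (x + y)) then x + y else x - y.
pose u := fix u n := if n is m.+1 then next m (u m) else 0.
have step n : rnorm (u n.+1 - u n) <= 1 * q ^+ n.
  rewrite mul1r /= /next /=; case: ifP => _; rewrite addrAC subrr add0r ?rnormN rnormZr ger0_norm ?(ltW (qn n)) //;
    by rewrite ler_piMr ?(ltW (qn n)) //; case: (hK n).
have big n : q ^+ n * (K n / 2) <= rnorm (Tn n (u n.+1)).
  have -> : u n.+1 = next n (u n) by [].
  have hy : q ^+ n * (K n / 2) <= rnorm (Tn n ((q ^+ n)%:C *: z n)).
    rewrite (linZ (lT n)) rnormZr ger0_norm ?(ltW (qn n)) // ler_pM2l // ltW //.
    by case: (hK n).
  rewrite /next /=; case: ifP => [h|/negbT]; first exact: le_trans hy h.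
  rewrite -ltNge; set y := _ *: z n; move: hy; rewrite -/y.
  rewrite (linB (lT n)) (linD (lT n)) => hy h.
  have := ler_rnormB (Tn n (u n) + Tn n y) (Tn n (u n) - Tn n y).
  have -> : Tn n (u n) + Tn n y - (Tn n (u n) - Tn n y) = 2%:C *: Tn n y.
    by rewrite opprB addrC addrA subrK -mulr2n -scaler_nat; congr (_ *: _); rewrite rmorph_nat.
  by rewrite rnormZr ger0_norm //; lra.
have [x hx] := geometric_cvg q01 ler01 step.
have [M hM] := ptT x.
have [n hn] := exp2_unbounded (6 * M).
have [Di hK8 ob _ _] := hK n.
have h1 := hM _ Di; rewrite -/(Tn n) in h1.
have h2 := big n.
have h3 : rnorm (Tn n (u n.+1)) <= rnorm (Tn n x) + K n * (q ^+ n / 3).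
  have := ob (u n.+1 - x); rewrite -/(Tn n) (linB (lT n)) => h3.
  have h4 : rnorm (u n.+1 - x) <= q ^+ n / 3.
    apply: le_trans (hx n.+1) _; rewrite exprS mul1r; set s := q ^+ n.
    have -> : q * s / (1 - q) = s / 3 by rewrite /q; field.
    by [].
  have K0 : 0 <= K n by rewrite ltW // (le_lt_trans _ hK8) // exprn_ge0.
  have h5 := ler_rnormD (Tn n (u n.+1) - Tn n x) (Tn n x).
  rewrite subrK in h5; rewrite addrC.
  apply: le_trans h5 _; rewrite lerD2r; apply: le_trans h3 _.
  by rewrite ler_wpM2l.
have h4 : 2 ^+ n <= q ^+ n * K n.
  have -> : 2 ^+ n = q ^+ n * 8 ^+ n :> R by rewrite -exprMn; congr (_ ^+ _); rewrite /q; field.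
  by rewrite ler_pM2l // ltW.
nra.
Qed.

End UniformBoundedness.

(** * Self-adjoint and positive operators *)

Section SelfAdjoint.
Context {R : realType} {H : hilbertType R}.
Implicit Types (P Q S X : H -> H) (x y : H).

(** Symmetry for the real inner product; for complex linear operators it is
self-adjointness. *)
Definition rsym P := forall x y, rip (P x) y = rip x (P y).

Lemma SigmaE P : Sigma P <-> bounded_linear P /\ rsym P.
Proof.
split=> [[bP aP]|[bP sP]]; split => //.
  by move=> x y; rewrite adjP // aP.
exact: adj_unique.
Qed.

(** The values [inner (P x) x] are real as [P] is symmetric. *)
Lemma SigmaPE P : SigmaP P <-> Sigma P /\ forall x, 0 <= rip (P x) x.
Proof.
split=> [[sP h]|[sP h]]; split => // x.
  by have := h x; rewrite lecE => /andP[_].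
rewrite inner_rip lecE /= h andbT.
have /SigmaE[[lP _] symP] := sP.
suff e : rip (P x) ('i%C *: x) = - rip (P x) ('i%C *: x) by apply/eqP; lra.
rewrite {1}symP (linZ lP) ripC ripZiZ (_ : ('i%C)^*%C = - 'i%C).
  by rewrite scaleNr ripNr.
by apply/eqP; rewrite eq_complex /= oppr0 !eqxx.
Qed.

Lemma adj_opb {V W : hilbertType R} (f : V -> W) K : bounded_linear f ->
  0 <= K -> opb K f -> opb K (adj f).
Proof.
move=> bf K0 hf y; apply: rnorm_le_dual => [|x]; first by rewrite mulr_ge0 // rnorm_ge0.
rewrite ripC -adjP // (le_trans (rip_le _ _)) // mulrAC ler_wpM2r ?rnorm_ge0 //.
Qed.

Lemma adj_bounded {V W : hilbertType R} (f : V -> W) :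
  bounded_linear f -> bounded_linear (adj f).
Proof.
move=> bf; split; first exact: adj_linear.
by have [K K0 hK] := bounded_linear_opb bf; exists K; exact: adj_opb.
Qed.

Lemma comp_opb {U V W : normedModType R[i]} (f : V -> W) (g : U -> V) K L :
  0 <= K -> opb K f -> opb L g -> opb (K * L) (f \o g).
Proof.
by move=> K0 hf hg x; rewrite (le_trans (hf _)) // -mulrA ler_wpM2l.
Qed.

Lemma comp_linear {U V W : normedModType R[i]} (f : V -> W) (g : U -> V) :
  linear f -> linear g -> linear (f \o g).
Proof. by move=> lf lg a x y /=; rewrite lg lf. Qed.

Lemma comp_bounded {U V W : normedModType R[i]} (f : V -> W) (g : U -> V) :
  bounded_linear f -> bounded_linear g -> bounded_linear (f \o g).
Proof.
move=> bf bg; split; first exact: comp_linear bf.1 bg.1.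
have [K K0 hK] := bounded_linear_opb bf; have [L L0 hL] := bounded_linear_opb bg.
by exists (K * L); exact: comp_opb.
Qed.

(** Polarisation, applied to [x] and [y] rescaled to have equal norms. *)
Lemma quadratic_opb P K : linear P -> rsym P -> 0 <= K ->
  (forall x, `|rip (P x) x| <= K * rnorm x ^+ 2) -> opb K P.
Proof.
move=> lP sP K0 h x; apply: rnorm_le_dual => [|y]; first by rewrite mulr_ge0 // rnorm_ge0.
have [x0|x0] := eqVneq (rnorm x) 0.
  by rewrite (rnorm_eq0 x0) (lin0 lP) rip0l rnorm0 mulr0 mul0r.
have [y0|y0] := eqVneq (rnorm y) 0.
  by rewrite (rnorm_eq0 y0) rip0r rnorm0 mulr0.
set a := rnorm x in x0 *; set b := rnorm y in y0 *.
have a0 : 0 < a by rewrite lt_def x0 rnorm_ge0.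
have b0 : 0 < b by rewrite lt_def y0 rnorm_ge0.
set x' := b%:C *: x; set y' := a%:C *: y.
have h1 := h (x' + y'); have h2 := h (x' - y').
have h3 := rnorm_parallelogram x' y'.
have e1 : rnorm x' ^+ 2 = (a * b) ^+ 2 by rewrite rnormZr ger0_norm ?(ltW b0) // mulrC.
have e2 : rnorm y' ^+ 2 = (a * b) ^+ 2 by rewrite rnormZr ger0_norm ?(ltW a0).
have e3 : rip (P (x' + y')) (x' + y') - rip (P (x' - y')) (x' - y') = 4 * (a * b) * rip (P x) y.
  rewrite (linD lP) (linB lP) !(ripDl, ripDr, ripNl, ripNr) (sP y') (ripC y').
  by rewrite /x' /y' !(linZ lP) !(ripZl, ripZr); ring.
have h4 : 4 * (a * b) * rip (P x) y <= 4 * (a * b) * (K * a * b).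
  move: h1 h2; rewrite -e3 !ler_norml => /andP[_ h1] /andP[h2 _].
  by rewrite e1 e2 in h3; nra.
by rewrite ler_pM2l ?mulr_gt0 // in h4.
Qed.

End SelfAdjoint.

(** * Limits of vectors and operators *)

Section Limits.
Context {R : realType}.

Section Filtered.
Context {T : Type} {F : set_system T} {FF : Filter F}.

Lemma cvg_dominated (g b : T -> R) (l : R) :
  (\forall t \near F, `|g t - l| <= b t) -> b t @[t --> F] --> (0 : R) ->
  g t @[t --> F] --> l.
Proof.
move=> gb b0; apply/cvgrPdist_le => e e0.
have hb := @cvgr0_norm_le _ _ _ F FF b b0 e e0; near=> t; rewrite distrC; apply: le_trans (le_trans (ler_norm (b t)) _).
  by near: t.
by near: t.
Unshelve. all: by end_near. Qed.

Lemma cvg0D (f g : T -> R) : f t @[t --> F] --> (0 : R) ->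
  g t @[t --> F] --> (0 : R) -> (fun t => f t + g t) t @[t --> F] --> (0 : R).
Proof. by move=> f0 g0; rewrite -[X in _ --> X](addr0 (0 : R)); exact: cvgD. Qed.

Lemma cvg0M (f g : T -> R) : f t @[t --> F] --> (0 : R) ->
  g t @[t --> F] --> (0 : R) -> (fun t => f t * g t) t @[t --> F] --> (0 : R).
Proof. by move=> f0 g0; rewrite -[X in _ --> X](mulr0 (0 : R)); exact: cvgM. Qed.

Lemma cvg0Ml (c : R) (f : T -> R) : f t @[t --> F] --> (0 : R) ->
  (fun t => c * f t) t @[t --> F] --> (0 : R).
Proof.
move=> f0; rewrite -[X in _ --> X](mulr0 c); apply: cvgM => //; exact: cvg_cst.
Qed.

Lemma cvg0Mr (c : R) (f : T -> R) : f t @[t --> F] --> (0 : R) ->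
  (fun t => f t * c) t @[t --> F] --> (0 : R).
Proof.
move=> f0; rewrite -[X in _ --> X](mul0r c); apply: cvgM => //; exact: cvg_cst.
Qed.

(** Norm convergence through the real norm, which makes domination by real
functions available. *)
Definition vcvg {V : normedModType R[i]} (u : T -> V) (l : V) :=
  rnorm (u t - l) @[t --> F] --> (0 : R).

Lemma vcvgP {V : normedModType R[i]} (u : T -> V) (l : V) :
  vcvg u l <-> u t @[t --> F] --> l.
Proof.
split=> h; apply/cvgrPdist_lt => e e0.
  have er : e = (complex.Re e)%:C by rewrite RRe_real // gtr0_real.
  have e0' : 0 < complex.Re e by rewrite -ltcR -er.
  have := @cvgr0_norm_lt _ _ _ F FF _ h _ e0'; apply: filterS => t.
  by rewrite er rnormE ltcR ger0_norm ?rnorm_ge0 // rnormBC.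
have e0' : 0 < e%:C by rewrite ltcR.
move/cvgrPdist_lt : h => /(_ _ e0'); apply: filterS => t.
by rewrite rnormE ltcR sub0r normrN ger0_norm ?rnorm_ge0 // rnormBC.
Qed.

Lemma vcvg_cst {V : normedModType R[i]} (l : V) : vcvg (fun=> l) l.
Proof. by rewrite /vcvg; under eq_cvg do rewrite subrr rnorm0; exact: cvg_cst. Qed.

Lemma vcvg_dominated {V : normedModType R[i]} (u : T -> V) (l : V) (b : T -> R) :
  (\forall t \near F, rnorm (u t - l) <= b t) -> b t @[t --> F] --> (0 : R) ->
  vcvg u l.
Proof.
move=> ub; apply: cvg_dominated; apply: filterS ub => t.
by rewrite subr0 ger0_norm ?rnorm_ge0.
Qed.

Lemma vcvgD {V : normedModType R[i]} (u v : T -> V) (l m : V) :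
  vcvg u l -> vcvg v m -> vcvg (fun t => u t + v t) (l + m).
Proof.
move=> ul vm; apply: (vcvg_dominated _ (cvg0D ul vm)).
by near=> t; rewrite opprD addrACA ler_rnormD.
Unshelve. all: by end_near. Qed.

Lemma vcvg_near {V : normedModType R[i]} (u v : T -> V) (l : V) :
  (\forall t \near F, u t = v t) -> vcvg u l -> vcvg v l.
Proof.
by move=> uv ul; apply: (vcvg_dominated _ ul); apply: filterS uv => t <-.
Qed.

Lemma vcvg_rip {H : hilbertType R} (u v : T -> H) (l m : H) :
  vcvg u l -> vcvg v m -> rip (u t) (v t) @[t --> F] --> rip l m.
Proof.
move=> ul vm.
have h1 := cvg0M ul vm; have h2 := cvg0Mr (rnorm m) ul; have h3 := cvg0Ml (rnorm l) vm.
apply: (cvg_dominated _ (cvg0D (cvg0D h1 h2) h3)).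
near=> t.
have -> : rip (u t) (v t) - rip l m =
    rip (u t - l) (v t - m) + rip (u t - l) m + rip l (v t - m).
  by rewrite !(ripBl, ripBr); ring.
have := abs_rip_le (u t - l) (v t - m).
have := abs_rip_le (u t - l) m.
have := abs_rip_le l (v t - m).
have := ler_normD (rip (u t - l) (v t - m) + rip (u t - l) m) (rip l (v t - m)).
have := ler_normD (rip (u t - l) (v t - m)) (rip (u t - l) m).
by move=> /=; lra.
Unshelve. all: by end_near. Qed.

(** Convergence in operator norm, with an explicit vanishing bound in place of
the extended-real operator norm. *)
Definition opcvg {V W : normedModType R[i]} (Z : T -> V -> W) (Z0 : V -> W) :=
  exists2 b : T -> R, (\forall t \near F, opb (b t) (fun x => Z t x - Z0 x)) &
    b t @[t --> F] --> (0 : R).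

Lemma opcvg_vcvg {V W : normedModType R[i]} (Z : T -> V -> W) (Z0 : V -> W)
    (u : T -> V) (l : V) :
  bounded_linear Z0 -> opcvg Z Z0 -> vcvg u l -> vcvg (fun t => Z t (u t)) (Z0 l).
Proof.
move=> bZ [b Zb b0] ul; have [K K0 hK] := bounded_linear_opb bZ.
have h1 := cvg0M b0 ul; have h2 := cvg0Mr (rnorm l) b0; have h3 := cvg0Ml K ul.
apply: (vcvg_dominated _ (cvg0D (cvg0D h1 h2) h3)).
near=> t.
have ob : opb (b t) (fun x => Z t x - Z0 x) by near: t.
have b0' : 0 <= b t \/ rnorm (u t) = 0.
  have [e|e] := eqVneq (rnorm (u t)) 0; [by right|left].
  have := le_trans (rnorm_ge0 _) (ob (u t)).
  by rewrite pmulr_lge0 // lt_def e rnorm_ge0.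
have h := ler_rnorm_distD (Z0 (u t)) (Z t (u t)) (Z0 l).
apply: (le_trans h); apply: lerD; last by rewrite -(linB bZ.1); exact: hK.
apply: le_trans (ob _) _; rewrite -mulrDr.
case: b0' => [b0'|e].
  apply: ler_wpM2l => //.
  by rewrite -{1}(subrK l (u t)) ler_rnormD.
have bl := le_trans (rnorm_ge0 _) (ob l).
by rewrite (rnorm_eq0 e) sub0r rnormN rnorm0 mulr0 mulrDr addr_ge0.
Unshelve. all: by end_near. Qed.

(** Pointwise convergence suffices for uniformly bounded operators. *)
Lemma bounded_vcvg {V W : normedModType R[i]} (Z : T -> V -> W) (Z0 : V -> W) (M : R)
    (u : T -> V) (l : V) :
  (\forall t \near F, linear (Z t) /\ opb M (Z t)) ->
  vcvg (fun t => Z t l) (Z0 l) -> vcvg u l -> vcvg (fun t => Z t (u t)) (Z0 l).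
Proof.
move=> Zb Zl ul.
have h3 := cvg0Ml M ul.
apply: (vcvg_dominated _ (cvg0D h3 Zl)).
apply: filterS Zb => t [lZ ob].
apply: le_trans (ler_rnorm_distD (Z t l) _ _) _; rewrite lerD2r -(linB lZ).
exact: ob.
Qed.

Lemma linear_vcvg {V W : normedModType R[i]} (Z : V -> W) (u : T -> V) (l : V) :
  bounded_linear Z -> vcvg u l -> vcvg (fun t => Z (u t)) (Z l).
Proof.
move=> bZ ul; have [M M0 hM] := bounded_linear_opb bZ.
apply: (@bounded_vcvg _ _ (fun=> Z) Z M _ _ _ (vcvg_cst _) ul).
by apply: nearW => t; split => //; exact: bZ.1.
Qed.

Lemma opnorm_opcvg {V W : normedModType R[i]} (Z : T -> V -> W) (Z0 : V -> W) :
  (\forall t \near F, linear (Z t)) -> linear Z0 ->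
  opnorm (Z t \- Z0) @[t --> F] --> 0%E -> opcvg Z Z0.
Proof.
move=> lZ lZ0 h; exists (fun t => fine (opnorm (Z t \- Z0))); last first.
  by move/fine_cvg : h.
have /fine_cvgP[hfin _] := h.
apply: (filterS2 _ _ lZ hfin) => t lZt hf; apply: opnorm_opb; last by rewrite fineK.
by move=> a x y /=; rewrite lZt lZ0 scalerBr opprD addrACA.
Qed.

End Filtered.

End Limits.
Arguments vcvg {R T} F {V} u l.
Arguments opcvg {R T} F {V W} Z Z0.

(** * Derivatives in a real variable and mean value inequalities *)

Section Calculus.
Context {R : realType}.

Definition rderiv (g : R -> R) (s d : R) :=
  h^-1 * (g (s + h) - g s) @[h --> (0 : R)^'] --> d.

(** The increments are real although the scalars of [V] are complex. *)
Definition vderiv {V : normedModType R[i]} (u : R -> V) (s : R) (d : V) :=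
  vcvg (0 : R)^' (fun h => (h^-1)%:C *: (u (s + h) - u s)) d.

Definition opderiv {V W : normedModType R[i]} (P : R -> V -> W) (s : R) (D : V -> W) :=
  opcvg (0 : R)^' (fun h x => (h^-1)%:C *: (P (s + h) x - P s x)) D.

Lemma rderiv_is_derive (g : R -> R) s d : rderiv g s d -> is_derive s 1 g d.
Proof.
move=> h.
have h' : h^-1 *: ((g \o shift s) (h *: (1 : R)) - g s) @[h --> (0 : R)^'] --> d.
  apply: cvg_trans h; apply: near_eq_cvg; apply: nearW => r /=.
  by rewrite [r *: _]mulr1 (addrC r).
apply: DeriveDef; first by apply/cvg_ex; exists d.
by apply: cvg_lim => //; exact: Rhausdorff.
Qed.

Lemma is_derive_rderiv (g : R -> R) (s d : R) : is_derive s 1 g d -> rderiv g s d.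
Proof.
move=> [gd <-].
have h : h^-1 *: ((g \o shift s) (h *: (1 : R)) - g s) @[h --> (0 : R)^'] --> 'D_1 g s.
  exact: gd.
apply: cvg_trans h; apply: near_eq_cvg; apply: nearW => r /=.
by rewrite [r *: _]mulr1 (addrC r).
Qed.

Lemma rderiv_continuous (g : R -> R) (s d : R) : rderiv g s d ->
  {for s, continuous g}.
Proof.
move=> /rderiv_is_derive[gd _].
by apply: differentiable_continuous; apply/derivable1_diffP.
Qed.

Lemma near0_neq : \forall h \near (0 : R)^', h != 0.
Proof. exact: nbhs_dnbhs_neq. Qed.

Lemma dnbhs0_id : h @[h --> (0 : R)^'] --> (0 : R).
Proof. exact: cvg_within. Qed.

Lemma dnbhs0_norm : `|h| @[h --> (0 : R)^'] --> (0 : R).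
Proof. by rewrite -[X in _ --> X](normr0 R); apply: cvg_norm; exact: dnbhs0_id. Qed.

Lemma rcvgD {T : Type} {F : set_system T} {FF : Filter F} (f g : T -> R) (a b : R) :
  f t @[t --> F] --> a -> g t @[t --> F] --> b -> f t + g t @[t --> F] --> a + b.
Proof. exact: cvgD. Qed.

Lemma rcvgN {T : Type} {F : set_system T} {FF : Filter F} (f : T -> R) (a : R) :
  f t @[t --> F] --> a -> - f t @[t --> F] --> - a.
Proof. exact: cvgN. Qed.

Lemma rderivD g f s d e : rderiv g s d -> rderiv f s e ->
  rderiv (fun t => g t + f t) s (d + e).
Proof.
move=> gd fe; apply: cvg_trans (rcvgD gd fe); apply: near_eq_cvg.
by apply: nearW => h /=; rewrite -mulrDr; congr (_ * _); ring.
Qed.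

Lemma rderivN g s d : rderiv g s d -> rderiv (fun t => - g t) s (- d).
Proof.
move=> gd; apply: cvg_trans (rcvgN gd); apply: near_eq_cvg.
by apply: nearW => h /=; rewrite -mulrN; congr (_ * _); ring.
Qed.

Lemma rderivB g f s d e : rderiv g s d -> rderiv f s e ->
  rderiv (fun t => g t - f t) s (d - e).
Proof. by move=> gd /rderivN; exact: rderivD. Qed.

Lemma rderiv_linear c s : rderiv (fun t => c * t) s c.
Proof.
apply: cvg_near_cst; apply: filterS near0_neq => h h0.
have -> : c * (s + h) - c * s = c * h by ring.
by rewrite mulrCA mulVf ?mulr1.
Qed.

Lemma rderivZ (c : R) (g : R -> R) (s d : R) : rderiv g s d -> rderiv (fun t => c * g t) s (c * d).
Proof.
move=> gd; apply: cvg_trans (cvgM (cvg_cst c) gd); apply: near_eq_cvg.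
apply: nearW => h /=; rewrite -[LHS]/(c * (h^-1 * (g (s + h) - g s))); ring.
Qed.

Lemma rderiv_expR (l s : R) :
  rderiv (fun t => expR (l * t)) s (l * expR (l * s)).
Proof.
apply: is_derive_rderiv; rewrite mulrC.
apply: (@is_derive1_comp _ expR (fun t => l * t)).
exact: rderiv_is_derive (@rderiv_linear l s).
Qed.

Section Vector.
Context {V W : normedModType R[i]}.

Lemma vderiv_cvg (u : R -> V) s d :
  vderiv u s d -> vcvg (0 : R)^' (fun h => u (s + h)) (u s).
Proof.
move=> ud.
apply: (vcvg_dominated _ (cvg0D (cvg0M dnbhs0_norm ud) (cvg0Mr (rnorm d) dnbhs0_norm))); apply: filterS near0_neq => h h0 /=.
rewrite -mulrDr -{1}(scale1r (u (s + h) - u s)) -(mulfV (x := h%:C)) ?fmorph_eq0 //.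
rewrite -scalerA -fmorphV rnormZr ler_wpM2l //.
set v := _ *: _; by rewrite -{1}(subrK d v) ler_rnormD.
Qed.

(** Product rule; the first factor is differentiated in operator norm because
its argument moves too. *)
Lemma opderiv_vderiv (P : R -> V -> W) (u : R -> V) s D d :
  bounded_linear D -> bounded_linear (P s) ->
  opderiv P s D -> vderiv u s d -> vderiv (fun t => P t (u t)) s (D (u s) + P s d).
Proof.
move=> bD bP Pd ud.
apply: vcvg_near (vcvgD (opcvg_vcvg bD Pd (vderiv_cvg ud)) (linear_vcvg bP ud)); apply: nearW => h /=.
by rewrite (linZ bP.1) (linB bP.1) -scalerDr addrA subrK.
Qed.

Lemma opderiv_app (P : R -> V -> W) s D x : bounded_linear D ->
  opderiv P s D -> vderiv (fun t => P t x) s (D x).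
Proof.
by move=> bD Pd; exact: opcvg_vcvg bD Pd (vcvg_cst x).
Qed.

Lemma linear_vderiv (Z : V -> W) (u : R -> V) s d :
  bounded_linear Z -> vderiv u s d -> vderiv (fun t => Z (u t)) s (Z d).
Proof.
move=> bZ ud; apply: vcvg_near (linear_vcvg bZ ud); apply: nearW => h.
by rewrite (linZ bZ.1) (linB bZ.1).
Qed.

Lemma vderiv_cst (x : V) s : vderiv (fun=> x) s 0.
Proof. by apply: vcvg_near (vcvg_cst 0); apply: nearW => h; rewrite subrr scaler0. Qed.

Lemma vderiv_rev (u : R -> V) c s d :
  vderiv u (c - s) d -> vderiv (fun t => u (c - t)) s (- d).
Proof.
move=> ud.
have hN : - h @[h --> (0 : R)^'] --> (0 : R)^'.
  move=> A; rewrite -{1}oppr0 dnbhsN => -[B hB <-].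
  by apply: filterS hB => h Bh; exists h.
have := cvg_comp _ _ hN ud; apply: vcvg_dominated; apply: nearW => h /=.
rewrite -rnormN; have -> : - ((h^-1)%:C *: (u (c - (s + h)) - u (c - s)) - - d) =
   ((- h)^-1)%:C *: (u (c - s - h) - u (c - s)) - d; last by [].
by rewrite opprB addrC invrN rmorphN scaleNr opprD addrA.
Qed.

Lemma opderiv_shift (P : R -> V -> W) c s D :
  opderiv P (c + s) D -> opderiv (fun t => P (c + t)) s D.
Proof.
by move=> [b hb b0]; exists b => //; apply: filterS hb => h hb x; rewrite addrA; exact: hb.
Qed.

Lemma vderiv_continuous (u : R -> V) s d : vderiv u s d -> vcvg (nbhs s) u (u s).
Proof.
move=> /vderiv_cvg ud; apply/cvgrPdist_lt => e e0.
have hn : \forall h \near (0 : R)^', `|rnorm (u (s + h) - u s)| < e.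
  by apply: cvgr0_norm_lt e0.
have {}hn : \forall h \near (0 : R), h != 0 -> `|rnorm (u (s + h) - u s)| < e by exact: hn.
have /nbhs_ballP[r /= r0 hr] := hn.
apply/nbhs_ballP; exists r => // t; rewrite -ball_normE /= => st.
rewrite sub0r normrN.
have [->|ts] := eqVneq t s; first by rewrite subrr rnorm0 normr0.
have est : s + (t - s) = t by rewrite addrC subrK.
have := hr (t - s); rewrite /= est; apply; last by rewrite subr_eq0.
by rewrite -ball_normE /= sub0r normrN distrC.
Qed.

End Vector.

Lemma rderiv_rip {H : hilbertType R} (u v : R -> H) s d e :
  vderiv u s d -> vderiv v s e ->
  rderiv (fun t => rip (u t) (v t)) s (rip d (v s) + rip (u s) e).
Proof.
move=> ud ve.
apply: cvg_trans (rcvgD (vcvg_rip ud (vderiv_cvg ve)) (vcvg_rip (vcvg_cst (u s)) ve)); apply: near_eq_cvg; apply: nearW => h /=.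
rewrite ripZl ripZr ripBl ripBr; ring.
Qed.

Lemma mean_value_le (g k dg dk : R -> R) (a b : R) : a <= b ->
  (forall s, s \in `]a, b[ -> rderiv g s (dg s)) ->
  (forall s, s \in `]a, b[ -> rderiv k s (dk s)) ->
  {within `[a, b], continuous g} -> {within `[a, b], continuous k} ->
  (forall s, s \in `]a, b[ -> dg s <= dk s) -> g b - g a <= k b - k a.
Proof.
move=> ab gd kd gc kc hle.
case: (ltP a b) => [altb|ba]; last first.
  by have -> : b = a by [apply/eqP; rewrite eq_le ab ba]; rewrite !subrr.
have [c cab] := @MVT R (fun s => k s - g s) (fun s => dk s - dg s) a b altb
  (fun s hs => rderiv_is_derive (rderivB (kd s hs) (gd s hs)))
  (fun x => continuousB (kc x) (gc x)).
have : 0 <= (dk c - dg c) * (b - a) by rewrite mulr_ge0 // subr_ge0 // hle.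
by move=> h0 h1; lra.
Qed.

Lemma mean_value_abs_le (g k dg dk : R -> R) (a b : R) : a <= b ->
  (forall s, s \in `]a, b[ -> rderiv g s (dg s)) ->
  (forall s, s \in `]a, b[ -> rderiv k s (dk s)) ->
  {within `[a, b], continuous g} -> {within `[a, b], continuous k} ->
  (forall s, s \in `]a, b[ -> `|dg s| <= dk s) -> `|g b - g a| <= k b - k a.
Proof.
move=> ab gd kd gc kc hle; rewrite ler_norml; apply/andP; split; last first.
  apply: (mean_value_le ab gd kd gc kc) => s hs.
  exact: le_trans (ler_norm _) (hle s hs).
suff : - g b - - g a <= k b - k a by lra.
apply: (mean_value_le (g := fun s => - g s) (dg := fun s => - dg s) ab
  (fun s hs => rderivN (gd s hs)) kd (fun x => continuousN (gc x)) kc) => s hs.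
by apply: le_trans (hle s hs); rewrite -normrN ler_norm.
Qed.

Lemma mean_value_cst (g dg : R -> R) (a b c : R) : a <= b ->
  (forall s, s \in `]a, b[ -> rderiv g s (dg s)) ->
  {within `[a, b], continuous g} ->
  (forall s, s \in `]a, b[ -> `|dg s| <= c) -> `|g b - g a| <= c * (b - a).
Proof.
move=> ab gd gc hle.
have := mean_value_abs_le (k := fun s => c * s) (dk := fun=> c) ab gd
  (fun s _ => @rderiv_linear c s) gc _ hle.
rewrite -mulrBr; apply; apply: continuous_subspaceT => x.
by apply: cvgM; [exact: cvg_cst | exact: cvg_id].
Qed.

Definition vcont {V : normedModType R[i]} (u : R -> V) (a b : R) :=
  forall s, s \in `[a, b] -> vcvg (within `[a, b] (nbhs s)) u (u s).

Lemma rcontP (g : R -> R) a b :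
  (forall s, s \in `[a, b] -> g t @[t --> within `[a, b] (nbhs s)] --> g s) ->
  {within `[a, b], continuous g}.
Proof. by move=> h; apply/subspace_continuousP. Qed.

Section VCont.
Context {V W : normedModType R[i]}.

Lemma vcont_within (u : R -> V) a b :
  {within `[a, b], continuous u} -> vcont u a b.
Proof. by move=> /subspace_continuousP h s hs; apply/vcvgP; exact: h. Qed.

Lemma within_vcont (u : R -> V) a b :
  vcont u a b -> {within `[a, b], continuous u}.
Proof. by move=> h; apply/subspace_continuousP => s /h/vcvgP. Qed.

Lemma vcont_comp (m : R -> R) (u : R -> V) a b a' b' : continuous m ->
  (forall s, s \in `[a', b'] -> m s \in `[a, b]) -> vcont u a b ->
  vcont (fun s => u (m s)) a' b'.
Proof.
move=> mc mab uc s hs.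
have hm : m t @[t --> within `[a', b'] (nbhs s)] --> within `[a, b] (nbhs (m s)).
  move=> A hA; change (nbhs s (fun t => t \in `[a', b'] -> A (m t))).
  have {}hA : nbhs (m s) (fun r => r \in `[a, b] -> A r) by exact: hA.
  have h : nbhs s (fun t => m t \in `[a, b] -> A (m t)) := mc s _ hA.
  by apply: filterS h => t h /mab; exact: h.
exact: (cvg_comp _ _ hm (uc _ (mab _ hs))).
Qed.

Lemma vcont_sub (u : R -> V) a b a' b' : a <= a' -> b' <= b ->
  vcont u a b -> vcont u a' b'.
Proof.
move=> h1 h2; apply: (vcont_comp (m := id)) => s; first exact: cvg_id.
by rewrite !in_itv /=; lra.
Qed.

Lemma vcont_shift (u : R -> V) c a b a' b' : a <= c + a' -> c + b' <= b ->
  vcont u a b -> vcont (fun s => u (c + s)) a' b'.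
Proof.
move=> h1 h2; apply: vcont_comp => [s|s]; last by rewrite !in_itv /=; lra.
by apply: cvgD; [exact: cvg_cst | exact: cvg_id].
Qed.

Lemma vcont_rev (u : R -> V) c a b a' b' : a <= c - b' -> c - a' <= b ->
  vcont u a b -> vcont (fun s => u (c - s)) a' b'.
Proof.
move=> h1 h2; apply: vcont_comp => [s|s]; last by rewrite !in_itv /=; lra.
by apply: cvgB; [exact: cvg_cst | exact: cvg_id].
Qed.

Lemma vcont_cst (x : V) a b : vcont (fun=> x) a b.
Proof. by move=> s _; exact: vcvg_cst. Qed.

Lemma vcont_app (P : R -> V -> W) (M : R) (u : R -> V) a b :
  (forall s, s \in `[a, b] -> linear (P s) /\ opb M (P s)) ->
  (forall x, vcont (fun s => P s x) a b) -> vcont u a b ->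
  vcont (fun s => P s (u s)) a b.
Proof.
move=> Pb Pc uc s hs.
apply: (bounded_vcvg _ (Pc (u s) s hs) (uc s hs)).
by rewrite near_withinE; apply: nearW => t ht; exact: Pb.
Qed.

End VCont.

Lemma rcont_rip {H : hilbertType R} (u v : R -> H) a b :
  vcont u a b -> vcont v a b -> {within `[a, b], continuous (fun s => rip (u s) (v s))}.
Proof.
by move=> uc vc; apply: rcontP => s hs; apply: vcvg_rip; [exact: uc|exact: vc].
Qed.

End Calculus.

(** * Real-time properties of an analytic semigroup *)

(** What is used of analyticity: for positive times the orbits lie in the
domain, are differentiable, and [A e^{tA}] has norm of order [1 / t]. The
constant is at least [1] because [e^{0A}] is the identity. *)
Record parabolic {R : realType} {H : hilbertType R} (DA : set H) (A : H -> H)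
    (e : R -> H -> H) (T C : R) : Prop := Parabolic {
  sg0 : e 0 = id;
  sg_bounded : forall t, 0 <= t -> bounded_linear (e t);
  sgD : forall s t x, 0 <= s -> 0 <= t -> e (s + t) x = e s (e t x);
  sg_dom : forall t x, 0 < t -> DA (e t x);
  sg_deriv : forall t x, 0 < t -> vderiv (fun s => e s x) t (A (e t x));
  sg_cont : forall x, vcont (fun s => e s x) 0 T;
  sg_C1 : 1 <= C;
  sg_opb : forall t, 0 <= t <= T -> opb C (e t);
  sgA_opb : forall t, 0 < t <= T -> opb (C / t) (A \o e t)
}.

Section Semigroup.
Context {R : realType} {H : hilbertType R}.

Lemma sector_real (delta t : R) : 0 < delta -> 0 < t -> sector delta t%:C.
Proof.
move=> d0 t0; exists t, 0; split; rewrite ?normr0 //.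
by rewrite cos0 sin0 mulr1 mulr0.
Qed.

Lemma cvg_real_complex (t : R) : r%:C @[r --> t] --> (t%:C : R[i]^o).
Proof.
apply/(@cvgrPdist_lt _ (R[i]^o : pseudoMetricNormedZmodType R[i])) => e e0.
have er : e = (complex.Re e)%:C by rewrite RRe_real // gtr0_real.
have e0' : 0 < complex.Re e by rewrite -ltcR -er.
apply/nbhs_ballP; exists (complex.Re e) => // r h.
have {}h : `|t - r| < complex.Re e by exact: h.
by rewrite er -rmorphB normRC ltcR.
Qed.

(** The complex derivative at [t > 0], restricted to real increments, is the
derivative of the orbit. Its right-hand part is the limit which defines the
generator at [e^{tA} x], so this point lies in the domain and the derivative is
[A e^{tA} x]. *)
Lemma analytic_parabolic (DA : set H) (A : H -> H) (eA : R[i] -> H -> H) (T CA : R) :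
  analytic_semigroup eA -> is_generator eA DA A -> 
  (forall t, 0 < t <= T ->
       (opnorm (eA t%:C) <= CA%:E)%E /\
       (opnorm (A \o eA t%:C) <= (CA / t)%:E)%E) ->
  parabolic DA A (fun t => eA t%:C) T (Num.max 1 CA).
Proof.
move=> [delta [/andP[d0 _] [e0 eb eD ed ec]]] gen hC.
have e0' : eA 0%:C = id by rewrite rmorph0.
have eb' t : 0 <= t -> bounded_linear (eA t%:C).
  rewrite le_eqVlt => /predU1P[<-|t0]; last by apply: eb; exact: sector_real.
  by rewrite e0'; split => //; exists 1 => x; rewrite mul1r.
have eD' s t x : 0 <= s -> 0 <= t -> eA (s + t)%:C x = eA s%:C (eA t%:C x).
  rewrite le_eqVlt => /predU1P[<-|s0]; first by rewrite add0r e0'.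
  rewrite le_eqVlt => /predU1P[<-|t0]; first by rewrite addr0 e0'.
  by rewrite rmorphD eD //; exact: sector_real.
have deriv t : 0 < t -> exists2 V, bounded_linear V & opderiv (fun s => eA s%:C) t V.
  move=> t0; have [V [bV hV]] := ed _ (sector_real d0 t0).
  exists V => //.
  have hR : r%:C @[r --> (0 : R)^'] --> (0 : R[i]^o)^'.
    move=> U hU; have {}hU : nbhs (0 : R[i]^o) (fun z => z != 0 -> U z) by exact: hU.
    have := @cvg_real_complex 0 _ hU; rewrite /= => h.
    have {}h : nbhs (0 : R) (fun r => r%:C != 0 -> U r%:C) by exact: h.
    by apply: filterS h => r h r0; apply: h; rewrite fmorph_eq0.
  apply: opnorm_opcvg.
  - have pos : \forall h \near (0 : R)^', 0 < t + h.
      apply: cvg_within; apply: filterS (nbhsx_ballx (0 : R) t t0) => h.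
      by rewrite -ball_normE /= sub0r normrN => /ltr_normlP[]; lra.
    apply: filterS pos => h th a x y /=.
    have lth := (eb' _ (ltW th)).1; have lt := (eb' _ (ltW t0)).1.
    rewrite (lth a x y) (lt a x y) opprD addrACA -scalerBr scalerDr.
    by rewrite !scalerA mulrC.
  - exact: bV.1.
  - have := cvg_comp _ _ hR hV; apply: cvg_trans; apply: near_eq_cvg.
    by apply: nearW => h /=; rewrite -fmorphV -rmorphD.
have gA t V x : 0 < t -> bounded_linear V -> opderiv (fun s => eA s%:C) t V ->
    DA (eA t%:C x) /\ A (eA t%:C x) = V x.
  move=> t0 bV hV; have hx := @opderiv_app _ _ _ _ _ _ x bV hV.
  apply: (gen (eA t%:C x) (V x)).2.
  have hx' : ((h^-1)%:C *: (eA (t + h)%:C x - eA t%:C x)) @[h --> (0 : R)^'] --> V x.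
    exact/vcvgP.
  have hr : ((h^-1)%:C *: (eA (t + h)%:C x - eA t%:C x)) @[h --> (0 : R)^'+] --> V x.
    apply: cvg_trans hx'; apply: cvg_app => U hU.
    have {}hU : nbhs (0 : R) (fun r => r != 0 -> U r) by exact: hU.
    change (nbhs (0 : R) (fun r => 0 < r -> U r)).
    by apply: filterS hU => r h r0; apply: h; rewrite gt_eqF.
  apply: cvg_trans hr; apply: near_eq_cvg.
  near=> h; have h0 : 0 < h by near: h; exact: nbhs_right_gt.
  by rewrite (addrC t h) eD' ?(ltW h0) ?(ltW t0).
have gd t x : 0 < t -> DA (eA t%:C x) /\ vderiv (fun s => eA s%:C x) t (A (eA t%:C x)).
  move=> t0; have [V bV hV] := deriv _ t0.
  have [? ->] := gA t V x t0 bV hV; split => //; exact: opderiv_app bV hV.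
have Cmax : CA <= Num.max 1 CA by rewrite le_max lexx orbT.
have C1 : 1 <= Num.max 1 CA by rewrite le_max lexx.
have C0 : 0 <= Num.max 1 CA by rewrite (le_trans ler01).
split => //.
- by move=> t x t0; case: (gd t x t0).
- by move=> t x t0; case: (gd t x t0).
- move=> x s; rewrite in_itv /= => /andP[s0 sT].
  case: (ltP 0 s) => [sp|s0'].
    have hv := vderiv_continuous (gd s x sp).2.
    by apply: cvg_trans hv; apply: cvg_app; exact: cvg_within.
  have {s0 s0'} -> : s = 0 by apply/eqP; rewrite eq_le s0 s0'.
  apply/vcvgP/cvgrPdist_lt => e ep.
  move/cvgrPdist_lt : (ec x) => /(_ e ep) hU.
  have {}hU : nbhs (0 : R[i]^o) (fun z => sector delta z -> `|x - eA z x| < e) by exact: hU.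
  have {}hU := @cvg_real_complex 0 _ hU.
  have {}hU : nbhs (0 : R) (fun r => sector delta r%:C -> `|x - eA r%:C x| < e) by exact: hU.
  change (nbhs (0 : R) (fun r => r \in `[0, T] -> `|eA 0%:C x - eA r%:C x| < e)).
  apply: filterS hU => r h; rewrite in_itv /= => /andP[r0 _]; rewrite e0'.
  move: r0; rewrite le_eqVlt => /predU1P[<-|r0]; first by rewrite e0' subrr normr0.
  by apply: h; exact: sector_real.
- move=> t /andP[]; rewrite le_eqVlt => /predU1P[<- _ x|t0 tT].
    by rewrite e0' ler_peMl // rnorm_ge0.
  apply: opnorm_opb; first exact: (eb' _ (ltW t0)).1.
  have /hC[h _] : 0 < t <= T by rewrite t0.
  by rewrite (le_trans h) // lee_fin.
- move=> t /andP[t0 tT].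
  have [V bV hV] := deriv _ t0.
  have e : A \o eA t%:C = V.
    by apply/funext => x /=; case: (gA t V x t0 bV hV).
  have /hC[_ h] : 0 < t <= T by rewrite t0.
  rewrite e; apply: opnorm_opb; first exact: bV.1.
  by rewrite -e (le_trans h) // lee_fin ler_pM2r ?invr_gt0.
Unshelve. all: by end_near. Qed.

End Semigroup.

(** * Antiderivatives *)

Section Antiderivatives.
Context {R : realType}.
Implicit Types (g : R -> R) (a b : R).

(** The Newton integral as a relation. Its linearity, monotonicity and
uniqueness all come from the mean value theorem. *)
Definition antideriv g a b (I : R) := exists q : R -> R,
  [/\ {within `[a, b], continuous q},
      (forall s, s \in `]a, b[ -> rderiv q s (g s)) & q b - q a = I].

(** The only place where Lebesgue integration enters. *)
Lemma antideriv_exists g a b : a < b -> {within `[a, b], continuous g} ->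
  exists I, antideriv g a b I.
Proof.
move=> ab gc.
have gi : (@lebesgue_measure R).-integrable `[a, b] (EFin \o g).
  by apply: continuous_compact_integrable => //; exact: segment_compact.
pose F x := (\int[@lebesgue_measure R]_(t in [set` `[a, x]]) (g t))%R.
exists (F b - F a), F; split => //.
  exact: (parameterized_integral_continuous (ltW ab) gi).
move=> s; rewrite in_itv /= => /andP[as_ sb].
have gs : {for s, continuous g}.
  by apply: (within_continuous_continuous ab gc); rewrite in_itv /= as_.
have [Fd FE] := continuous_FTC1_closed sb gi as_ gs.
rewrite -/F in Fd FE; rewrite -FE derive1E.
move/derivableP : Fd => [Fd _].
have h : h^-1 *: ((F \o shift s) (h *: (1 : R)) - F s) @[h --> (0 : R)^'] --> 'D_1 F s.
  exact: Fd.
apply: cvg_trans h; apply: near_eq_cvg; apply: nearW => r /=.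
by rewrite [r *: _]mulr1 (addrC r).
Qed.

Lemma antiderivD g f a b I J : antideriv g a b I -> antideriv f a b J ->
  antideriv (fun s => g s + f s) a b (I + J).
Proof.
move=> [q [qc qd qI]] [p [pc pd pJ]]; exists (fun s => q s + p s); split.
- by move=> x; exact: continuousD (qc x) (pc x).
- by move=> s hs; apply: rderivD; [exact: qd|exact: pd].
- by rewrite -qI -pJ; ring.
Qed.

Lemma antiderivZ c g a b I : antideriv g a b I ->
  antideriv (fun s => c * g s) a b (c * I).
Proof.
move=> [q [qc qd qI]]; exists (fun s => c * q s); split.
- by move=> x; apply: cvgM; [exact: cvg_cst|exact: qc].
- by move=> s hs; apply: rderivZ; exact: qd.
- by rewrite -qI; ring.
Qed.

Lemma antideriv_cst c a b : antideriv (fun=> c) a b (c * (b - a)).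
Proof.
exists (fun s => c * s); split; last by rewrite mulrBr.
  apply: continuous_subspaceT => x.
  by apply: cvgM; [exact: cvg_cst | exact: cvg_id].
by move=> s _; exact: rderiv_linear.
Qed.

Lemma eq_antideriv f g a b I : (forall s, s \in `]a, b[ -> f s = g s) ->
  antideriv f a b I -> antideriv g a b I.
Proof.
by move=> fg [q [qc qd qI]]; exists q; split => // s hs; rewrite -fg //; exact: qd.
Qed.

Lemma antideriv_le f g a b I J : a <= b -> antideriv f a b I -> antideriv g a b J ->
  (forall s, s \in `]a, b[ -> f s <= g s) -> I <= J.
Proof.
by move=> ab [q [qc qd <-]] [p [pc pd <-]]; exact: mean_value_le.
Qed.

Lemma antideriv_unique g a b I J : a <= b ->
  antideriv g a b I -> antideriv g a b J -> I = J.
Proof.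
move=> ab hI hJ; apply/eqP; rewrite eq_le.
by rewrite (antideriv_le ab hI hJ) ?(antideriv_le ab hJ hI).
Qed.

Lemma antideriv_abs_le g a b I c : a <= b -> antideriv g a b I ->
  (forall s, s \in `]a, b[ -> `|g s| <= c) -> `|I| <= c * (b - a).
Proof. by move=> ab [q [qc qd <-]]; exact: mean_value_cst. Qed.

End Antiderivatives.

(** * Riemann integrals of curves in a Hilbert space *)

Section Partitions.
Context {R : realType} (a b : R) (s : seq R).
Hypothesis sP : itv_partition a b s.

Lemma partition_lt i : (i < size s)%N -> nth 0 (a :: s) i < nth 0 s i.
Proof. by case: sP => /(pathP 0) h _; exact: h. Qed.

Lemma partition_telescope (F : R -> R) :
  \sum_(i < size s) (F (nth 0 s i) - F (nth 0 (a :: s) i)) = F b - F a.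
Proof.
case: sP => _ /eqP <-.
rewrite -(big_mkord xpredT (fun i => F (nth 0 s i) - F (nth 0 (a :: s) i))).
rewrite (telescope_sumr (fun i => F (nth 0 (a :: s) i)) (leq0n _)) /=.
by rewrite (last_nth 0).
Qed.

Lemma partition_ge i : (i <= size s)%N -> a <= nth 0 (a :: s) i.
Proof.
elim: i => [//|i ih] hi; apply: le_trans (ih (ltnW hi)) _.
exact: ltW (partition_lt hi).
Qed.

Lemma partition_le i : (i <= size s)%N -> nth 0 (a :: s) i <= b.
Proof.
move=> hi; have {hi} : (i = size s - (size s - i))%N by rewrite subKn.
elim: (size s - i)%N {-2}i => [|k ih] j ->.
  by rewrite subn0; case: sP => _ /eqP <-; rewrite (last_nth 0).
case: (leqP (size s) k) => hk.
  by rewrite (eqP (_ : size s - k.+1 == 0)%N) ?subn_eq0 ?(leq_trans hk) //;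
     have := ih 0%N; rewrite (eqP (_ : size s - k == 0)%N) ?subn_eq0 // => /(_ erefl).
apply: le_trans (ih _ erefl); have hj : (size s - k.+1 < size s)%N by rewrite subnSK // leq_subr.
by have := partition_lt hj; rewrite -(subnSK hk) => /ltW.
Qed.

End Partitions.

Lemma uniform_partition {R : realType} (t d : R) : 0 < t -> 0 < d ->
  exists s : seq R, itv_partition 0 t s /\
    forall i, (i < size s)%N -> nth 0 s i - nth 0 (0 :: s) i < d.
Proof.
move=> t0 d0.
pose n := (Num.trunc (t / d)).+1.
have hn : t / n%:R < d.
  rewrite ltr_pdivrMr ?ltr0n // mulrC -ltr_pdivrMr //; exact: truncnS_gt.
pose s := [seq t * i.+1%:R / n%:R | i <- iota 0 n].
have sz : size s = n by rewrite size_map size_iota.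
have hs i : (i <= n)%N -> nth 0 (0 :: s) i = t * i%:R / n%:R.
  case: i => [|i] hi /=; first by rewrite mulr0 mul0r.
  by rewrite (nth_map 0%N) ?size_iota // nth_iota.
have hs' i : (i < n)%N -> nth 0 s i = t * i.+1%:R / n%:R by move=> hi; exact: hs i.+1 hi.
exists s; split; first split.
- apply/(pathP 0) => i; rewrite sz => hi; rewrite hs ?(ltnW hi) // hs' //.
  by rewrite ltr_pM2r ?invr_gt0 ?ltr0n // ltr_pM2l // ltr_nat.
- by rewrite (last_nth 0) sz hs // mulfK // pnatr_eq0.
- move=> i; rewrite sz => hi; rewrite hs ?(ltnW hi) // hs' //.
  by rewrite -mulrBl -mulrBr -natrB // subSnn mulr1.
Qed.

Section Rint.
Context {R : realType} {H : hilbertType R}.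
Variables (f : R -> H) (t M : R).
Hypotheses (t0 : 0 < t) (M0 : 0 <= M).
Hypothesis fM : forall s, s \in `[0, t] -> rnorm (f s) <= M.
Hypothesis fw : forall y, {within `[0, t], continuous (fun s => rip (f s) y)}.
Hypothesis fL : forall c, c < t -> exists2 L, 0 <= L & forall r s, 0 <= r <= c -> 0 <= s <= c ->
  rnorm (f r - f s) <= L * `|r - s|.

(** Evaluate both limits on one fine uniform partition. *)
Lemma is_rint_unique v w : is_rint f 0 t v -> is_rint f 0 t w -> v = w.
Proof.
move=> hv hw; apply/eqP; rewrite -subr_eq0; apply/eqP/rnorm_eq0/eqP.
rewrite eq_le rnorm_ge0 andbT leNgt; apply/negP => e0.
set e := rnorm _ in e0.
have e20 : 0 < e / 2 by rewrite divr_gt0.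
have [d1 d10 h1] := hv _ e20; have [d2 d20 h2] := hw _ e20.
have d0 : 0 < Num.min d1 d2 by rewrite lt_min d10.
have [s [sP sd]] := uniform_partition t0 d0.
pose xi i := nth 0 s i.
have tag i : (i < size s)%N -> nth 0 (0 :: s) i <= xi i /\ xi i <= nth 0 s i.
  by move=> hi; split => //; exact: ltW (partition_lt sP hi).
have m1 : Num.min d1 d2 <= d1 by rewrite ge_min lexx.
have m2 : Num.min d1 d2 <= d2 by rewrite ge_min lexx orbT.
have {}h1 := h1 s xi sP (fun i hi => And3 (tag i hi).1 (tag i hi).2
  (lt_le_trans (sd i hi) m1)).
have {}h2 := h2 s xi sP (fun i hi => And3 (tag i hi).1 (tag i hi).2
  (lt_le_trans (sd i hi) m2)).
move: h1 h2; set x := \sum_(i < _) _ => h1 h2.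
have := ler_rnorm_distD x v w; rewrite (rnormBC v x) -/e; lra.
Qed.

(** The primitive of the pairings with [y] defines the integral by duality;
the Riemann sums approach it because, on each cell, the mean value inequality
compares [f (xi i)] with the values of [f] on that cell. Cells near the
endpoint [t], where only boundedness is known, have small total length, which
is counted by the telescoping sum of [r |-> Num.max r c]. *)
Lemma is_rint_exists : exists v, is_rint f 0 t v /\
  forall y, antideriv (fun s => rip (f s) y) 0 t (rip v y).
Proof.
have tl := ltW t0.
have [I hI] := choice (fun y => antideriv_exists t0 (fw (y := y))).
have ID x y : I (x + y) = I x + I y.
  apply: (antideriv_unique tl (hI (x + y))).
  apply: (eq_antideriv _ (antiderivD (hI x) (hI y))) => s _.
  by rewrite ripDr.
have IZ r x : I (r%:C *: x) = r * I x.
  apply: (antideriv_unique tl (hI (r%:C *: x))).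
  apply: (eq_antideriv _ (antiderivZ r (hI x))) => s _.
  by rewrite ripZr.
have IM x : I x <= M * t * rnorm x.
  apply: le_trans (ler_norm _) _.
  have -> : M * t * rnorm x = M * rnorm x * (t - 0) by ring.
  apply: (antideriv_abs_le tl (hI x)) => s hs.
  apply: le_trans (abs_rip_le _ _) _; rewrite ler_wpM2r ?rnorm_ge0 //.
  by apply: fM; apply: subset_itv_oo_cc.
have [v hv] := riesz ID IZ IM.
exists v; split; last by move=> y; rewrite hv; exact: hI.
move=> eps eps0.
(* on cells starting from c = t - 2 eta on, values of f differ by at most 2 M;
   the other cells lie in [0, t - eta], where f is Lipschitz *)
pose eta := Num.min (t / 2) (eps / (8 * (M + 1))).
have M1 : 0 < M + 1 by rewrite ltr_wpDl.
have eta0 : 0 < eta by rewrite lt_min !divr_gt0 // mulr_gt0.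
have etat : eta <= t / 2 by rewrite ge_min lexx.
have etae : 4 * M * eta <= eps / 2.
  have : eta <= eps / (8 * (M + 1)) by rewrite ge_min lexx orbT.
  by rewrite ler_pdivlMr ?mulr_gt0 //; nra.
pose c := t - 2 * eta.
have c0 : 0 <= c by rewrite /c; lra.
have ct : t - eta < t by lra.
have [L L0 hL] := fL ct.
pose e' := eps / (4 * t).
have e'0 : 0 < e' by rewrite divr_gt0 // mulr_gt0.
pose d := Num.min eta (e' / (L + 1)).
have L1 : 0 < L + 1 by rewrite ltr_wpDl.
have d0 : 0 < d by rewrite lt_min eta0 divr_gt0.
have de : d <= eta by rewrite ge_min lexx.
have dL : L * d <= e'.
  have : d <= e' / (L + 1) by rewrite ge_min lexx orbT.
  by rewrite ler_pdivlMr //; nra.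
exists d => // s xi sP hs.
pose u i := nth 0 (0 :: s) i; pose w i := nth 0 s i.
have ui i : (i < size s)%N -> 0 <= u i /\ u i <= t.
  by move=> hi; split; [apply: (partition_ge sP)|apply: (partition_le sP)]; exact: ltnW.
have wi i : (i < size s)%N -> 0 <= w i /\ w i <= t.
  by move=> hi; split; [exact: (@partition_ge _ _ _ _ sP i.+1)|exact: (@partition_le _ _ _ _ sP i.+1)].
have uw i : (i < size s)%N -> u i < w i by move=> hi; exact: (partition_lt sP).
suff hD : rnorm (\sum_(i < size s) (w i - u i)%:C *: f (xi i) - v) <= 3 / 4 * eps.
  by apply: le_lt_trans hD _; lra.
apply: rnorm_le_dual => [|y]; first by rewrite mulr_ge0 // ltW.
have [q [qc qd qI]] := hI y.
pose m r := Num.max r c.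
have key i : (i < size s)%N ->
    (w i - u i) * rip (f (xi i)) y - (q (w i) - q (u i)) <=
    ((w i - u i) * e' + 2 * M * (m (w i) - m (u i))) * rnorm y.
  move=> hi; have [u0 ut] := ui i hi; have [w0 wt] := wi i hi; have uwi := uw i hi.
  have [x1 x2 x3] := hs i hi; rewrite -/(u i) -/(w i) in x1 x2 x3.
  have bound B : (forall r, u i < r < w i -> rnorm (f (xi i) - f r) <= B) ->
     (w i - u i) * rip (f (xi i)) y - (q (w i) - q (u i)) <= (w i - u i) * B * rnorm y.
    move=> hB; apply: le_trans (ler_norm _) _.
    pose g r := r * rip (f (xi i)) y - q r.
    have -> : (w i - u i) * rip (f (xi i)) y - (q (w i) - q (u i)) = g (w i) - g (u i).
      by rewrite /g; ring.
    have -> : (w i - u i) * B * rnorm y = B * rnorm y * (w i - u i) by ring.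
    apply: (mean_value_cst (dg := fun r => rip (f (xi i)) y - rip (f r) y)).
    - exact: ltW.
    - move=> r; rewrite in_itv /= => /andP[r1 r2]; apply: rderivB.
        have := @rderiv_linear _ (rip (f (xi i)) y) r.
        by rewrite (_ : (fun _ => _) = (fun r => r * rip (f (xi i)) y)) //; apply/funext => ?; rewrite mulrC.
      by apply: qd; rewrite in_itv /=; lra.
    - have qc' : {within `[u i, w i], continuous q}.
        by apply: continuous_subspaceW qc; apply: subset_itv; rewrite bnd_simp.
      have lc : {within `[u i, w i], continuous (fun r => r * rip (f (xi i)) y)}.
        by apply: continuous_subspaceT => r; apply: cvgM; [exact: cvg_id|exact: cvg_cst].
      by move=> x; exact: continuousB (lc x) (qc' x).
    - move=> r; rewrite in_itv /= => hr; rewrite -ripBl.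
      apply: le_trans (abs_rip_le _ _) _; rewrite ler_wpM2r ?rnorm_ge0 //.
      exact: hB.
  have hm : m (u i) <= m (w i) by rewrite /m le_max2 // ltW.
  case: (ltP (u i) c) => uc.
    apply: le_trans (bound e' _) _.
      move=> r /andP[r1 r2].
      have xc : 0 <= xi i <= t - eta by rewrite /c in uc; lra.
      have rc : 0 <= r <= t - eta by rewrite /c in uc; lra.
      apply: le_trans (hL _ _ xc rc) _; apply: le_trans dL; rewrite ler_wpM2l //.
      by rewrite ler_norml; lra.
    rewrite ler_wpM2r ?rnorm_ge0 // lerDl !mulr_ge0 // subr_ge0 //.
  apply: le_trans (bound (2 * M) _) _.
    move=> r /andP[r1 r2]; apply: le_trans (ler_rnormB _ _) _.
    have -> : 2 * M = M + M by ring.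
    by apply: lerD; apply: fM; rewrite in_itv /=; lra.
  rewrite ler_wpM2r ?rnorm_ge0 //.
  have -> : m (w i) = w i by rewrite /m; apply/max_idPl; lra.
  have -> : m (u i) = u i by rewrite /m; apply/max_idPl.
  by rewrite mulrC lerDr mulr_ge0 // ?subr_ge0 ltW.
have ripsum : rip (\sum_(i < size s) (w i - u i)%:C *: f (xi i)) y =
    \sum_(i < size s) (w i - u i) * rip (f (xi i)) y.
  elim/big_ind2: _ => [|x1 x2 y1 y2 <- <-|i _]; first exact: rip0l.
    exact: ripDl.
  exact: ripZl.
have tq := @partition_telescope _ 0 t s sP q.
rewrite ripBl hv -qI -tq ripsum -sumrB.
have hsum : \sum_(i < size s) ((w i - u i) * rip (f (xi i)) y - (q (w i) - q (u i)))
    <= \sum_(i < size s) ((w i - u i) * e' + 2 * M * (m (w i) - m (u i))) * rnorm y.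
  by apply: ler_sum => i _; exact: key.
apply: (le_trans hsum).
rewrite -mulr_suml ler_wpM2r ?rnorm_ge0 // big_split /= -mulr_suml -mulr_sumr.
rewrite (@partition_telescope _ 0 t s sP m) (@partition_telescope _ 0 t s sP id) /= subr0.
have -> : m t = t by rewrite /m; apply/max_idPl; rewrite /c; lra.
have -> : m 0 = c by rewrite /m; apply/max_idPr.
have -> : t * e' = eps / 4 by rewrite /e'; field; rewrite gt_eqF.
rewrite /c; lra.
Qed.

Lemma rint_antideriv y : antideriv (fun s => rip (f s) y) 0 t (rip (rint 0 t f) y).
Proof.
have [v [hv hI]] := is_rint_exists.
suff -> : rint 0 t f = v by exact: hI.
rewrite /rint; case: xgetP => [w -> hw|none]; first exact: is_rint_unique.
by case: (none v).
Qed.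

End Rint.

(** * The affine flow *)

Section Flow.
Context {R : realType} {H : hilbertType R}.
Context {DA : set H} {A : H -> H} {eA : R[i] -> H -> H} {T C : R}.
Let e (t : R) := eA t%:C.
Hypothesis sg : parabolic DA A e T C.

Lemma sgC_ge0 : 0 <= C.
Proof. exact: le_trans ler01 (sg_C1 sg). Qed.

Lemma sg_lin t : 0 <= t -> linear (e t).
Proof. by move=> t0; case: (sg_bounded sg t0). Qed.

(** The derivative of the orbit has norm at most [C / s |x|], and [s >= a]. *)
Lemma sg_dist_le a b x : 0 < a -> a <= b -> b <= T ->
  rnorm (e b x - e a x) <= (b - a) * (C / a) * rnorm x.
Proof.
move=> a0 ab bT.
apply: rnorm_le_dual => [|y].
  by rewrite !mulr_ge0 ?rnorm_ge0 ?subr_ge0 ?invr_ge0 ?sgC_ge0 // ltW.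
rewrite ripBl.
have -> : (b - a) * (C / a) * rnorm x * rnorm y = (C / a) * rnorm x * rnorm y * (b - a) by ring.
apply: le_trans (ler_norm _) _.
apply: (mean_value_cst (g := fun s => rip (e s x) y) (dg := fun s => rip (A (e s x)) y)) => //.
- move=> s; rewrite in_itv /= => /andP[as_ sb].
  have h := rderiv_rip (sg_deriv sg x (lt_trans a0 as_)) (vderiv_cst y s).
  by rewrite rip0r addr0 in h.
- apply: rcont_rip; last exact: vcont_cst.
  by apply: vcont_sub (sg_cont sg x) => //; exact: ltW.
- move=> s; rewrite in_itv /= => /andP[as_ sb].
  apply: le_trans (abs_rip_le _ _) _; rewrite ler_wpM2r ?rnorm_ge0 //.
  have s0 := lt_trans a0 as_.
  have sT : 0 < s <= T by rewrite s0 /= (le_trans (ltW sb)).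
  apply: le_trans (sgA_opb sg sT x) _; rewrite ler_wpM2r ?rnorm_ge0 //.
  by rewrite ler_wpM2l ?sgC_ge0 // lef_pV2 ?posrE // ltW.
Qed.

Lemma sg_dist d a b x : 0 < d -> d <= a <= T -> d <= b <= T ->
  rnorm (e b x - e a x) <= `|b - a| * (C / d) * rnorm x.
Proof.
wlog ab : a b / a <= b => [W|] d0 ha hb.
  case: (leP a b) => ab; first exact: W.
  by rewrite rnormBC distrC; apply: W => //; exact: ltW.
have a0 : 0 < a by case/andP: ha => h _; exact: lt_le_trans h.
apply: le_trans (sg_dist_le x a0 ab _) _; first by case/andP: hb.
rewrite ger0_norm ?subr_ge0 // ler_wpM2r ?rnorm_ge0 // ler_wpM2l ?subr_ge0 //.
rewrite ler_wpM2l ?sgC_ge0 // lef_pV2 ?posrE //; by case/andP: ha.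
Qed.

Lemma exp_calA_rip t X x y : 0 <= t ->
  rip (exp_calA eA t X x) y = rip (X (e t x)) (e t y).
Proof.
by move=> t0; rewrite /exp_calA /= ripC -(adjP (sg_bounded sg t0)) ripC.
Qed.

Section Source.
Variables (Q : H -> H) (kQ tau : R).
Hypotheses (sQ : SigmaP Q) (kQ0 : 0 <= kQ) (hQ : opb kQ Q).
Hypotheses (tau0 : 0 < tau) (tauT : tau <= T).

Let bQ : bounded_linear Q. Proof. by case: sQ => [[]]. Qed.
Let lQ : linear Q. Proof. by case: bQ. Qed.

Let back (s : R) : s \in `[0, tau] -> 0 <= tau - s /\ tau - s <= T.
Proof.
rewrite in_itv /= => /andP[s0 st]; split; first by rewrite subr_ge0.
by rewrite lerBlDr (le_trans tauT) // lerDl.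
Qed.

Let e_le (s : R) x : s \in `[0, tau] -> rnorm (e (tau - s) x) <= C * rnorm x.
Proof. by move=> /back[? ?]; apply: (sg_opb sg); apply/andP. Qed.

Let e_cont x : vcont (fun s => e (tau - s) x) 0 tau.
Proof.
have h1 : 0 <= tau - tau by rewrite subrr.
have h2 : tau - 0 <= T by rewrite subr0.
exact: vcont_rev h1 h2 (sg_cont sg x).
Qed.

Lemma source_rip_le s x y : s \in `[0, tau] ->
  `|rip (Q (e (tau - s) x)) (e (tau - s) y)| <= kQ * C ^+ 2 * rnorm x * rnorm y.
Proof.
move=> hs; apply: le_trans (abs_rip_le _ _) _.
have -> : kQ * C ^+ 2 * rnorm x * rnorm y = (kQ * (C * rnorm x)) * (C * rnorm y) by ring.
apply: ler_pM; rewrite ?rnorm_ge0 ?e_le //.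
by apply: le_trans (hQ _) _; rewrite ler_wpM2l // e_le.
Qed.

Lemma source_cont (x y : H) :
  {within `[0, tau], continuous (fun s => rip (Q (e (tau - s) x)) (e (tau - s) y))}.
Proof.
apply: rcont_rip => //.
apply: (vcont_app (M := kQ) (P := fun=> Q)) => [s hs|z|]; first by split.
  exact: vcont_cst.
exact: e_cont.
Qed.

(** Away from [s = tau] the integrand is Lipschitz in norm, because the
semigroup is; at [s = tau] it is only bounded and weakly continuous. This is
what [rint_antideriv] requires. *)
Lemma exp_F_rip X x y : exists2 I,
  antideriv (fun s => rip (Q (e (tau - s) x)) (e (tau - s) y)) 0 tau I &
  rip (exp_F eA Q tau X x) y = rip (X (e tau x)) (e tau y) + I.
Proof.
pose f s := exp_calA eA (tau - s) Q x.
have fE s z : s \in `[0, tau] -> rip (f s) z = rip (Q (e (tau - s) x)) (e (tau - s) z).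
  by move=> /back[h _]; rewrite /f exp_calA_rip.
have M0 : 0 <= kQ * C ^+ 2 * rnorm x by rewrite !mulr_ge0 ?exprn_ge0 ?sgC_ge0 ?rnorm_ge0.
have fM s : s \in `[0, tau] -> rnorm (f s) <= kQ * C ^+ 2 * rnorm x.
  move=> hs; apply: rnorm_le_dual => // z; rewrite fE //.
  by apply: le_trans (ler_norm _) _; exact: source_rip_le.
have fw z : {within `[0, tau], continuous (fun s => rip (f s) z)}.
  have h : {in `[0, tau]%classic,
      (fun s => rip (Q (e (tau - s) x)) (e (tau - s) z)) =1 (fun s => rip (f s) z)}.
    by move=> s; rewrite inE => hs; rewrite fE.
  by move: (@source_cont x z); apply: (subspace_eq_continuous h).
have fL c : c < tau -> exists2 L, 0 <= L & forall r s, 0 <= r <= c -> 0 <= s <= c ->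
    rnorm (f r - f s) <= L * `|r - s|.
  move=> ct; have d0 : 0 < tau - c by rewrite subr_gt0.
  exists (2 * (kQ * (C / (tau - c)) * C * rnorm x)).
    by rewrite !mulr_ge0 ?invr_ge0 ?sgC_ge0 ?rnorm_ge0 // ltW.
  move=> r s hr hs; apply: rnorm_le_dual => [|z].
    by rewrite !mulr_ge0 ?invr_ge0 ?sgC_ge0 ?rnorm_ge0 // ltW.
  have ri : r \in `[0, tau] by rewrite in_itv /=; lra.
  have si : s \in `[0, tau] by rewrite in_itv /=; lra.
  rewrite ripBl !fE //.
  have dist w : rnorm (e (tau - r) w - e (tau - s) w) <= `|r - s| * (C / (tau - c)) * rnorm w.
    have -> : `|r - s| = `|(tau - r) - (tau - s)| by rewrite distrC; congr `|_|; ring.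
    by have tT := tauT; apply: sg_dist; lra.
  set ar := e (tau - r) x; set as_ := e (tau - s) x; set br := e (tau - r) z; set bs := e (tau - s) z.
  have -> : rip (Q ar) br - rip (Q as_) bs = rip (Q (ar - as_)) br + rip (Q as_) (br - bs).
    by rewrite (linB lQ) ripBl ripBr; ring.
  have -> : 2 * (kQ * (C / (tau - c)) * C * rnorm x) * `|r - s| * rnorm z =
     kQ * (`|r - s| * (C / (tau - c)) * rnorm x) * (C * rnorm z) +
     kQ * (C * rnorm x) * (`|r - s| * (C / (tau - c)) * rnorm z) by ring.
  apply: lerD; apply: le_trans (rip_le _ _) _; apply: ler_pM; rewrite ?rnorm_ge0 ?e_le ?dist //.
    by apply: le_trans (hQ _) _; rewrite ler_wpM2l // dist.
  by apply: le_trans (hQ _) _; rewrite ler_wpM2l // e_le.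
have := rint_antideriv tau0 M0 fM fw fL y.
exists (rip (rint 0 tau f) y).
  apply: eq_antideriv (rint_antideriv tau0 M0 fM fw fL y) => s hs.
  by rewrite fE //; exact: subset_itv_oo_cc.
by rewrite /exp_F ripDl exp_calA_rip // ltW.
Qed.

(** All properties are read off the pairings in [exp_F_rip] and the uniqueness
of antiderivatives. *)
Lemma exp_F_SigmaP X : SigmaP X -> SigmaP (exp_F eA Q tau X).
Proof.
move=> sX.
have [/SigmaE[[lX bX] symX] posX] := iffLR (SigmaPE _) sX.
have [/SigmaE[_ symQ] posQ] := iffLR (SigmaPE _) sQ.
have tl := ltW tau0.
have lE := sg_lin.
have lF : linear (exp_F eA Q tau X).
  move=> a u v; apply: rip_ext => z.
  have [I hI ->] := exp_F_rip X (a *: u + v) z.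
  rewrite ripDl ripZiZ.
  have [J hJ ->] := exp_F_rip X u (a^*%C *: z).
  have [K hK ->] := exp_F_rip X v z.
  have -> : I = J + K.
    apply: (antideriv_unique tl hI); apply: eq_antideriv (antiderivD hJ hK) => s hs.
    have /back[h _] : s \in `[0, tau] by exact: subset_itv_oo_cc.
    by rewrite !(linD (lE _ h)) !(linZ (lE _ h)) !(linD lQ) !(linZ lQ) ripDl ripZiZ.
  by rewrite !(linD (lE _ tl)) !(linZ (lE _ tl)) !(linD lX) !(linZ lX) ripDl ripZiZ; ring.
have symF : rsym (exp_F eA Q tau X).
  move=> x y; rewrite (ripC x).
  have [I hI ->] := exp_F_rip X x y; have [J hJ ->] := exp_F_rip X y x.
  rewrite symX ripC; congr (_ + _).
  apply: (antideriv_unique tl hI); apply: eq_antideriv hJ => s _.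
  by rewrite symQ ripC.
apply/SigmaPE; split; last first.
  move=> x; have [I hI ->] := exp_F_rip X x x.
  rewrite addr_ge0 //.
  have := antideriv_le tl (antideriv_cst 0 0 tau) hI; rewrite mul0r; apply => s _; exact: posQ.
apply/SigmaE; split => //; split => //.
have [K K0 hK] := bounded_linear_opb (conj lX bX : bounded_linear X).
exists (K * C ^+ 2 + kQ * C ^+ 2 * tau) => x.
apply: rnorm_le_dual => [|y].
  rewrite mulr_ge0 ?rnorm_ge0 // addr_ge0 //; by rewrite !mulr_ge0 ?exprn_ge0 ?sgC_ge0 // ltW.
have [I hI ->] := exp_F_rip X x y.
rewrite !mulrDl; apply: lerD.
  apply: le_trans (rip_le _ _) _.
  have -> : K * C ^+ 2 * rnorm x * rnorm y = (K * (C * rnorm x)) * (C * rnorm y) by ring.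
  have tt : 0 <= tau <= T by rewrite tl.
  apply: ler_pM; rewrite ?rnorm_ge0 ?(sg_opb sg tt) //.
  by apply: le_trans (hK _) _; rewrite ler_wpM2l // (sg_opb sg tt).
apply: le_trans (ler_norm _) _.
have -> : kQ * C ^+ 2 * tau * rnorm x * rnorm y = kQ * C ^+ 2 * rnorm x * rnorm y * (tau - 0) by ring.
apply: (antideriv_abs_le tl hI) => s hs; apply: source_rip_le.
exact: subset_itv_oo_cc.
Qed.

End Source.
End Flow.

(** * Absorption and operator derivatives *)

Section Absorption.
Context {R : realType}.

(** Each application of the hypothesis halves the distance of the constant to
[2 c]. This replaces taking suprema in Gronwall arguments. *)
Lemma absorb (I : Type) (D : I -> Prop) (v w : I -> R) (c M : R) :
  0 <= c -> 0 <= M -> (forall i, D i -> 0 <= w i) -> (forall i, D i -> v i <= M * w i) ->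
  (forall m, 0 <= m -> (forall i, D i -> v i <= m * w i) ->
     forall i, D i -> v i <= (c + m / 2) * w i) ->
  forall i, D i -> v i <= 2 * c * w i.
Proof.
move=> c0 M0 w0 hM step i Di.
have q0 n : 0 <= 2^-1 ^+ n :> R by rewrite exprn_ge0.
have h n : forall i, D i -> v i <= (2 * c + M * 2^-1 ^+ n) * w i.
  elim: n => [|n ih] j Dj.
    apply: le_trans (hM j Dj) _; rewrite expr0 mulr1 ler_wpM2r ?w0 // lerDr.
    by rewrite mulr_ge0.
  have m0 : 0 <= 2 * c + M * 2^-1 ^+ n by rewrite addr_ge0 ?mulr_ge0.
  apply: le_trans (step _ m0 ih j Dj) _; rewrite le_eqVlt; apply/orP; left.
  by apply/eqP; rewrite exprS; field.
rewrite -subr_le0; apply: (@le0_geometric _ _ (M * w i)) => n.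
by have := h n i Di; lra.
Qed.

(** Solutions are required to be nonnegative and bounded only at interior
times; this carries such properties to the endpoints. *)
Lemma within_ge0 (g : R -> R) a b : a < b -> {within `[a, b], continuous g} ->
  (forall s, s \in `]a, b[ -> 0 <= g s) -> forall s, s \in `[a, b] -> 0 <= g s.
Proof.
move=> ab /subspace_continuousP gc h s hs; rewrite leNgt; apply/negP => gs.
have ngs : 0 < - g s by rewrite oppr_gt0.
move/cvgrPdist_lt : (gc s hs) => /(_ _ ngs) hn.
have {}hn : nbhs s (fun t => t \in `[a, b] -> `|g s - g t| < - g s) by exact: hn.
have /nbhs_ballP[r r0 hr] := hn.
have {}r0 : 0 < r by exact: r0.
(* an interior point close to s, where g is both negative and nonnegative *)
have [t tab tr] : exists2 t, t \in `]a, b[ & `|s - t| < r.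
  move: hs; rewrite in_itv /= => /andP[as_ sb].
  (* move away from s towards the midpoint, which stays in the open interval *)
  pose d := Num.min (r / 2) ((b - a) / 4).
  have d0 : 0 < d by rewrite lt_min !divr_gt0 // subr_gt0.
  have dr : d <= r / 2 by rewrite ge_min lexx.
  have db : d <= (b - a) / 4 by rewrite ge_min lexx orbT.
  case: (ltP s ((a + b) / 2)) => hs.
    exists (s + d); first by rewrite in_itv /=; lra.
    by rewrite ltr_norml; lra.
  exists (s - d); first by rewrite in_itv /=; lra.
  by rewrite ltr_norml; lra.
have tab' : t \in `[a, b] by exact: subset_itv_oo_cc.
have := hr t tr tab'; rewrite /= ltr_norml => /andP[+ _].
by have := h t tab; lra.
Qed.

End Absorption.

Section OperatorDerivative.
Context {R : realType} {H : hilbertType R}.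
Implicit Types (P : R -> H -> H) (D : H -> H).

Lemma is_opderive_opderiv P t D : (\forall h \near (0 : R)^', linear (P (t + h))) ->
  linear (P t) -> is_opderive P t D -> opderiv P t D.
Proof.
move=> lP lt [bD hD]; apply: opnorm_opcvg => //; last exact: bD.1.
apply: filterS lP => h lh a x y /=.
by rewrite (lh a x y) (lt a x y) opprD addrACA -scalerBr scalerDr !scalerA mulrC.
Qed.

Lemma is_opderive_unique P t D D' : (\forall h \near (0 : R)^', linear (P (t + h))) ->
  linear (P t) -> is_opderive P t D -> is_opderive P t D' -> D = D'.
Proof.
move=> lP lt hD hD'; apply/funext => x.
have /vcvgP h := @opderiv_app _ _ _ _ _ _ x hD.1 (is_opderive_opderiv lP lt hD).
have /vcvgP h' := @opderiv_app _ _ _ _ _ _ x hD'.1 (is_opderive_opderiv lP lt hD').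
exact: (cvg_unique _ h h').
Qed.

Lemma opderive_eq P t D : (\forall h \near (0 : R)^', linear (P (t + h))) ->
  linear (P t) -> is_opderive P t D -> opderive P t = D.
Proof.
move=> lP lt hD; rewrite /opderive; case: xgetP => [D' -> hD'|none].
  exact: is_opderive_unique hD' hD.
by case: (none D).
Qed.

Lemma opderiveP P t : (exists D, is_opderive P t D) -> is_opderive P t (opderive P t).
Proof. by move=> [D hD]; rewrite /opderive; case: xgetP => [D' -> //|/(_ D)]. Qed.

Lemma opb_is_opderive P t D (b : R -> R) : bounded_linear D ->
  (\forall h \near (0 : R)^', 0 <= b h /\
     opb (b h) (fun x => (h^-1)%:C *: (P (t + h) x - P t x) - D x)) ->
  b h @[h --> (0 : R)^'] --> (0 : R) -> is_opderive P t D.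
Proof.
move=> bD hb b0; split => //.
have hq : \forall h \near (0 : R)^', (0 <= opnorm ((h^-1)%:C \*: (P (t + h) \- P t) \- D)%R <= (b h)%:E)%E.
  by apply: filterS hb => h [bh ob]; rewrite opnorm_ge0 /=; exact: opb_opnorm.
apply: (squeeze_cvge hq); first exact: cvg_cst.
by apply/fine_cvgP; split => //; exact: nearW.
Qed.

Lemma near_in (a b s : R) : s \in `]a, b[ -> \forall h \near (0 : R)^', s + h \in `]a, b[.
Proof.
rewrite in_itv /= => /andP[as_ sb].
pose d := Num.min (s - a) (b - s).
have d0 : 0 < d by rewrite lt_min !subr_gt0 as_.
have d1 : d <= s - a by rewrite ge_min lexx.
have d2 : d <= b - s by rewrite ge_min lexx orbT.
apply: cvg_within; apply: filterS (nbhsx_ballx (0 : R) d d0) => h.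
by rewrite -ball_normE /= sub0r normrN => /ltr_normlP[]; rewrite in_itv /=; lra.
Qed.

End OperatorDerivative.

(** * Existence of the quadratic flow *)

Section QuadraticFlow.
Context {R : realType} {H : hilbertType R}.
Variables (S : H -> H) (sigma : R).
Hypotheses (sS : SigmaP S) (sigma0 : 0 <= sigma) (hS : opb sigma S).

Let lS : linear S. Proof. by case: sS => [[[]]]. Qed.
Let symS : rsym S. Proof. by case: sS => [/SigmaE[]]. Qed.
Let posS x : 0 <= rip (S x) x. Proof. by have [_] := iffLR (SigmaPE S) sS; apply. Qed.

Section Existence.
Variables (X : H -> H) (K tau : R).
Hypotheses (sX : SigmaP X) (K0 : 0 <= K) (hX : opb K X) (tau0 : 0 < tau).
Hypothesis small : tau * (sigma * K) <= 2^-1.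

Let bX : bounded_linear X. Proof. by case: sX => [[]]. Qed.
Let lX : linear X. Proof. by case: bX. Qed.
Let symX : rsym X. Proof. by case: sX => [/SigmaE[]]. Qed.
Let posX x : 0 <= rip (X x) x. Proof. by have [_] := iffLR (SigmaPE X) sX; apply. Qed.

Let N (s : R) (w : H) := s%:C *: S (X w).
Let J (s : R) (x : H) := xget 0 [set w | w + N s w = x].
(** The flow is [X (1 + s S X)^-1]; [J s] is the inverse. *)
Let V (s : R) (x : H) := X (J s x).

Let lN s : linear (N s).
Proof. by move=> a x y; rewrite /N lX lS scalerDr !scalerA mulrC. Qed.

Let N_opb s : s \in `[0, tau] -> opb 2^-1 (N s).
Proof.
rewrite in_itv /= => /andP[s0 st] x; rewrite /N rnormZr ger0_norm //.
have h : rnorm (S (X x)) <= sigma * K * rnorm x.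
  by apply: le_trans (hS _) _; rewrite -mulrA ler_wpM2l.
apply: le_trans (ler_wpM2l s0 h) _; rewrite mulrA ler_wpM2r ?rnorm_ge0 //.
by apply: le_trans small; rewrite ler_wpM2r // mulr_ge0.
Qed.

Let JP s x : s \in `[0, tau] -> J s x + N s (J s x) = x.
Proof.
move=> hs; have [w hw] := halfcontraction_surj (@lN s) (N_opb hs) x.
by rewrite /J; case: xgetP => [z -> //|/(_ w)].
Qed.

(** [1 + N s] is injective since [N s] is a half contraction. *)
Let J_unique s w : s \in `[0, tau] -> J s (w + N s w) = w.
Proof.
move=> hs; apply/eqP; rewrite -subr_eq0; apply/eqP/rnorm_eq0.
set z := J s _ - w.
have hz : z = - N s z.
  have := JP (w + N s w) hs; rewrite /z (linB (@lN s)); set j := J s _ => e.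
  by apply/eqP; rewrite -addr_eq0 addrACA -opprD e subrr.
have := N_opb hs z; rewrite -(rnormN (N s z)) -hz => h.
by apply/eqP; rewrite eq_le rnorm_ge0 andbT; lra.
Qed.

Let J_linear s : s \in `[0, tau] -> linear (J s).
Proof.
move=> hs a x y.
rewrite -{1}(JP x hs) -{1}(JP y hs).
have -> : a *: (J s x + N s (J s x)) + (J s y + N s (J s y)) =
    (a *: J s x + J s y) + N s (a *: J s x + J s y).
  by rewrite (@lN s a) scalerDr addrACA.
exact: J_unique.
Qed.

Let J_opb s : s \in `[0, tau] -> opb 2 (J s).
Proof.
move=> hs x; have h := N_opb hs (J s x).
have := ler_rnormDB (J s x) (N s (J s x)); rewrite (JP x hs) => h2; lra.
Qed.

Let V_linear s : s \in `[0, tau] -> linear (V s).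
Proof. by move=> hs; apply: comp_linear => //; exact: J_linear. Qed.

Let V_opb s : s \in `[0, tau] -> opb (K * 2) (V s).
Proof. by move=> hs; apply: comp_opb => //; exact: J_opb. Qed.

Let V_sym s x y : s \in `[0, tau] -> rip (V s x) y = rip x (V s y).
Proof.
move=> hs; rewrite /V; set w := J s x; set u := J s y.
have ex : x = w + N s w by rewrite /w JP.
have ey : y = u + N s u by rewrite /u JP.
by rewrite ey ex /N ripDr ripDl ripZr ripZl symX symS.
Qed.

(** The resolvent identity, from which both the Lipschitz bound and the
derivative of the flow follow. *)
Let V_rip r s x y : r \in `[0, tau] -> s \in `[0, tau] ->
  rip (V r x) y - rip (V s x) y = (s - r) * rip (V s (S (V r x))) y.
Proof.
move=> hr hs; rewrite (V_sym x y hs) (V_sym (S _) y hs) /V.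
set u := J s y; set w := J r x.
have ex : x = w + N r w by rewrite /w JP.
have ey : y = u + N s u by rewrite /u JP.
rewrite [in rip (X w) y]ey {1}ex /N ripDr ripDl ripZr ripZl symX -symS; ring.
Qed.

Let V_sub r s x : r \in `[0, tau] -> s \in `[0, tau] ->
  V r x - V s x = (s - r)%:C *: V s (S (V r x)).
Proof. by move=> hr hs; apply: rip_ext => y; rewrite ripBl ripZl V_rip. Qed.

Let L := K * 2 * (sigma * (K * 2)).
Let L0 : 0 <= L. Proof. by rewrite !mulr_ge0. Qed.

Let VSV_opb r s : r \in `[0, tau] -> s \in `[0, tau] -> opb L (fun x => V s (S (V r x))).
Proof.
move=> hr hs; apply: (comp_opb (f := V s) (g := fun x => S (V r x))).
- by rewrite mulr_ge0.
- exact: V_opb.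
- by apply: comp_opb => //; exact: V_opb.
Qed.

Let V_dist r s x : r \in `[0, tau] -> s \in `[0, tau] ->
  rnorm (V r x - V s x) <= `|s - r| * (L * rnorm x).
Proof.
by move=> hr hs; rewrite V_sub // rnormZr ler_wpM2l //; exact: VSV_opb.
Qed.

Let V_SigmaP s : s \in `[0, tau] -> SigmaP (V s).
Proof.
move=> hs; apply/SigmaPE; split.
  apply/SigmaE; split; last by move=> x y; exact: V_sym.
  by split; [exact: V_linear | exists (K * 2); exact: V_opb].
move=> x; rewrite /V -{2}(JP x hs) ripDr ripZr ripC -ripC addr_ge0 //.
by rewrite mulr_ge0 //; [move: hs; rewrite in_itv /= => /andP[] | rewrite ripC].
Qed.

Let V_opderive s : s \in `]0, tau[ -> is_opderive V s (\- (V s \o S \o V s)).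
Proof.
move=> hs; have hs' : s \in `[0, tau] by exact: subset_itv_oo_cc.
have bVSV : bounded_linear (\- (V s \o S \o V s)).
  split; last by exists L => x; rewrite /= rnormN; exact: VSV_opb.
  move=> a x y /=.
  by rewrite (V_linear hs' a) lS (V_linear hs') opprD scalerN.
apply: (opb_is_opderive (b := fun h => `|h| * (K * 2 * (sigma * L)))) => //; last first.
  exact: cvg0Mr dnbhs0_norm.
apply: filterS2 (near_in hs) (@near0_neq R) => h hsh h0; split.
  by rewrite !mulr_ge0.
have hsh' : s + h \in `[0, tau] by exact: subset_itv_oo_cc.
move=> x; rewrite (V_sub x hsh' hs') opprD addrA subrr sub0r rmorphN scaleNr scalerN.
rewrite scalerA -rmorphM mulVf // scale1r /= opprK addrC -(linB (V_linear hs')) -(linB lS).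
have h1 := V_opb hs' (S (V s x - V (s + h) x)); have h2 := hS (V s x - V (s + h) x).
have h3 := V_dist x hs' hsh'; rewrite addrAC subrr add0r in h3.
have K20 : 0 <= K * 2 by rewrite mulr_ge0.
apply: (le_trans h1); apply: (le_trans (ler_wpM2l K20 h2)).
have -> : `|h| * (K * 2 * (sigma * L)) * rnorm x = K * 2 * (sigma * (`|h| * (L * rnorm x))) by ring.
by rewrite ler_wpM2l ?mulr_ge0 // ler_wpM2l.
Qed.

Lemma quadratic_flow_exists : exists W, is_solution (G_rhs S) tau X W.
Proof.
exists V; split.
- split; first by move=> t ht; case: (V_SigmaP ht).
  move=> x; apply: within_vcont => s hs.
  have cv : `|s - t| * (L * rnorm x) @[t --> within `[0, tau] (nbhs s)] --> (0 : R).
    apply: cvg0Mr; rewrite -(normr0 R); apply: cvg_norm; rewrite -(subrr s).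
    by apply: cvgB; [exact: cvg_cst | exact: cvg_within].
  apply: (vcvg_dominated _ cv); rewrite near_withinE; apply: nearW => t ht.
  exact: V_dist.
- apply/funext => x; have h0 : 0 \in `[0, tau] by rewrite in_itv /= lexx ltW.
  have := JP x h0; rewrite /V /N scale0r addr0 => ->. by [].
- move=> t ht; have ht' : t \in `[0, tau] by exact: subset_itv_oo_cc.
  split; first by eexists; exact: V_opderive.
    exact: V_SigmaP.
  apply: opderive_eq (V_opderive ht); last exact: V_linear.
  by apply: filterS (near_in ht) => h hh; apply: V_linear; exact: subset_itv_oo_cc.
Qed.

(** The bounds of the next part hold for every solution, hence for the one
chosen in [exp_G]. *)
Lemma exp_G_solution : exists2 W, is_solution (G_rhs S) tau X W & exp_G S tau X = W tau.
Proof.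
have [W hW] := quadratic_flow_exists.
rewrite /exp_G; case: xgetP => [Z -> [W' hW' e]|/(_ (W tau))]; first by exists W'.
by move=> h; exfalso; apply: h; exists W.
Qed.

End Existence.
End QuadraticFlow.

(** * Bounds along the quadratic flow *)

Lemma sub_itv0 {R : realType} (tau s r : R) : s \in `[0, tau] -> r \in `]0, s[ ->
  r \in `]0, tau[.
Proof. by rewrite !in_itv /=; lra. Qed.

Section QuadraticFlowBounds.
Context {R : realType} {H : hilbertType R}.
Variables (S : H -> H) (sigma K tau : R).
Hypotheses (sS : SigmaP S) (sigma0 : 0 <= sigma) (hS : opb sigma S).
Hypotheses (K0 : 0 <= K) (tau0 : 0 < tau).

Let lS : linear S. Proof. by case: sS => [[[]]]. Qed.
Let symS : rsym S. Proof. by case: sS => [/SigmaE[]]. Qed.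

Section OneSolution.
Variables (X : H -> H) (W : R -> H -> H).
Hypotheses (hX : opb K X) (hW : is_solution (G_rhs S) tau X W).

Lemma G_sol_Sigma s : s \in `[0, tau] -> Sigma (W s).
Proof. by case: hW => [[h _] _ _]; exact: h. Qed.

Lemma G_sol_linear s : s \in `[0, tau] -> linear (W s).
Proof. by move=> /G_sol_Sigma[[]]. Qed.

Lemma G_sol_sym s : s \in `[0, tau] -> rsym (W s).
Proof. by move=> /G_sol_Sigma/SigmaE[]. Qed.

Lemma G_sol_cont x : vcont (fun s => W s x) 0 tau.
Proof. by case: hW => [[_ h] _ _]; exact: vcont_within. Qed.

(** Symmetry moves [W s] from the left of [- W S W] to the test vector. *)
Lemma G_sol_rderiv x y s : s \in `]0, tau[ ->
  rderiv (fun s => rip (W s x) y) s (- rip (S (W s x)) (W s y)).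
Proof.
move=> hs; have hs' : s \in `[0, tau] by exact: subset_itv_oo_cc.
case: hW => [_ _ /(_ s hs)[ex _ hG]].
have hD := opderiveP ex; rewrite hG in hD.
have hd : opderiv W s (\- (W s \o S \o W s)).
  apply: is_opderive_opderiv hD; last exact: G_sol_linear.
  by apply: filterS (near_in hs) => h hh; apply: G_sol_linear; exact: subset_itv_oo_cc.
have := rderiv_rip (@opderiv_app _ _ _ _ _ _ x hD.1 hd) (vderiv_cst y s).
by rewrite rip0r addr0 /= ripNl (G_sol_sym hs').
Qed.

Lemma G_sol_rcont x y s : s \in `[0, tau] ->
  {within `[0, s], continuous (fun s => rip (W s x) y)}.
Proof.
rewrite in_itv /= => /andP[s0 st]; apply: rcont_rip; last exact: vcont_cst.
exact: (vcont_sub (lexx 0) st (@G_sol_cont x)).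
Qed.

Lemma G_sol0 : W 0 = X. Proof. by case: hW. Qed.

Lemma G_sol_SigmaP s : s \in `[0, tau] -> SigmaP (W s).
Proof.
move=> hs; apply/SigmaPE; split=> [|x]; first exact: G_sol_Sigma.
have ht : tau \in `[0, tau] by rewrite in_itv /= lexx ltW.
apply: (within_ge0 tau0 (@G_sol_rcont x x _ ht) _ hs) => r hr.
case: hW => [_ _ /(_ r hr)[_ sW _]].
by have [_] := iffLR (SigmaPE _) sW; apply.
Qed.

(** The derivative of the left-hand side is [- rip (S (W s x)) (W s x)]. *)
Lemma G_sol_le s x : s \in `[0, tau] -> rip (W s x) x <= rip (X x) x.
Proof.
move=> hs; have s0 : 0 <= s by move: hs; rewrite in_itv /= => /andP[].
suff : rip (W s x) x - rip (W 0 x) x <= 0 - 0 by rewrite G_sol0 subr0 subr_le0.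
apply: (mean_value_le (g := fun r => rip (W r x) x) (k := fun=> 0) (dk := fun=> 0) s0
  (fun r hr => @G_sol_rderiv x x _ (sub_itv0 hs hr)) _ (@G_sol_rcont x x _ hs)).
- by move=> r _; have := @rderiv_linear _ 0 r; congr (rderiv _ _ _); apply/funext => ?; rewrite mul0r.
- by apply: continuous_subspaceT => r; exact: cvg_cst.
- move=> r _; rewrite oppr_le0.
  by have [_] := iffLR (SigmaPE _) sS; apply.
Qed.

Lemma G_sol_opb s : s \in `[0, tau] -> opb K (W s).
Proof.
move=> hs; have [_ pW] := iffLR (SigmaPE _) (G_sol_SigmaP hs).
apply: quadratic_opb => //; [exact: G_sol_linear|exact: G_sol_sym|move=> x].
rewrite ger0_norm // (le_trans (G_sol_le x hs)) // (le_trans (rip_le _ _)) //.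
by rewrite expr2 mulrA ler_wpM2r ?rnorm_ge0.
Qed.

Lemma G_sol_dist s x : s \in `[0, tau] ->
  rnorm (W s x - X x) <= s * (sigma * K ^+ 2) * rnorm x.
Proof.
move=> hs; have s0 : 0 <= s by move: hs; rewrite in_itv /= => /andP[].
apply: rnorm_le_dual => [|y].
  by rewrite !mulr_ge0 ?exprn_ge0 ?rnorm_ge0.
rewrite -G_sol0 ripBl.
have -> : s * (sigma * K ^+ 2) * rnorm x * rnorm y =
  sigma * (K * rnorm x) * (K * rnorm y) * (s - 0) by ring.
apply: le_trans (ler_norm _) _.
apply: (mean_value_cst (g := fun r => rip (W r x) y) s0 (fun r hr => @G_sol_rderiv x y _ (sub_itv0 hs hr)) (@G_sol_rcont x y _ hs)).
move=> r hr; have hr' : r \in `[0, tau] by apply: subset_itv_oo_cc; exact: sub_itv0 hs hr.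
rewrite normrN (le_trans (abs_rip_le _ _)) // ler_pM ?rnorm_ge0 ?G_sol_opb //.
by rewrite (le_trans (hS _)) // ler_wpM2l // G_sol_opb.
Qed.

End OneSolution.

(** Both increments have quadratic derivatives, whose difference is bounded by
a multiple of [|W1 - W2|], that is, of [d] plus the difference of the
increments. Over a short time the latter part is absorbed. *)
Lemma G_sol_increment_lip (X1 X2 : H -> H) (W1 W2 : R -> H -> H) d :
  opb K X1 -> opb K X2 ->
  is_solution (G_rhs S) tau X1 W1 -> is_solution (G_rhs S) tau X2 W2 ->
  0 <= d -> opb d (fun x => X1 x - X2 x) -> tau * (4 * sigma * K) <= 1 ->
  forall s x y, s \in `[0, tau] ->
  rip ((W1 s x - W2 s x) - (X1 x - X2 x)) y <= 2 * (2 * sigma * K * tau * d) * (rnorm x * rnorm y).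
Proof.
move=> hX1 hX2 hW1 hW2 d0 hd small s x y hs.
pose v (i : R * (H * H)) := rip ((W1 i.1 i.2.1 - W2 i.1 i.2.1) - (X1 i.2.1 - X2 i.2.1)) i.2.2.
pose w (i : R * (H * H)) := rnorm i.2.1 * rnorm i.2.2.
apply: (@absorb R _ (fun i => i.1 \in `[0, tau]) v w (2 * sigma * K * tau * d) (2 * K + d) _ _ _ _ _ (s, (x, y)) hs).
- by rewrite !mulr_ge0 // ltW.
- by rewrite addr_ge0 // mulr_ge0.
- by move=> i _; rewrite mulr_ge0 ?rnorm_ge0.
- move=> [r [a b]] /= hr; rewrite /v /w /= mulrA.
  apply: le_trans (rip_le _ _) _; rewrite ler_wpM2r ?rnorm_ge0 //.
  apply: le_trans (ler_rnormB _ _) _; rewrite mulrDl; apply: lerD; last exact: hd.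
  apply: le_trans (ler_rnormB _ _) _; rewrite mulr2n mulrDl mulrDl !mul1r.
  by apply: lerD; [exact: (G_sol_opb hX1 hW1 hr)|exact: (G_sol_opb hX2 hW2 hr)].
move=> m m0 hm [r [a b]] /= hr; rewrite /v /w /=.
have r0 : 0 <= r by move: hr; rewrite in_itv /= => /andP[].
have rt : r <= tau by move: hr; rewrite in_itv /= => /andP[].
have hdm q z : q \in `[0, tau] -> rnorm (W1 q z - W2 q z) <= (d + m) * rnorm z.
  move=> hq; rewrite -(subrK (X1 z - X2 z) (W1 q z - W2 q z)) addrC.
  apply: le_trans (ler_rnormD _ _) _; rewrite mulrDl; apply: lerD; first exact: hd.
  apply: rnorm_le_dual => [|z']; first by rewrite mulr_ge0 ?rnorm_ge0.
  by have := hm (q, (z, z')) hq; rewrite /v /w /= mulrA.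
have -> : rip (W1 r a - W2 r a - (X1 a - X2 a)) b =
    (rip (W1 r a) b - rip (W2 r a) b) - (rip (W1 0 a) b - rip (W2 0 a) b).
  by rewrite (G_sol0 hW1) (G_sol0 hW2) !ripBl.
have bound : (rip (W1 r a) b - rip (W2 r a) b) - (rip (W1 0 a) b - rip (W2 0 a) b) <=
    2 * (sigma * ((d + m) * rnorm a) * (K * rnorm b)) * (r - 0).
  apply: le_trans (ler_norm _) _.
  apply: (mean_value_cst (g := fun t => rip (W1 t a) b - rip (W2 t a) b)
    (dg := fun t => - rip (S (W1 t a)) (W1 t b) - - rip (S (W2 t a)) (W2 t b)) r0).
  - move=> t ht; have ht' := sub_itv0 hr ht.
    by apply: rderivB; [exact: (G_sol_rderiv hW1)|exact: (G_sol_rderiv hW2)].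
  - by move=> t; exact: (continuousB (G_sol_rcont (x := a) (y := b) hW1 hr (x0 := t)) (G_sol_rcont (x := a) (y := b) hW2 hr (x0 := t))).
  - move=> t ht; have ht' : t \in `[0, tau] by apply: subset_itv_oo_cc; exact: sub_itv0 hr ht.
    have o1 := G_sol_opb hX1 hW1 ht'; have o2 := G_sol_opb hX2 hW2 ht'.
    have -> : - rip (S (W1 t a)) (W1 t b) - - rip (S (W2 t a)) (W2 t b) =
       - (rip (S (W1 t a - W2 t a)) (W1 t b) + rip (W1 t b - W2 t b) (S (W2 t a))).
      by rewrite (linB lS) !ripBl (ripC (W1 t b) (S _)) (ripC (W2 t b) (S _)); ring.
    rewrite normrN; apply: le_trans (ler_normD _ _) _; rewrite mulr2n mulrDl !mul1r.
    apply: lerD.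
      apply: le_trans (abs_rip_le _ _) _; rewrite ler_pM ?rnorm_ge0 //.
      by apply: le_trans (hS _) _; rewrite ler_wpM2l // hdm.
    apply: le_trans (abs_rip_le _ _) _.
    have -> : sigma * ((d + m) * rnorm a) * (K * rnorm b) =
       ((d + m) * rnorm b) * (sigma * (K * rnorm a)) by ring.
    rewrite ler_pM ?rnorm_ge0 ?hdm //.
    by apply: le_trans (hS _) _; rewrite ler_wpM2l.
apply: (le_trans bound); rewrite subr0.
have -> : 2 * (sigma * ((d + m) * rnorm a) * (K * rnorm b)) * r =
  (2 * sigma * K * r * d + r * (4 * sigma * K) * (m / 2)) * (rnorm a * rnorm b) by field.
rewrite ler_wpM2r ?mulr_ge0 ?rnorm_ge0 //; apply: lerD.
  by rewrite ler_wpM2r // ler_wpM2l // !mulr_ge0.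
rewrite -[leRHS]mul1r ler_wpM2r ?divr_ge0 //.
by apply: le_trans small; rewrite ler_wpM2r // !mulr_ge0.
Qed.

End QuadraticFlowBounds.

(** * The Riccati solution *)

Section RiccatiSolution.
Context {R : realType} {H : hilbertType R}.
Context {DA : set H} {A : H -> H} {e : R -> H -> H} {T C : R}.
Variables (Q S P0 : H -> H) (P : R -> H -> H) (kappa sigma : R).
Hypothesis sg : parabolic DA A e T C.
Hypotheses (T0 : 0 < T).
Hypothesis hP : is_solution (riccati_rhs DA A Q S) T P0 P.

Let C0 : 0 <= C. Proof. exact: le_trans ler01 (sg_C1 sg). Qed.

Lemma ric_Sigma t : t \in `[0, T] -> Sigma (P t).
Proof. by case: hP => [[h _] _ _]; exact: h. Qed.

Lemma ric_bounded t : t \in `[0, T] -> bounded_linear (P t).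
Proof. by move=> /ric_Sigma[]. Qed.

Lemma ric_linear t : t \in `[0, T] -> linear (P t).
Proof. by move=> /ric_bounded[]. Qed.

Lemma ric_sym t : t \in `[0, T] -> rsym (P t).
Proof. by move=> /ric_Sigma/SigmaE[]. Qed.

Lemma ric_cont x : vcont (fun s => P s x) 0 T.
Proof. by case: hP => [[_ h] _ _]; exact: vcont_within. Qed.

Lemma ric0 : P 0 = P0.
Proof. by case: hP. Qed.

Lemma ric_SigmaP t : t \in `[0, T] -> SigmaP (P t).
Proof.
move=> ht; apply/SigmaPE; split=> [|x]; first exact: ric_Sigma.
apply: (within_ge0 T0 (rcont_rip (@ric_cont x) (@vcont_cst _ _ x 0 T)) _ ht) => r hr.
case: hP => [_ _ /(_ r hr)[_ sW _]].
by have [_] := iffLR (SigmaPE _) sW; apply.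
Qed.

Lemma ric_opderive t : t \in `]0, T[ -> bounded_linear (opderive P t) /\ opderiv P t (opderive P t).
Proof.
move=> ht; case: hP => [_ _ /(_ t ht)[ex _ _]].
have hD := opderiveP ex; split; first by case: hD.
apply: is_opderive_opderiv hD; last by apply: ric_linear; exact: subset_itv_oo_cc.
by apply: filterS (near_in ht) => h hh; apply: ric_linear; exact: subset_itv_oo_cc.
Qed.

Lemma ric_eq t a b : t \in `]0, T[ -> DA a -> DA b ->
  rip (opderive P t a) b = rip (P t a) (A b) + rip (A a) (P t b) + rip (Q a) b
    - rip (S (P t a)) (P t b).
Proof.
move=> ht da db; have ht' : t \in `[0, T] by exact: subset_itv_oo_cc.
case: hP => [_ _ /(_ t ht)[_ _ [Z [_ _ hZ] ->]]] /=.
rewrite !(ripDl, ripNl) (ric_sym ht' (S _)).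
by rewrite {1}/rip (hZ a b da db) /phiA ReD.
Qed.

(** Along backward orbits the terms with [A] coming from the equation and from
the orbits cancel, which leaves only bounded operators. *)
Lemma ric_evol c r s x y : c + s \in `]0, T[ -> 0 < r - s ->
  rderiv (fun s => rip (P (c + s) (e (r - s) x)) (e (r - s) y)) s
    (rip (Q (e (r - s) x)) (e (r - s) y) -
     rip (S (P (c + s) (e (r - s) x))) (P (c + s) (e (r - s) y))).
Proof.
move=> ht rs; have ht' : c + s \in `[0, T] by exact: subset_itv_oo_cc.
have [bD hD] := ric_opderive ht.
have ax := vderiv_rev (sg_deriv sg x rs); have ay := vderiv_rev (sg_deriv sg y rs).
set a := e (r - s) x; set b := e (r - s) y.
suff -> : rip (Q a) b - rip (S (P (c + s) a)) (P (c + s) b) =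
    rip (opderive P (c + s) a + P (c + s) (- A a)) b + rip (P (c + s) a) (- A b).
  exact: rderiv_rip (opderiv_vderiv bD (ric_bounded ht') (opderiv_shift hD) ax) ay.
rewrite ripDl (ric_eq ht (sg_dom sg x rs) (sg_dom sg y rs)) ripNr.
by rewrite (linN (ric_linear ht')) ripNl (ric_sym ht' (A _)); ring.
Qed.

Lemma ric_evol_cont M c r s : (forall t, t \in `[0, T] -> opb M (P t)) ->
  0 <= c -> c + s <= T -> s <= r -> r <= T -> forall x y,
  {within `[0, s], continuous (fun s => rip (P (c + s) (e (r - s) x)) (e (r - s) y))}.
Proof.
move=> hM c0 cs sr rT x y.
have erev z : vcont (fun s => e (r - s) z) 0 s.
  by apply: (vcont_rev _ _ (sg_cont sg z)); lra.
apply: rcont_rip => //.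
apply: (vcont_app (M := M) (P := fun s => P (c + s))) => // [t|z].
  rewrite in_itv /= => ht; have ht' : c + t \in `[0, T] by rewrite in_itv /=; lra.
  by split; [exact: ric_linear|exact: hM].
by apply: (vcont_shift (c := c) _ _ (@ric_cont z)); lra.
Qed.

(** Strong continuity on a compact interval gives pointwise bounds. *)
Lemma ric_uniform_bound : exists2 M, 0 <= M & forall t, t \in `[0, T] -> opb M (P t).
Proof.
apply: (uniform_boundedness (D := [set t | t \in `[0, T]]) (T := P)).
  by move=> t ht; exact: ric_bounded.
move=> x.
have nc : {within `[0, T], continuous (fun t => rnorm (P t x))}.
  apply: rcontP => s hs; apply: (cvg_dominated _ (ric_cont x hs)).
  apply: nearW => t; rewrite ler_norml.
  have h1 := ler_rnorm_distD (P t x) (P s x) 0; have h2 := ler_rnorm_distD (P s x) (P t x) 0.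
  rewrite !subr0 in h1 h2; rewrite (rnormBC (P s x) (P t x)) in h1.
  by apply/andP; split; lra.
have [c _ hc] := EVT_max (ltW T0) nc.
by exists (rnorm (P c x)) => t ht; exact: hc.
Qed.

Lemma norm_inf_fin : exists2 M, 0 <= M & norm_inf T P = M%:E.
Proof.
have [M M0 hM] := ric_uniform_bound.
have : (norm_inf T P <= M%:E)%E.
  apply: ge_ereal_sup => _ [t ht <-]; apply: opb_opnorm => //; apply: hM.
  exact: subset_itv_oo_cc.
have : (0 <= norm_inf T P)%E.
  have hT : (T / 2) \in `]0, T[ by have t0 := T0; rewrite in_itv /=; lra.
  apply: le_trans (opnorm_ge0 (P (T / 2))) _; apply: ereal_sup_ubound; exists (T / 2) => //.
by case: (norm_inf T P) => // r r0 _; exists r; rewrite -?lee_fin.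
Qed.

(** The supremum runs over interior times; strong continuity covers the
endpoints. *)
Lemma norm_inf_opb M : 0 <= M -> norm_inf T P = M%:E ->
  forall t, t \in `[0, T] -> opb M (P t).
Proof.
move=> M0 hM t ht x; apply: rnorm_le_dual => [|y]; first by rewrite mulr_ge0 ?rnorm_ge0.
rewrite -subr_ge0.
apply: (within_ge0 (g := fun t => M * rnorm x * rnorm y - rip (P t x) y) T0 _ _ ht).
  have hc := rcont_rip (@ric_cont x) (@vcont_cst _ _ y 0 T).
  move=> z; apply: (continuousB _ (hc z)).
  exact: cvg_cst.
move=> r hr; rewrite subr_ge0; apply: le_trans (rip_le _ _) _.
rewrite ler_wpM2r ?rnorm_ge0 //.
have hr' : r \in `[0, T] by exact: subset_itv_oo_cc.
apply: (opnorm_opb (ric_linear hr')); rewrite -hM; apply: ereal_sup_ubound.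
by exists r.
Qed.

End RiccatiSolution.

(** * Lipschitz continuity of the Riccati solution *)

Section RiccatiLipschitz.
Context {R : realType} {H : hilbertType R}.
Context {DA : set H} {A : H -> H} {e : R -> H -> H} {T C : R}.
Variables (Q S P0 : H -> H) (P : R -> H -> H) (kappa sigma M : R).
Hypothesis sg : parabolic DA A e T C.
Hypotheses (T0 : 0 < T) (sQ : SigmaP Q) (sS : SigmaP S).
Hypotheses (kappa0 : 0 <= kappa) (hQ : opb kappa Q).
Hypotheses (sigma0 : 0 <= sigma) (hS : opb sigma S).
Hypothesis hP : is_solution (riccati_rhs DA A Q S) T P0 P.
Hypotheses (M0 : 0 <= M) (hM : forall t, t \in `[0, T] -> opb M (P t)).

Let C0 : 0 <= C. Proof. exact: le_trans ler01 (sg_C1 sg). Qed.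
Let lS : linear S. Proof. by case: sS => [[[]]]. Qed.

(** The derivative of the left-hand side in [h] is the form of [calA_dom] at two
points of the orbits, so it is bounded. *)
Lemma initial_orbit_lip : calA_dom DA A P0 ->
  exists2 c, 0 <= c & forall h x y, 0 <= h <= T ->
    `|rip (P0 (e h x)) (e h y) - rip (P0 x) y| <= c * (rnorm x * rnorm y) * h.
Proof.
move=> [/SigmaE[bP0 symP0] [c hc]].
exists (`|c| * C ^+ 2); first by rewrite mulr_ge0 ?exprn_ge0.
move=> h x y /andP[h0 hT].
pose g s := rip (P0 (e s x)) (e s y).
have e0 z : e 0 z = z by rewrite (sg0 sg).
have -> : rip (P0 (e h x)) (e h y) - rip (P0 x) y = g h - g 0 by rewrite /g !e0.
rewrite -[X in _ * X]subr0.
apply: (mean_value_cst (dg := fun s => rip (P0 (A (e s x))) (e s y) + rip (P0 (e s x)) (A (e s y))) h0).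
- move=> s; rewrite in_itv /= => /andP[s0 _].
  exact: rderiv_rip (linear_vderiv bP0 (sg_deriv sg x s0)) (sg_deriv sg y s0).
- have ec z : vcont (fun s => e s z) 0 h by exact: vcont_sub (lexx 0) hT (sg_cont sg z).
  apply: rcont_rip => // s hs; apply: linear_vcvg => //; exact: ec.
- move=> s; rewrite in_itv /= => /andP[s0 sh].
  have st : 0 <= s <= T by rewrite ltW //= (le_trans (ltW sh)).
  rewrite symP0 addrC.
  have h1 := hc _ _ (sg_dom sg x s0) (sg_dom sg y s0).
  have h2 : `|rip (P0 (e s x)) (A (e s y)) + rip (A (e s x)) (P0 (e s y))| <= c * rnorm (e s x) * rnorm (e s y).
    rewrite -lecR; apply: le_trans h1; rewrite /phiA /rip -ReD; exact: normc_ge_Re.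
  apply: (le_trans h2).
  have -> : `|c| * C ^+ 2 * (rnorm x * rnorm y) = (`|c| * (C * rnorm x)) * (C * rnorm y) by ring.
  apply: le_trans (_ : _ <= `|c| * rnorm (e s x) * rnorm (e s y)) _.
    by rewrite ler_wpM2r ?rnorm_ge0 // ler_wpM2r ?rnorm_ge0 // ler_norm.
  apply: ler_pM; rewrite ?mulr_ge0 ?rnorm_ge0 ?(sg_opb sg st) //.
  by rewrite ler_wpM2l // (sg_opb sg st).
Qed.

(** Compare [P h] with [e^{hA^*} P0 e^{hA}] by [ric_evol], and the latter with
[P0] by [initial_orbit_lip]. *)
Lemma first_increment_lip : calA_dom DA A P0 ->
  exists2 c, 0 <= c & forall h x y, 0 <= h <= T ->
    rip (P h x - P 0 x) y <= c * h * (rnorm x * rnorm y).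
Proof.
move=> dP0; have [c c0 hc] := initial_orbit_lip dP0.
exists (c + (kappa + sigma * M ^+ 2) * C ^+ 2) => [|h x y hh].
  by rewrite addr_ge0 // mulr_ge0 ?exprn_ge0 // addr_ge0 // mulr_ge0 // exprn_ge0.
have := hc h x y hh; have /andP[h0 hT] := hh.
have e0 z : e 0 z = z by rewrite (sg0 sg).
pose g s := rip (P (0 + s) (e (h - s) x)) (e (h - s) y).
have gh : g h = rip (P h x) y by rewrite /g add0r subrr !e0.
have g0 : g 0 = rip (P0 (e h x)) (e h y) by rewrite /g addr0 subr0 (ric0 hP).
have : `|g h - g 0| <= (kappa + sigma * M ^+ 2) * C ^+ 2 * (rnorm x * rnorm y) * (h - 0).
  apply: (mean_value_cst h0).
  - move=> s; rewrite in_itv /= => hs; apply: (ric_evol sg hP); last by lra.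
    by rewrite in_itv /=; lra.
  - by apply: (ric_evol_cont sg hP hM); lra.
  move=> s; rewrite in_itv /= => /andP[s0 sh].
  have st : 0 <= h - s <= T by lra.
  have ss : 0 + s \in `[0, T] by rewrite in_itv /=; lra.
  set a := e (h - s) x; set b := e (h - s) y.
  have ha : rnorm a <= C * rnorm x by exact: (sg_opb sg st).
  have hb : rnorm b <= C * rnorm y by exact: (sg_opb sg st).
  apply: le_trans (ler_normB _ _) _.
  have -> : (kappa + sigma * M ^+ 2) * C ^+ 2 * (rnorm x * rnorm y) =
    (kappa * (C * rnorm x)) * (C * rnorm y) + (sigma * (M * (C * rnorm x))) * (M * (C * rnorm y)) by ring.
  apply: lerD; apply: le_trans (abs_rip_le _ _) _; apply: ler_pM; rewrite ?rnorm_ge0 //.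
  - by apply: le_trans (hQ _) _; rewrite ler_wpM2l.
  - apply: le_trans (hS _) _; rewrite ler_wpM2l //; apply: le_trans (hM ss _) _.
    by rewrite ler_wpM2l.
  - by apply: le_trans (hM ss _) _; rewrite ler_wpM2l.
rewrite gh g0 (ric0 hP) ripBl subr0 !ler_norml => /andP[_ h1] /andP[_ h2]; lra.
Qed.

(** The increment of [P] over a time shift [h] satisfies a linear integral
inequality with initial value of order [h]. With the weight [expR (l r)] and [l]
large, the integral term takes at most half of the bound and is absorbed. *)
Lemma increment_lip c : 0 <= c ->
  (forall h x y, 0 <= h <= T -> rip (P h x - P 0 x) y <= c * h * (rnorm x * rnorm y)) ->
  exists2 L, 0 <= L & forall s t x, 0 <= s -> s <= t -> t <= T ->
    rnorm (P t x - P s x) <= L * (t - s) * rnorm x.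
Proof.
move=> c0 hc.
have C20 : 0 <= C ^+ 2 by rewrite exprn_ge0.
(* twice the Lipschitz constant 2 sigma M C^2 of the integral term, plus 1 to
   be positive *)
pose l := 4 * sigma * M * C ^+ 2 + 1.
have l0 : 0 < l by rewrite ltr_wpDl // !mulr_ge0.
have lne : l != 0 by rewrite gt_eqF.
pose L := 2 * (c * C ^+ 2) * expR (l * T).
have L0 : 0 <= L by rewrite !mulr_ge0 ?expR_ge0.
exists L => // s t x s0 st tT; pose h := t - s.
have h0 : 0 <= h by rewrite subr_ge0.
apply: rnorm_le_dual => [|y]; first by rewrite !mulr_ge0 ?rnorm_ge0.
pose v (i : R * (H * H)) := rip (P (h + i.1) i.2.1 - P i.1 i.2.1) i.2.2.
pose w (i : R * (H * H)) := expR (l * i.1) * (rnorm i.2.1 * rnorm i.2.2).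
pose D (i : R * (H * H)) := 0 <= i.1 /\ h + i.1 <= T.
have w0 i : D i -> 0 <= w i by move=> _; rewrite !mulr_ge0 ?expR_ge0 ?rnorm_ge0.
have hmax i : D i -> v i <= 2 * M * w i.
  case: i => r [a b] [/= r0 rT]; rewrite /v /w /=.
  have r1 : r \in `[0, T] by rewrite in_itv /=; lra.
  have r2 : h + r \in `[0, T] by rewrite in_itv /=; lra.
  apply: le_trans (rip_le _ _) _.
  have h1 : rnorm (P (h + r) a - P r a) <= 2 * M * rnorm a.
    have := ler_rnormB (P (h + r) a) (P r a); have := hM r1 a; have := hM r2 a; lra.
  apply: le_trans (ler_wpM2r (rnorm_ge0 b) h1) _.
  rewrite -(mulrA (2 * M) (rnorm a)) ler_wpM2l ?mulr_ge0 // -[leLHS]mul1r ler_wpM2r ?mulr_ge0 ?rnorm_ge0 //.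
  by rewrite -expR0 ler_expR mulr_ge0 // ltW.
have step m : 0 <= m -> (forall i, D i -> v i <= m * w i) ->
    forall i, D i -> v i <= (c * C ^+ 2 * h + m / 2) * w i.
  move=> m0 hm [r [a b]] [/= r0 rT]; rewrite /v /w /=.
  pose g q := rip (P (h + q) (e (r - q) a)) (e (r - q) b).
  pose f q := rip (P (0 + q) (e (r - q) a)) (e (r - q) b).
  pose k q := 2 * sigma * M * C ^+ 2 * m * (rnorm a * rnorm b) / l * expR (l * q).
  have e0 z : e 0 z = z by rewrite (sg0 sg).
  have rT' : r <= T by lra.
  have hC z q : 0 <= q -> q <= r -> rnorm (e (r - q) z) <= C * rnorm z.
    by move=> q0 qr; apply: (sg_opb sg); lra.
  have dk q : rderiv k q (2 * sigma * M * C ^+ 2 * m * expR (l * q) * (rnorm a * rnorm b)).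
    have := rderivZ (c := 2 * sigma * M * C ^+ 2 * m * (rnorm a * rnorm b) / l) (@rderiv_expR _ l q).
    by congr rderiv; field.
  have key : (g r - f r) - (g 0 - f 0) <= k r - k 0.
    apply: (mean_value_le (g := fun q => g q - f q) (k := k) r0 _ (fun q _ => dk q)).
    - move=> q; rewrite in_itv /= => hq; apply: rderivB; apply: (ric_evol sg hP);
        try lra; by rewrite in_itv /=; lra.
    - have gc : {within `[0, r], continuous g} by apply: (ric_evol_cont sg hP hM); lra.
      have fc : {within `[0, r], continuous f} by apply: (ric_evol_cont sg hP hM); lra.
      by move=> q; exact: continuousB (gc q) (fc q).
    - by apply: continuous_subspaceT => q; exact: rderiv_continuous (dk q).
    move=> q; rewrite in_itv /= => /andP[q0 qr]; rewrite add0r.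
    set a' := e (r - q) a; set b' := e (r - q) b.
    have ha : rnorm a' <= C * rnorm a by apply: hC; exact: ltW.
    have hb : rnorm b' <= C * rnorm b by apply: hC; exact: ltW.
    have q1 : q \in `[0, T] by rewrite in_itv /=; lra.
    have q2 : h + q \in `[0, T] by rewrite in_itv /=; lra.
    pose d z := P (h + q) z - P q z.
    have hd z : rnorm (d z) <= m * expR (l * q) * rnorm z.
      apply: rnorm_le_dual => [|z']; first by rewrite !mulr_ge0 ?expR_ge0 ?rnorm_ge0.
      have Dq : D (q, (z, z')) by split => /=; lra.
      by have := hm _ Dq; rewrite /v /w /= !mulrA.
    have -> : rip (Q a') b' - rip (S (P (h + q) a')) (P (h + q) b') -
        (rip (Q a') b' - rip (S (P q a')) (P q b')) =
        - (rip (S (d a')) (P (h + q) b') + rip (d b') (S (P q a'))).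
      by rewrite /d (linB lS) !ripBl (ripC (P (h + q) b')) (ripC (P q b')); ring.
    apply: le_trans (ler_norm _) _; rewrite normrN; apply: le_trans (ler_normD _ _) _.
    have -> : 2 * sigma * M * C ^+ 2 * m * expR (l * q) * (rnorm a * rnorm b) =
      sigma * (m * expR (l * q) * (C * rnorm a)) * (M * (C * rnorm b)) +
      m * expR (l * q) * (C * rnorm b) * (sigma * (M * (C * rnorm a))) by ring.
    have mE : 0 <= m * expR (l * q) by rewrite mulr_ge0 ?expR_ge0.
    apply: lerD; apply: le_trans (abs_rip_le _ _) _; apply: ler_pM; rewrite ?rnorm_ge0 //.
    - apply: le_trans (hS _) _; rewrite ler_wpM2l //; apply: le_trans (hd _) _.
      by rewrite ler_wpM2l.
    - by apply: le_trans (hM q2 _) _; rewrite ler_wpM2l.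
    - by apply: le_trans (hd _) _; rewrite ler_wpM2l.
    - apply: le_trans (hS _) _; rewrite ler_wpM2l //; apply: le_trans (hM q1 _) _.
      by rewrite ler_wpM2l.
  have E1 : 1 <= expR (l * r) by rewrite -expR0 ler_expR mulr_ge0 // ltW.
  have ab0 : 0 <= rnorm a * rnorm b by rewrite mulr_ge0 ?rnorm_ge0.
  have -> : rip (P (h + r) a - P r a) b = g r - f r.
    by rewrite /g /f subrr !e0 add0r ripBl.
  have g0 : g 0 - f 0 <= c * C ^+ 2 * h * (expR (l * r) * (rnorm a * rnorm b)).
    have -> : g 0 - f 0 = rip (P h (e r a) - P 0 (e r a)) (e r b).
      by rewrite /g /f subr0 !addr0 ripBl.
    have hT : 0 <= h <= T by lra.
    have hrT : 0 <= r <= T by lra.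
    apply: le_trans (hc h (e r a) (e r b) hT) _.
    have -> : c * C ^+ 2 * h * (expR (l * r) * (rnorm a * rnorm b)) =
      c * h * ((C * rnorm a) * (C * rnorm b) * expR (l * r)) by ring.
    rewrite ler_wpM2l ?mulr_ge0 //.
    have hh : rnorm (e r a) * rnorm (e r b) <= (C * rnorm a) * (C * rnorm b).
      by apply: ler_pM; rewrite ?rnorm_ge0 ?(sg_opb sg hrT).
    apply: (le_trans hh); rewrite -[leLHS]mulr1 ler_wpM2l //.
    by rewrite !mulr_ge0 ?rnorm_ge0.
  have k0 : 0 <= k 0 by rewrite /k !mulr_ge0 ?expR_ge0 ?exprn_ge0 ?rnorm_ge0 ?invr_ge0 // ltW.
  have kr : k r <= m / 2 * (expR (l * r) * (rnorm a * rnorm b)).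
    have -> : k r = (2 * sigma * M * C ^+ 2 / l) * m * (expR (l * r) * (rnorm a * rnorm b)).
      by rewrite /k; field.
    apply: ler_wpM2r; first by rewrite mulr_ge0 ?expR_ge0.
    rewrite (mulrC _ m); apply: ler_wpM2l => //.
    by rewrite ler_pdivrMr // /l; lra.
  by rewrite mulrDl; lra.
have Ds : D (s, (x, y)) by split => //=; rewrite /h; lra.
have := absorb (D := D) (v := v) (w := w) _ _ w0 hmax step Ds.
rewrite /v /w /= subrK => hv; apply: le_trans (hv _ _) _.
- by rewrite !mulr_ge0.
- by rewrite mulr_ge0.
have -> : L * (t - s) * rnorm x * rnorm y =
  2 * (c * C ^+ 2 * h) * (expR (l * T) * (rnorm x * rnorm y)) by rewrite /L /h; ring.
rewrite ler_wpM2l ?mulr_ge0 // ler_wpM2r ?mulr_ge0 ?rnorm_ge0 //.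
by rewrite ler_expR ler_pM2l //; lra.
Qed.

End RiccatiLipschitz.

Section RiccatiDerivativeNorm.
Context {R : realType} {H : hilbertType R}.
Context {DA : set H} {A : H -> H} {e : R -> H -> H} {T C : R}.
Variables (Q S P0 : H -> H) (P : R -> H -> H).
Hypothesis sg : parabolic DA A e T C.
Hypotheses (T0 : 0 < T) (sQ : SigmaP Q) (sS : SigmaP S).
Hypothesis hP : is_solution (riccati_rhs DA A Q S) T P0 P.

(** Difference quotients, and so the derivative, are bounded by the Lipschitz
constant. This is where [P0] has to be in the domain. *)
Lemma opderive_norm_fin : calA_dom DA A P0 ->
  exists2 L, 0 <= L & norm_inf T (opderive P) = L%:E.
Proof.
move=> dP0.
have [kappa kappa0 hQ] : exists2 k, 0 <= k & opb k Q.
  by apply: bounded_linear_opb; case: sQ => [[]].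
have [sigma sigma0 hS] : exists2 k, 0 <= k & opb k S.
  by apply: bounded_linear_opb; case: sS => [[]].
have [M M0 hM] := ric_uniform_bound T0 hP.
have [c c0 hc] := first_increment_lip sg kappa0 hQ sigma0 hS hP M0 hM dP0.
have [L L0 hL] := increment_lip sg sS sigma0 hS hP M0 hM c0 hc.
have Lub : (norm_inf T (opderive P) <= L%:E)%E.
  apply: ge_ereal_sup => _ [t ht <-]; apply: opb_opnorm => // x.
  have [bD hD] := ric_opderive hP ht.
  have hv := @opderiv_app _ _ _ _ _ _ x bD hD.
  rewrite leNgt; apply/negP => hlt.
  have d0 : 0 < rnorm (opderive P t x) - L * rnorm x by rewrite subr_gt0.
  have [h [h1 h2 h3]] : exists h, [/\ t + h \in `]0, T[, h != 0 &
     `|rnorm ((h^-1)%:C *: (P (t + h) x - P t x) - opderive P t x)| <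
       rnorm (opderive P t x) - L * rnorm x].
    have hn : \forall h \near (0 : R)^',
        `|rnorm ((h^-1)%:C *: (P (t + h) x - P t x) - opderive P t x)| <
          rnorm (opderive P t x) - L * rnorm x by apply: cvgr0_norm_lt d0.
    apply: (filter_ex (F := (0 : R)^')).
    near=> h; split; near: h; [exact: near_in|exact: near0_neq|exact: hn].
  rewrite ger0_norm ?rnorm_ge0 // in h3.
  have hdiff : rnorm (P (t + h) x - P t x) <= L * `|h| * rnorm x.
    move: ht h1; rewrite !in_itv /= => /andP[t0 tT] /andP[h10 h1T].
    case: (leP 0 h) => hs.
      have := @hL t (t + h) x (ltW t0) _ (ltW h1T); rewrite lerDl => /(_ hs).
      by rewrite addrAC subrr add0r ger0_norm.
    rewrite rnormBC.
    have := @hL (t + h) t x (ltW h10) _ (ltW tT); rewrite gerDl => /(_ (ltW hs)).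
    by rewrite opprD addrA subrr add0r ltr0_norm.
  have hq : rnorm ((h^-1)%:C *: (P (t + h) x - P t x)) <= L * rnorm x.
    rewrite rnormZr normfV ler_pdivrMl ?normr_gt0 //.
    by apply: le_trans hdiff _; rewrite mulrA (mulrC _ L).
  have := ler_rnormDB (opderive P t x) ((h^-1)%:C *: (P (t + h) x - P t x) - opderive P t x).
  by rewrite (addrC (opderive P t x)) subrK; lra.
have : (0 <= norm_inf T (opderive P))%E.
  have hT : (T / 2) \in `]0, T[ by have t0 := T0; rewrite in_itv /=; lra.
  apply: le_trans (opnorm_ge0 (opderive P (T / 2))) _; apply: ereal_sup_ubound; exists (T / 2) => //.
by move: Lub; case: (norm_inf T _) => // r _ r0; exists r; rewrite -?lee_fin.
Unshelve. all: by end_near. Qed.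

Lemma ric_lip L : 0 <= L -> norm_inf T (opderive P) = L%:E ->
  forall s t x, 0 <= s -> s <= t -> t <= T ->
    rnorm (P t x - P s x) <= L * (t - s) * rnorm x.
Proof.
move=> L0 hL s t x s0 st tT.
apply: rnorm_le_dual => [|y]; first by rewrite !mulr_ge0 ?rnorm_ge0 ?subr_ge0.
rewrite ripBl; apply: le_trans (ler_norm _) _.
have -> : L * (t - s) * rnorm x * rnorm y = L * rnorm x * rnorm y * (t - s) by ring.
apply: (mean_value_cst (g := fun r => rip (P r x) y) (dg := fun r => rip (opderive P r x) y)) => //.
- move=> r hr; have hr' : r \in `]0, T[ by move: hr; rewrite !in_itv /=; lra.
  have [bD hD] := ric_opderive hP hr'.
  have := rderiv_rip (@opderiv_app _ _ _ _ _ _ x bD hD) (vderiv_cst y r).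
  by rewrite rip0r addr0.
- apply: rcont_rip; last exact: vcont_cst.
  exact: vcont_sub s0 tT (ric_cont hP x).
- move=> r hr; have hr' : r \in `]0, T[ by move: hr; rewrite !in_itv /=; lra.
  have [bD _] := ric_opderive hP hr'.
  apply: le_trans (abs_rip_le _ _) _; rewrite ler_wpM2r ?rnorm_ge0 //.
  apply: (opnorm_opb bD.1); rewrite -hL; apply: ereal_sup_ubound.
  by exists r.
Qed.

End RiccatiDerivativeNorm.

(** * Local and global errors of the splitting *)

(** Sum of the costs of moving time in [P] ([L C]), moving the orbit
([2 C K]) and moving time in the quadratic flow ([sigma K ^+ 2 C]), times the
Lipschitz constant [2 sigma K C] of the quadratic term. *)
Definition local_cst {R : realType} (C sigma L K : R) :=
  2 * sigma * K * C * (L * C + 2 * C * K + sigma * K ^+ 2 * C).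

Lemma local_cst_ge0 {R : realType} (C sigma L K : R) :
  0 <= C -> 0 <= sigma -> 0 <= L -> 0 <= K -> 0 <= local_cst C sigma L K.
Proof.
by move=> *; rewrite /local_cst !mulr_ge0 // !addr_ge0 // !mulr_ge0 ?exprn_ge0.
Qed.

Section LieSplitting.
Context {R : realType} {H : hilbertType R}.
Context {DA : set H} {A : H -> H} {eA : R[i] -> H -> H} {T C : R}.
Variables (Q S P0 : H -> H) (P : R -> H -> H) (kappa sigma M L : R).
Let e (t : R) := eA t%:C.
Hypothesis sg : parabolic DA A e T C.
Hypotheses (T0 : 0 < T) (sQ : SigmaP Q) (sS : SigmaP S).
Hypotheses (kappa0 : 0 <= kappa) (hQ : opb kappa Q).
Hypotheses (sigma0 : 0 <= sigma) (hS : opb sigma S).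
Hypothesis hP : is_solution (riccati_rhs DA A Q S) T P0 P.
Hypotheses (M0 : 0 <= M) (hM : forall t, t \in `[0, T] -> opb M (P t)).
Hypotheses (L0 : 0 <= L) (hL : forall s t x, 0 <= s -> s <= t -> t <= T ->
  rnorm (P t x - P s x) <= L * (t - s) * rnorm x).

Let C0 : 0 <= C. Proof. exact: le_trans ler01 (sg_C1 sg). Qed.
Let C1 : 1 <= C. Proof. exact: (sg_C1 sg). Qed.
Let lS : linear S. Proof. by case: sS => [[[]]]. Qed.

Variable K : R.
Hypotheses (K0 : 0 <= K) (hK : C ^+ 2 * (M + T * kappa) <= K).

Let MK : M <= K.
Proof.
apply: le_trans hK; rewrite -[leLHS]mul1r; apply: ler_pM => //; first by rewrite exprn_ege1.
by rewrite lerDl mulr_ge0 // ltW.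
Qed.

Let hMK t : t \in `[0, T] -> opb K (P t).
Proof. by move=> /hM; exact: opb_le. Qed.

Variable tau : R.
Hypotheses (tau0 : 0 < tau) (tauT : tau <= T) (small : tau * (4 * sigma * K) <= 1).

Let small' : tau * (sigma * K) <= 2^-1.
Proof.
have h := small; have h0 : 0 <= tau * (sigma * K) by rewrite !mulr_ge0 // ltW.
have e4 : tau * (4 * sigma * K) = 4 * (tau * (sigma * K)) by ring.
rewrite e4 in h; lra.
Qed.

Let tau_in : tau \in `[0, tau].
Proof. by rewrite in_itv /= lexx ltW. Qed.

(** For [k > 0] use [sg_dist] from time [k tau] on: the shift [s <= tau] gives
the factor [tau / (k tau)]. For [k = 0] only boundedness is available, and the
form [2 C / (k + 1)] covers both. *)
Lemma orbit_increment s (k : nat) x : 0 <= s <= tau -> tau + k%:R * tau <= T ->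
  rnorm (e (tau - s) (e (k%:R * tau) x) - e tau (e (k%:R * tau) x)) <=
  2 * C / k.+1%:R * rnorm x.
Proof.
move=> /andP[s0 st] hk.
have t0 := tau0; have tT := tauT; have c0 := C0.
have kt0 : 0 <= k%:R * tau by rewrite mulr_ge0 // ltW.
rewrite -!(sgD sg) // ?subr_ge0 ?(ltW t0) //.
case: k hk kt0 => [|k] hk kt0.
  rewrite mul0r !addr0 divr1; apply: le_trans (ler_rnormB _ _) _.
  have h1 : rnorm (e (tau - s) x) <= C * rnorm x by apply: (sg_opb sg); lra.
  have h2 : rnorm (e tau x) <= C * rnorm x by apply: (sg_opb sg); lra.
  by lra.
set d := k.+1%:R * tau in hk kt0 *.
have d0 : 0 < d by rewrite mulr_gt0.
have a1 : d <= tau - s + d by lra.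
have a2 : tau - s + d <= T by lra.
rewrite rnormBC.
apply: le_trans (sg_dist sg x d0 (_ : d <= tau - s + d <= T) (_ : d <= tau + d <= T)) _.
- by rewrite a1.
- by rewrite hk andbT; lra.
rewrite ler_wpM2r ?rnorm_ge0 // ger0_norm; last by lra.
have -> : tau + d - (tau - s + d) = s by ring.
apply: le_trans (_ : _ <= tau * (C / d)) _.
  by rewrite ler_wpM2r // divr_ge0 // ltW.
have -> : tau * (C / d) = C / k.+1%:R.
  by rewrite /d; field; rewrite ?pnatr_eq0 ?gt_eqF.
have hn : (k.+2%:R : R) <= 2 * k.+1%:R.
  by rewrite -natrM ler_nat mul2n -addnn ltnS leq_addl.
rewrite ler_pdivrMr ?ltr0n // mulrAC ler_pdivlMr ?ltr0n //.
have -> : 2 * C * k.+1%:R = C * (2 * k.+1%:R) by ring.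
by rewrite ler_wpM2l.
Qed.

Let quad_diff_le p w p' w' B1 B2 b1 b2 : 0 <= B1 -> 0 <= b1 ->
  rnorm p' <= b2 -> rnorm w <= b1 -> rnorm (p - w) <= B1 -> rnorm (p' - w') <= B2 ->
  `|rip (S p) p' - rip (S w) w'| <= sigma * B1 * b2 + sigma * b1 * B2.
Proof.
move=> B10 b10 hp' hw hpw hpw'.
have -> : rip (S p) p' - rip (S w) w' = rip (S (p - w)) p' + rip (S w) (p' - w').
  by rewrite (linB lS) ripBl ripBr; ring.
apply: le_trans (ler_normD _ _) _.
apply: lerD; apply: le_trans (abs_rip_le _ _) _; apply: ler_pM; rewrite ?rnorm_ge0 //.
  by apply: le_trans (hS _) _; rewrite ler_wpM2l.
by apply: le_trans (hS _) _; rewrite ler_wpM2l.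
Qed.

(** The left-hand side is the increment over [[0, tau]] of [psi], which consists
of the solution along the moving orbit, minus the antiderivative of the source
term, minus the quadratic flow along the frozen orbit. In the derivative the
source terms cancel, and two quadratic terms with close arguments remain. *)
Lemma local_error t (k : nat) (W : R -> H -> H) x y :
  0 <= t -> t + tau <= T -> tau + k%:R * tau <= T ->
  is_solution (G_rhs S) tau (P t) W ->
  rip (P (t + tau) (e (k%:R * tau) x) - exp_F eA Q tau (W tau) (e (k%:R * tau) x))
      (e (k%:R * tau) y)
  <= local_cst C sigma L K * tau * (tau + k.+1%:R^-1) * (rnorm x * rnorm y).
Proof.
move=> t_ge0 ttT kT hW.
set xk := e _ x; set yk := e _ y.
have kt0 : 0 <= k%:R * tau by rewrite mulr_ge0 // ltW.
have t_in : t \in `[0, T] by rewrite in_itv /=; have := tau0; lra.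
have hX := hMK t_in.
have [I [q [qc qd qI]] ->] : exists2 I, antideriv (fun s => rip (Q (e (tau - s) xk)) (e (tau - s) yk)) 0 tau I &
    rip (P (t + tau) xk - exp_F eA Q tau (W tau) xk) yk =
    rip (P (t + tau) xk) yk - (rip (W tau (e tau xk)) (e tau yk) + I).
  have [I hI hF] := exp_F_rip sg sQ kappa0 hQ tau0 tauT (W tau) xk yk.
  by exists I => //; rewrite ripBl hF.
have e0 z : e 0 z = z by rewrite (sg0 sg : e 0 = id).
pose a0 := e tau xk; pose b0 := e tau yk.
pose g s := rip (P (t + s) (e (tau - s) xk)) (e (tau - s) yk).
pose psi s := g s - q s - rip (W s a0) b0.
have -> : rip (P (t + tau) xk) yk - (rip (W tau a0) b0 + I) = psi tau - psi 0.
  rewrite /psi /g subrr !e0 addr0 subr0 (G_sol0 hW) -qI -/a0 -/b0; ring.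
have -> : local_cst C sigma L K * tau * (tau + k.+1%:R^-1) * (rnorm x * rnorm y) =
   local_cst C sigma L K * (tau + k.+1%:R^-1) * (rnorm x * rnorm y) * (tau - 0) by ring.
apply: le_trans (ler_norm _) _.
have orb z r : 0 <= r -> r <= tau -> rnorm (e (tau - r) (e (k%:R * tau) z)) <= C * rnorm z.
  move=> r0 rt; rewrite -(sgD sg) ?subr_ge0 //; apply: (sg_opb sg).
  by have := kT; lra.
apply: (mean_value_cst (g := psi)
  (dg := fun s => (rip (Q (e (tau - s) xk)) (e (tau - s) yk) -
     rip (S (P (t + s) (e (tau - s) xk))) (P (t + s) (e (tau - s) yk))) -
     rip (Q (e (tau - s) xk)) (e (tau - s) yk) - - rip (S (W s a0)) (W s b0)) (ltW tau0)).
- move=> s hs; have := hs; rewrite in_itv /= => hs'.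
  apply: rderivB; last exact: (G_sol_rderiv hW).
  apply: rderivB; last exact: qd.
  by apply: (ric_evol sg hP); [rewrite in_itv /=; lra|lra].
- have gc : {within `[0, tau], continuous g} by apply: (ric_evol_cont sg hP hM); have := tauT; lra.
  have wc := G_sol_rcont (x := a0) (y := b0) hW tau_in.
  by move=> s; exact: continuousB (continuousB (gc s) (qc s)) (wc s).
move=> s hs; have hs0 : s \in `[0, tau] by exact: subset_itv_oo_cc.
move: hs; rewrite in_itv /= => /andP[s0 st].
have ts_in : t + s \in `[0, T] by rewrite in_itv /=; lra.
have Wop := G_sol_opb sS K0 tau0 hX hW hs0.
pose B := L * tau * C + K * (2 * C / k.+1%:R) + tau * (sigma * K ^+ 2) * C.
have pw z : rnorm (P (t + s) (e (tau - s) (e (k%:R * tau) z)) - W s (e tau (e (k%:R * tau) z))) <= B * rnorm z.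
  set a := e (tau - s) _; set a' := e tau _.
  have h1 : rnorm (P (t + s) a - P t a) <= L * tau * C * rnorm z.
    have ts1 : t <= t + s by lra.
    have ts2 : t + s <= T by lra.
    apply: le_trans (hL a t_ge0 ts1 ts2) _.
    have -> : t + s - t = s by ring.
    have -> : L * tau * C * rnorm z = (L * tau) * (C * rnorm z) by ring.
    by apply: ler_pM; rewrite ?mulr_ge0 ?rnorm_ge0 ?ler_wpM2l ?(ltW s0) ?(ltW st) // orb // ltW.
  have h2 : rnorm (P t a - P t a') <= K * (2 * C / k.+1%:R) * rnorm z.
    rewrite -(linB (ric_linear hP t_in)); apply: le_trans (hX _) _.
    rewrite -mulrA ler_wpM2l //; apply: orbit_increment => //.
  have h3 : rnorm (P t a' - W s a') <= tau * (sigma * K ^+ 2) * C * rnorm z.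
    rewrite rnormBC; apply: le_trans (G_sol_dist sS sigma0 hS K0 tau0 hX hW a' hs0) _.
    have ha' : rnorm a' <= C * rnorm z by have := orb z 0 (lexx 0) (ltW tau0); rewrite subr0.
    have -> : tau * (sigma * K ^+ 2) * C * rnorm z = (tau * (sigma * K ^+ 2)) * (C * rnorm z) by ring.
    apply: ler_pM; rewrite ?rnorm_ge0 ?mulr_ge0 ?exprn_ge0 ?(ltW s0) //.
    by rewrite ler_wpM2r ?mulr_ge0 ?exprn_ge0 // ltW.
  have h4 := ler_rnorm_distD (P t a) (P (t + s) a) (W s a').
  have h5 := ler_rnorm_distD (P t a') (P t a) (W s a').
  apply: (le_trans h4); rewrite /B mulrDl mulrDl -addrA; apply: (lerD h1).
  by apply: (le_trans h5); exact: lerD h2 h3.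
have B0 : 0 <= B.
  by rewrite /B !addr_ge0 // !mulr_ge0 ?exprn_ge0 ?invr_ge0 // ltW.
have -> : rip (Q (e (tau - s) xk)) (e (tau - s) yk) -
     rip (S (P (t + s) (e (tau - s) xk))) (P (t + s) (e (tau - s) yk)) -
     rip (Q (e (tau - s) xk)) (e (tau - s) yk) - - rip (S (W s a0)) (W s b0) =
   - (rip (S (P (t + s) (e (tau - s) xk))) (P (t + s) (e (tau - s) yk)) - rip (S (W s a0)) (W s b0)) by ring.
rewrite normrN.
apply: le_trans (quad_diff_le (B1 := B * rnorm x) (B2 := B * rnorm y)
  (b1 := K * (C * rnorm x)) (b2 := K * (C * rnorm y)) _ _ _ _ (pw x) (pw y)) _.
- by rewrite mulr_ge0 ?rnorm_ge0.
- by rewrite !mulr_ge0 ?rnorm_ge0.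
- by apply: le_trans (hMK ts_in _) _; apply: ler_wpM2l => //; apply: orb; exact: ltW.
- apply: le_trans (Wop _) _; rewrite ler_wpM2l //.
  by have := orb x 0 (lexx 0) (ltW tau0); rewrite subr0.
have -> : sigma * (B * rnorm x) * (K * (C * rnorm y)) + sigma * (K * (C * rnorm x)) * (B * rnorm y)
   = 2 * sigma * K * C * B * (rnorm x * rnorm y) by ring.
apply: ler_wpM2r; first by rewrite mulr_ge0 ?rnorm_ge0.
rewrite /local_cst -(mulrA (2 * sigma * K * C)); apply: ler_wpM2l; first by rewrite !mulr_ge0.
have u0 : 0 <= k.+1%:R^-1 :> R by rewrite invr_ge0.
rewrite /B; set u := k.+1%:R^-1 in u0 *.
have i1 : 0 <= L * C * u by rewrite !mulr_ge0.
have i2 : 0 <= 2 * C * K * tau by rewrite !mulr_ge0 // ltW.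
have i3 : 0 <= sigma * K ^+ 2 * C * u by rewrite !mulr_ge0 ?exprn_ge0.
by rewrite -subr_ge0; move: (addr_ge0 (addr_ge0 i1 i2) i3); congr (0 <= _); ring.
Qed.

Let lieS := lie eA Q S tau.
Let Pn n := iter n lieS P0.

(** The form of the iterates is bounded by that of the affine flow, since the
quadratic step only decreases it. *)
Lemma lie_iterate n : n%:R * tau <= T -> SigmaP (Pn n) /\
  forall r x, 0 <= r -> n%:R * tau + r <= T ->
    rip (Pn n (e r x)) (e r x) <= C ^+ 2 * (M + n%:R * tau * kappa) * rnorm x ^+ 2.
Proof.
have t_in0 : 0 \in `[0, T] by rewrite in_itv /= lexx ltW.
have opbK m : SigmaP (Pn m) -> m%:R * tau <= T ->
    (forall r x, 0 <= r -> m%:R * tau + r <= T ->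
      rip (Pn m (e r x)) (e r x) <= C ^+ 2 * (M + m%:R * tau * kappa) * rnorm x ^+ 2) ->
    opb K (Pn m).
  move=> sX mT hm.
  have [/SigmaE[bX symX] posX] := iffLR (SigmaPE _) sX.
  apply: quadratic_opb => //; first by case: bX.
  move=> x; rewrite ger0_norm //.
  have := hm 0 x (lexx 0); rewrite addr0 (sg0 sg : e 0 = id) => /(_ mT) h.
  apply: (le_trans h); apply: ler_wpM2r; first by rewrite exprn_ge0 ?rnorm_ge0.
  apply: le_trans hK; apply: ler_wpM2l; first by rewrite exprn_ge0.
  by rewrite lerD2l; apply: ler_wpM2r.
elim: n => [|n ih] nT.
  split; first by rewrite /Pn /= -(ric0 hP); exact: (ric_SigmaP T0 hP).
  move=> r x r0; rewrite !mul0r add0r addr0 => rT.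
  rewrite /Pn /= -(ric0 hP); apply: le_trans (rip_le _ _) _.
  have rr : 0 <= r <= T by rewrite r0.
  have -> : C ^+ 2 * M * rnorm x ^+ 2 = (M * (C * rnorm x)) * (C * rnorm x) by ring.
  apply: ler_pM; rewrite ?rnorm_ge0 ?(sg_opb sg rr) //.
  by apply: le_trans (hM t_in0 _) _; apply: ler_wpM2l => //; exact: (sg_opb sg rr).
have eS : n.+1%:R * tau = n%:R * tau + tau by rewrite -natr1 mulrDl mul1r.
have nT' : n%:R * tau <= T.
  by apply: le_trans nT; rewrite eS lerDl ltW.
have [sX hX] := ih nT'.
have oX := opbK n sX nT' hX.
have [W hW eW] := exp_G_solution sS sigma0 hS sX K0 oX tau0 small'.
have sW := G_sol_SigmaP tau0 hW tau_in.
have eP : Pn n.+1 = exp_F eA Q tau (W tau) by rewrite /Pn iterS /lieS /lie /= -/lieS -/(Pn n) eW.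
rewrite eP; split; first exact: (exp_F_SigmaP sg sQ kappa0 hQ tau0 tauT sW).
move=> r x r0; rewrite eS -addrA => rT.
have [I hI ->] := exp_F_rip sg sQ kappa0 hQ tau0 tauT (W tau) (e r x) (e r x).
have -> : C ^+ 2 * (M + (n%:R * tau + tau) * kappa) * rnorm x ^+ 2 =
   C ^+ 2 * (M + n%:R * tau * kappa) * rnorm x ^+ 2 +
   (kappa * (C * rnorm x)) * (C * rnorm x) * (tau - 0) by ring.
apply: lerD.
  apply: le_trans (G_sol_le sS hW _ tau_in) _.
  rewrite -/(e tau) -!(sgD sg) // ?(ltW tau0) //.
  by apply: hX => //; rewrite addr_ge0 // ltW.
have nt0 : 0 <= n%:R * tau by rewrite mulr_ge0 // ltW.
apply: le_trans (ler_norm _) _; apply: (antideriv_abs_le (ltW tau0) hI) => s.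
rewrite in_itv /= => /andP[s0 st].
have ee : rnorm (e (tau - s) (e r x)) <= C * rnorm x.
  rewrite -(sgD sg) ?subr_ge0 ?(ltW st) //; apply: (sg_opb sg); lra.
apply: le_trans (abs_rip_le _ _) _; apply: ler_pM; rewrite ?rnorm_ge0 //.
by apply: le_trans (hQ _) _; apply: ler_wpM2l.
Qed.

Lemma lie_iterate_opb n : n%:R * tau <= T -> opb K (Pn n).
Proof.
move=> nT; have [sX hX] := lie_iterate nT.
have [/SigmaE[bX symX] posX] := iffLR (SigmaPE _) sX.
apply: quadratic_opb => //; first by case: bX.
move=> x; rewrite ger0_norm //.
have := hX 0 x (lexx 0); rewrite addr0 (sg0 sg : e 0 = id) => /(_ nT) h.
apply: (le_trans h); apply: ler_wpM2r; first by rewrite exprn_ge0 ?rnorm_ge0.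
apply: le_trans hK; apply: ler_wpM2l; first by rewrite exprn_ge0.
by rewrite lerD2l; apply: ler_wpM2r.
Qed.

Let loc (i : nat) := local_cst C sigma L K * tau * (tau + i.+1%:R^-1).
Let c2 := 4 * sigma * K * C ^+ 2 * tau.

(** The test vectors carry [k] extra steps of the semigroup, so that the
induction step, which applies one more step to them, sees each local error
together with its smoothing. The case [k = 0] of the induction hypothesis bounds
the error by [Lam * (1 + c2) ^+ n]; this feeds the Lipschitz term, and the bound
is chosen so that the recursion closes exactly. *)
Lemma global_error_rec Lam (N : nat) : N%:R * tau <= T ->
  (forall n, (n <= N)%N -> \sum_(0 <= i < n) loc i <= Lam) -> 0 <= Lam ->
  forall n k x y, (n + k <= N)%N ->
  rip (P (n%:R * tau) (e (k%:R * tau) x) - Pn n (e (k%:R * tau) x)) (e (k%:R * tau) y)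
  <= (\sum_(k <= i < n + k) loc i + Lam * ((1 + c2) ^+ n - 1)) * (rnorm x * rnorm y).
Proof.
move=> NT hLam Lam0.
have c20 : 0 <= c2 by rewrite /c2 !mulr_ge0 ?exprn_ge0 // ltW.
have le_T m : (m <= N)%N -> m%:R * tau <= T.
  by move=> mN; apply: le_trans NT; rewrite ler_pM2r // ler_nat.
elim=> [|n ih] k x y nk.
  rewrite mul0r /Pn /= (ric0 hP) subrr rip0l big_geq ?add0n // expr0 subrr mulr0 addr0.
  by rewrite mul0r.
have nk' : (n + k.+1 <= N)%N by rewrite addnS -addSn.
have n1T : n.+1%:R * tau <= T by apply: le_T; apply: leq_trans nk; rewrite leq_addr.
have nN : (n <= N)%N by apply: leq_trans nk'; rewrite leq_addr.
have nT : n%:R * tau <= T by exact: le_T.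
have kT : tau + k%:R * tau <= T.
  have := le_T k.+1 (leq_trans (leq_addl _ _) nk'); by rewrite -nat1r mulrDl mul1r.
have eS : n.+1%:R * tau = n%:R * tau + tau by rewrite -natr1 mulrDl mul1r.
have ekS z : e (k.+1%:R * tau) z = e tau (e (k%:R * tau) z).
  by rewrite -(sgD sg) ?(ltW tau0) ?mulr_ge0 ?(ltW tau0) // -nat1r mulrDl mul1r.
have nt0 : 0 <= n%:R * tau by rewrite mulr_ge0 // ltW.
have t_in : n%:R * tau \in `[0, T] by rewrite in_itv /= nt0.
have sX := ric_SigmaP T0 hP t_in; have [sY _] := lie_iterate nT.
have oX := hMK t_in; have oY := lie_iterate_opb nT.
have [W hW _] := exp_G_solution sS sigma0 hS sX K0 oX tau0 small'.
have [V hV eV] := exp_G_solution sS sigma0 hS sY K0 oY tau0 small'.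
have eP : Pn n.+1 = exp_F eA Q tau (V tau) by rewrite /Pn iterS /lieS /lie /= -/lieS -/(Pn n) eV.
set xk := e (k%:R * tau) x; set yk := e (k%:R * tau) y.
have [I hI hFW] := exp_F_rip sg sQ kappa0 hQ tau0 tauT (W tau) xk yk.
have [J hJ hFV] := exp_F_rip sg sQ kappa0 hQ tau0 tauT (V tau) xk yk.
have {hJ} IJ : J = I by exact: (antideriv_unique (ltW tau0) hJ hI).
have ntT : n%:R * tau + tau <= T by rewrite -eS.
have h1 := local_error x y nt0 ntT kT hW; rewrite -/xk -/yk in h1.
pose d := Lam * (1 + c2) ^+ n.
have d0 : 0 <= d by rewrite mulr_ge0 // exprn_ge0 // addr_ge0.
have hd : opb d (fun z => P (n%:R * tau) z - Pn n z).
  move=> z; apply: rnorm_le_dual => [|z']; first by rewrite mulr_ge0 ?rnorm_ge0.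
  have := ih 0%N z z'; rewrite addn0 mul0r (sg0 sg : e 0 = id) => /(_ nN) h.
  apply: (le_trans h); rewrite -[leRHS]mulrA; apply: ler_wpM2r.
    by rewrite mulr_ge0 ?rnorm_ge0.
  by rewrite /d mulrBr mulr1; have := hLam n nN; lra.
have h2 := G_sol_increment_lip sS sigma0 hS K0 tau0 oX oY hW hV d0 hd small (e tau xk) (e tau yk) tau_in.
have h3 := ih k.+1 x y nk'; rewrite !ekS -/xk -/yk in h3.
have ek z : rnorm (e tau (e (k%:R * tau) z)) <= C * rnorm z.
  rewrite -ekS; apply: (sg_opb sg); rewrite -nat1r mulrDl mul1r kT andbT.
  by rewrite addr_ge0 ?mulr_ge0 // ltW.
have h4 : 2 * (2 * sigma * K * tau * d) * (rnorm (e tau xk) * rnorm (e tau yk)) <=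
    c2 * d * (rnorm x * rnorm y).
  have -> : c2 * d * (rnorm x * rnorm y) =
    2 * (2 * sigma * K * tau * d) * ((C * rnorm x) * (C * rnorm y)) by rewrite /c2; ring.
  apply: ler_wpM2l; first by apply: mulr_ge0 => //; apply: mulr_ge0 => //; rewrite !mulr_ge0 // ltW.
  by apply: ler_pM; rewrite ?rnorm_ge0 ?ek.
rewrite eS eP; move: h1 h2 h3; rewrite !ripBl hFW hFV IJ => h1 h2 h3.
have knk : (k < n + k.+1)%N by rewrite addnS ltnS leq_addl.
rewrite addSnnS (big_ltn knk) exprS.
set Sg := \sum_(_ <= _ < _) _ in h3 *; set E := (1 + c2) ^+ n in h3 d d0 hd h2 h4 *.
have -> : (loc k + Sg + Lam * ((1 + c2) * E - 1)) * (rnorm x * rnorm y) =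
  loc k * (rnorm x * rnorm y) + (Sg + Lam * (E - 1)) * (rnorm x * rnorm y) +
  c2 * d * (rnorm x * rnorm y) by rewrite /d; ring.
have h24 := le_trans h2 h4; rewrite -!/(e tau) in h1 *.
rewrite /loc; apply: le_trans (lerD (lerD h1 h3) h24).
by rewrite le_eqVlt; apply/orP; left; apply/eqP; ring.
Qed.

End LieSplitting.

(** * Summation of the errors *)

(** [ln (1 - u) <= - u] with [u = 1 / (n + 2)]. *)
Lemma harmonic_le {R : realType} (N : nat) : (0 < N)%N ->
  \sum_(0 <= i < N) (i.+1%:R^-1 : R) <= 1 + ln N%:R.
Proof.
elim: N => // -[_ _|n ih _]; first by rewrite big_nat1 invr1 ln1 addr0.
rewrite big_nat_recr //=; apply: le_trans (lerD (ih isT) (lexx _)) _.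
rewrite -addrA lerD2l.
have n1 : 0 < n.+1%:R :> R by rewrite ltr0n.
have n2 : 0 < n.+2%:R :> R by rewrite ltr0n.
have q0 : 0 < n.+1%:R / n.+2%:R :> R by rewrite divr_gt0.
have h : ln (n.+1%:R / n.+2%:R) <= - (n.+2%:R^-1) :> R.
  have -> : n.+1%:R / n.+2%:R = 1 + - (n.+2%:R^-1) :> R.
    have -> : n.+1%:R = n.+2%:R - 1 :> R by rewrite -[n.+2%:R](@natr1 _ n.+1) addrK.
    by rewrite mulrBl divff ?gt_eqF // mul1r.
  by apply: le_ln1Dx; rewrite ltrN2 invf_lt1 // ltr1n.
by rewrite ln_div ?posrE // lerBlDr addrC in h; rewrite -lerBrDr.
Qed.

Section Final.
Context {R : realType}.

(** The harmonic sum is at most [1 + ln (T / tau)]. *)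
Lemma local_sum_le (T tau c : R) (N : nat) : 0 < T -> (0 < N)%N -> tau = T / N%:R ->
  0 <= c ->
  \sum_(0 <= i < N) (c * tau * (tau + i.+1%:R^-1)) <=
  c * (T + 1 + `|ln T|) * tau * (1 + `|ln tau|).
Proof.
move=> T0 N0 etau c0.
have Np : 0 < N%:R :> R by rewrite ltr0n.
have tau0 : 0 < tau by rewrite etau divr_gt0.
rewrite -mulr_sumr big_split /= big_const_nat subn0 iter_addr_0 -mulr_natr.
have -> : tau * N%:R = T by rewrite etau divfK // gt_eqF.
have hN : ln N%:R = ln T - ln tau :> R.
  by rewrite etau ln_div ?posrE //; ring.
have h := @harmonic_le R N N0; rewrite hN in h.
have ct : 0 <= c * tau by rewrite mulr_ge0 // ltW.
have -> : c * (T + 1 + `|ln T|) * tau * (1 + `|ln tau|) =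
  c * tau * ((T + 1 + `|ln T|) * (1 + `|ln tau|)) by ring.
apply: ler_wpM2l => //.
have a0 := normr_ge0 (ln T); have b0 := normr_ge0 (ln tau).
have a1 := ler_norm (ln T); have b1 := ler_norm (- ln tau); rewrite normrN in b1.
have p1 : 0 <= T * `|ln tau| by rewrite mulr_ge0 // ltW.
have p2 : 0 <= `|ln T| * `|ln tau| by rewrite mulr_ge0.
nra.
Qed.

Lemma compound_le (x : R) n : 0 <= x -> (1 + x) ^+ n <= expR (n%:R * x).
Proof.
move=> x0; rewrite mulrC expRM_natr; apply: lerXn2r; rewrite ?nnegrE ?expR_ge0 ?addr_ge0 //.
exact: expR_ge1Dx.
Qed.

End Final.

Lemma adj_comp_SigmaP {R : realType} {H Y : hilbertType R} (E : H -> Y) :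
  bounded_linear E -> SigmaP (adj E \o E).
Proof.
move=> bE; have bA := adj_bounded bE.
have ripE x y : rip (adj E (E x)) y = rip (E x) (E y) by rewrite ripC -adjP // ripC.
apply/SigmaPE; split; last by move=> x /=; rewrite ripE ripxx sqr_ge0.
apply/SigmaE; split; first exact: comp_bounded.
by move=> x y /=; rewrite ripE (ripC x) ripE ripC.
Qed.

Lemma comp_adj_SigmaP {R : realType} {H U : hilbertType R} (B : U -> H) :
  bounded_linear B -> SigmaP (B \o adj B).
Proof.
move=> bB; have bA := adj_bounded bB.
have ripB x y : rip (B (adj B x)) y = rip (adj B x) (adj B y) by rewrite adjP.
apply/SigmaPE; split; last by move=> x /=; rewrite ripB ripxx sqr_ge0.
apply/SigmaE; split; first exact: comp_bounded.
by move=> x y /=; rewrite ripB (ripC x) ripB ripC.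
Qed.

Unset Implicit Arguments.

Theorem theorem3p3 (R : realType) (T CA : R) (nP ndP nS nQ : \bar R)
    (T_gt0 : 0 < T) :
  exists D taustar : R, [/\ 0 < D, 0 < taustar &
    forall (H U Y : hilbertType R) (DA : set H) (A : H -> H)
      (eA : R[i] -> H -> H) (B : U -> H) (E : H -> Y) (P0 : H -> H)
      (P : R -> H -> H),
    let Q := adj E \o E in
    let S := B \o adj B in
    bounded_linear B -> bounded_linear E ->
    SigmaP P0 -> calA_dom DA A P0 ->
    analytic_semigroup eA -> is_generator eA DA A ->
    (forall t, 0 < t <= T ->
       (opnorm (eA t%:C) <= CA%:E)%E /\
       (opnorm (A \o eA t%:C) <= (CA / t)%:E)%E) ->
    is_solution (riccati_rhs DA A Q S) T P0 P ->
    norm_inf T P = nP -> norm_inf T (opderive P) = ndP ->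
    opnorm S = nS -> opnorm Q = nQ ->
    forall N n : nat, (0 < N)%N -> (n <= N)%N ->
      let tau := T / N%:R in
      tau <= taustar ->
      (opnorm (P (n%:R * tau) \- iter n (lie eA Q S tau) P0)%R
         <= (D * tau * (1 + `|ln tau|))%:E)%E].
Proof.
(* the suprema are turned into reals by [fine]; they are finite, and the
   absolute value only makes the constants nonnegative beforehand *)
pose C := Num.max 1 CA.
pose M : R := `|fine nP|; pose L : R := `|fine ndP|.
pose sigma : R := `|fine nS|; pose kappa : R := `|fine nQ|.
pose K := C ^+ 2 * (M + T * kappa).
pose c := local_cst C sigma L K.
pose D := c * (T + 1 + `|ln T|) * expR (4 * sigma * K * C ^+ 2 * T) + 1.
have C1 : 1 <= C by rewrite /C le_max lexx.
have C0 : 0 <= C by exact: le_trans ler01 C1.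
have M0 : 0 <= M by exact: normr_ge0.
have L0 : 0 <= L by exact: normr_ge0.
have sigma0 : 0 <= sigma by exact: normr_ge0.
have kappa0 : 0 <= kappa by exact: normr_ge0.
have T0 := T_gt0.
have K0 : 0 <= K by rewrite /K mulr_ge0 ?exprn_ge0 // addr_ge0 // mulr_ge0 // ltW.
have c0 : 0 <= c by exact: local_cst_ge0.
have TT0 : 0 <= T + 1 + `|ln T| by rewrite !addr_ge0 ?normr_ge0 // ltW.
have D0 : 0 < D.
  by apply: ltr_wpDl => //; apply: mulr_ge0; [exact: mulr_ge0|exact: expR_ge0].
have sK00 : 0 <= 4 * sigma * K by apply: mulr_ge0 => //; exact: mulr_ge0.
have sK0 : 0 < 4 * sigma * K + 1 by exact: ltr_wpDl.
(* the step restriction gives tau * (4 sigma K) <= 1, under which the quadratic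
   flow exists and its increments are absorbed *)
exists D, (4 * sigma * K + 1)^-1; split => //; first by rewrite invr_gt0.
move=> H U Y DA A eA B E P0 P Q S bB bE sP0 dP0 an gen hC hP eP edP eS eQ N n N0 nN tau htau.
have sg := analytic_parabolic an gen hC; rewrite -/C in sg.
have sQ : SigmaP Q by exact: adj_comp_SigmaP.
have sS : SigmaP S by exact: comp_adj_SigmaP.
have bQ : bounded_linear Q by case: sQ => [[]].
have bS : bounded_linear S by case: sS => [[]].
have hQ : opb kappa Q.
  have [k k0 ek] := opnorm_fin bQ; apply: (opnorm_opb bQ.1).
  by rewrite /kappa -eQ ek /= ger0_norm.
have hS : opb sigma S.
  have [k k0 ek] := opnorm_fin bS; apply: (opnorm_opb bS.1).
  by rewrite /sigma -eS ek /= ger0_norm.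
have hM : forall t, t \in `[0, T] -> opb M (P t).
  have [k k0 ek] := norm_inf_fin T0 hP.
  have -> : M = k by rewrite /M -eP ek /= ger0_norm.
  exact: (norm_inf_opb T0 hP k0 ek).
have hL : forall s t x, 0 <= s -> s <= t -> t <= T ->
    rnorm (P t x - P s x) <= L * (t - s) * rnorm x.
  have [k k0 ek] := opderive_norm_fin sg T0 sQ sS hP dP0.
  have -> : L = k by rewrite /L -edP ek /= ger0_norm.
  exact: (ric_lip hP k0 ek).
have Np : 0 < N%:R :> R by rewrite ltr0n.
have tau0 : 0 < tau by rewrite divr_gt0.
have NT : N%:R * tau = T by rewrite /tau mulrC divfK // gt_eqF.
have tauT : tau <= T by rewrite /tau ler_pdivrMr // ler_pMr // ler1n.
have small : tau * (4 * sigma * K) <= 1.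
  move: htau; rewrite -[(_)^-1]mul1r ler_pdivlMr // mulrDr mulr1; have := ltW tau0; lra.
pose loc i := local_cst C sigma L K * tau * (tau + i.+1%:R^-1).
pose Lam := \sum_(0 <= i < N) loc i.
have loc0 i : 0 <= loc i.
  apply: mulr_ge0; first by apply: mulr_ge0; [exact: c0|exact: ltW].
  by apply: addr_ge0; [exact: ltW|rewrite invr_ge0].
have Lam_ge m : (m <= N)%N -> \sum_(0 <= i < m) loc i <= Lam.
  move=> mN.
  have -> : Lam = \sum_(0 <= i < m) loc i + \sum_(m <= i < N) loc i.
    by rewrite /Lam -big_cat_nat.
  rewrite lerDl.
  by apply: sumr_ge0 => i _; exact: loc0.
have Lam0 : 0 <= Lam by apply: sumr_ge0 => i _; exact: loc0.
have NT' : N%:R * tau <= T by rewrite NT.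
have n0 : (n + 0 <= N)%N by rewrite addn0.
have key := global_error_rec sg T0 sQ sS kappa0 hQ sigma0 hS hP M0 hM L0 hL K0 (lexx _) tau0 tauT small
  NT' Lam_ge Lam0.
have s0 : 0 <= 4 * sigma * K * C ^+ 2 by apply: mulr_ge0; [exact: sK00|exact: exprn_ge0].
have st0 : 0 <= 4 * sigma * K * C ^+ 2 * tau by apply: mulr_ge0 => //; exact: ltW.
have LamD : Lam * (1 + 4 * sigma * K * C ^+ 2 * tau) ^+ n <= D * tau * (1 + `|ln tau|).
  have h1 : Lam <= c * (T + 1 + `|ln T|) * tau * (1 + `|ln tau|).
    exact: local_sum_le T0 N0 erefl c0.
  have h2 : (1 + 4 * sigma * K * C ^+ 2 * tau) ^+ n <= expR (4 * sigma * K * C ^+ 2 * T).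
    apply: (le_trans (compound_le n st0)).
    rewrite ler_expR mulrCA; apply: ler_wpM2l => //; rewrite -NT ler_wpM2r ?ler_nat //.
    exact: ltW.
  apply: le_trans (ler_pM Lam0 _ h1 h2) _.
    by apply: exprn_ge0; apply: addr_ge0.
  rewrite /D; set X := c * (T + 1 + `|ln T|); set F := expR _; set Z := 1 + `|ln tau|.
  have Z0 : 0 <= Z by rewrite /Z addr_ge0 ?normr_ge0.
  have tZ : 0 <= tau * Z by rewrite mulr_ge0 // ltW.
  by rewrite -subr_ge0; move: tZ; congr (0 <= _); ring.
have rhs0 : 0 <= D * tau * (1 + `|ln tau|) by apply: mulr_ge0; [apply: mulr_ge0; exact: ltW|apply: addr_ge0; rewrite ?normr_ge0].
apply: opb_opnorm => // x; apply: rnorm_le_dual => [|y]; first by apply: mulr_ge0; rewrite ?rnorm_ge0.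
have := key n 0%N x y n0; rewrite mul0r (sg0 sg) /= addn0 => h.
apply: (le_trans h); rewrite -[leRHS]mulrA; apply: ler_wpM2r; first by rewrite mulr_ge0 ?rnorm_ge0.
by apply: le_trans LamD; rewrite mulrBr mulr1; have := Lam_ge n nN; lra.
Qed.
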